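(* Exact-Unique-DeleteAcceptability can be solved in $O(n^2)$ time.
   Context: A Stable Marriage (SM) instance consists of a set $U$ of men and a set $W$ of women with $|U|=|W|=n$, and for every agent a strict total order (preference list) over all agents of the opposite gender. In a Stable Marriage with Incomplete Lists (SMI) instance each agent's list is a strict order over a subset of the opposite gender; $m,w$ are mutually acceptable if each appears in the other's list (in an SM instance all pairs are mutually acceptable). A matching is a set of mutually acceptable man–woman pairs in which each agent appears at most once; it is complete if every agent is in a pair. A mutually acceptable pair $\{m,w\}$ blocks a matching $M$ if ($m$ is unassigned or prefers $w$ to his partner in $M$) and ($w$ is unassigned or prefers $m$ to her partner in $M$); $M$ is stable if no pair blocks it. Delete Acceptability action: choose a man–woman pair $\{m,w\}$ and remove $w$ from $m$'s list and $m$ from $w$'s list; costs one action. Exact-Unique-DeleteAcceptability: given an SM instance, a complete matching $M^*$ and a budget $\ell$, decide whether at most $\ell$ Delete Acceptability actions can be performed such that $M^*$ is the unique stable matching of the altered (SMI) instance. *)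

(* Defs.v *)
From mathcomp Require Import all_boot all_fingroup.
Set Implicit Arguments. Unset Strict Implicit. Unset Printing Implicit Defensive.

(* Men and women are both indexed by 'I_n.  A preference list of a man is a
   sequence of women (most preferred first), and vice versa. *)

(* SM instance: every list is a strict total order over ALL agents of the
   opposite gender, i.e. a duplicate-free enumeration of 'I_n. *)
Definition SM_instance (n : nat) (pM pW : 'I_n -> seq 'I_n) : Prop :=
  forall i : 'I_n, perm_eq (pM i) (enum 'I_n) /\ perm_eq (pW i) (enum 'I_n).

Definition delM (n : nat) (pM : 'I_n -> seq 'I_n) (D : {set 'I_n * 'I_n})
  (m : 'I_n) : seq 'I_n := [seq w <- pM m | (m, w) \notin D].
Definition delW (n : nat) (pW : 'I_n -> seq 'I_n) (D : {set 'I_n * 'I_n})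
  (w : 'I_n) : seq 'I_n := [seq m <- pW w | (m, w) \notin D].

Definition acceptable (n : nat) (LM LW : 'I_n -> seq 'I_n) (m w : 'I_n) : bool :=
  (w \in LM m) && (m \in LW w).

Definition prefers (T : eqType) (l : seq T) (a b : T) : bool :=
  index a l < index b l.

Definition is_matching (n : nat) (LM LW : 'I_n -> seq 'I_n)
  (M : {set 'I_n * 'I_n}) : Prop :=
  (forall p, p \in M -> acceptable LM LW p.1 p.2) /\
  (forall p q, p \in M -> q \in M -> p.1 = q.1 -> p = q) /\
  (forall p q, p \in M -> q \in M -> p.2 = q.2 -> p = q).

(* {m,w} blocks M: mutually acceptable, m unassigned or prefers w to his
   partner, and w unassigned or prefers m to her partner. *)
Definition blocks (n : nat) (LM LW : 'I_n -> seq 'I_n)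
  (M : {set 'I_n * 'I_n}) (m w : 'I_n) : Prop :=
  acceptable LM LW m w /\
  (forall w', (m, w') \in M -> prefers (LM m) w w') /\
  (forall m', (m', w) \in M -> prefers (LW w) m m').

Definition stable (n : nat) (LM LW : 'I_n -> seq 'I_n)
  (M : {set 'I_n * 'I_n}) : Prop :=
  is_matching LM LW M /\ forall m w, ~ blocks LM LW M m w.

Definition unique_stable (n : nat) (LM LW : 'I_n -> seq 'I_n)
  (M : {set 'I_n * 'I_n}) : Prop :=
  stable LM LW M /\ forall M', stable LM LW M' -> M' = M.

(* A complete matching of an SM instance is a bijection men -> women. *)
Definition matching_of_perm (n : nat) (mu : {perm 'I_n}) : {set 'I_n * 'I_n} :=
  [set (m, mu m) | m : 'I_n].

Definition EUDA (n : nat) (pM pW : 'I_n -> seq 'I_n) (mu : {perm 'I_n})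
  (ell : nat) : Prop :=
  exists D : {set 'I_n * 'I_n},
    #|D| <= ell /\ unique_stable (delM pM D) (delW pW D) (matching_of_perm mu).

Inductive instr : Type :=
| Iconst of nat & nat
| Iadd   of nat & nat & nat
| Isub   of nat & nat & nat
| Iload  of nat & nat
| Istore of nat & nat
| Ijlt   of nat & nat & nat
| Ijmp   of nat
| Ihalt.

Record state : Type := State { ram_pc : nat; ram_regs : nat -> nat; ram_mem : nat -> nat }.

Definition upd (f : nat -> nat) (a v : nat) : nat -> nat :=
  fun x => if x == a then v else f x.

Definition fetch (prog : seq instr) (s : state) : instr := nth Ihalt prog (ram_pc s).

Definition is_halted (prog : seq instr) (s : state) : bool :=
  if fetch prog s is Ihalt then true else false.

Definition step (prog : seq instr) (s : state) : state :=
  let R := ram_regs s in let Mm := ram_mem s in let p := ram_pc s in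
  match fetch prog s with
  | Iconst r k => State p.+1 (upd R r k) Mm
  | Iadd r a b => State p.+1 (upd R r (R a + R b)) Mm
  | Isub r a b => State p.+1 (upd R r (R a - R b)) Mm
  | Iload r a => State p.+1 (upd R r (Mm (R a))) Mm
  | Istore a r => State p.+1 R (upd Mm (R a) (R r))
  | Ijlt a b t => State (if R a < R b then t else p.+1) R Mm
  | Ijmp t => State t R Mm
  | Ihalt => s
  end.

Fixpoint exec (prog : seq instr) (t : nat) (s : state) : option state :=
  if is_halted prog s then Some s else
  match t with
  | 0 => None
  | t'.+1 => exec prog t' (step prog s)
  end.

(* Input encoding of an instance: memory cells
   0: n, 1: ell,
   2 + i*n + k           : k-th entry (0-based) of man i's list,
   2 + n*n + j*n + k     : k-th entry of woman j's list,
   2 + 2*n*n + i         : partner of man i in M*,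
   all other cells 0.  Registers start at 0, ram_pc at 0. *)
Definition encode (n : nat) (pM pW : 'I_n -> seq 'I_n) (mu : {perm 'I_n})
  (ell : nat) : seq nat :=
  [:: n; ell] ++ flatten [seq map val (pM m) | m <- enum 'I_n]
              ++ flatten [seq map val (pW w) | w <- enum 'I_n]
              ++ [seq val (mu m) | m <- enum 'I_n].

Definition init_state (input : seq nat) : state :=
  State 0 (fun _ => 0) (fun a => nth 0 input a).

(* Main.v *)
Require Import Defs.
From mathcomp Require Import all_boot all_fingroup.
From mathcomp Require Import zify.
Set Implicit Arguments. Unset Strict Implicit. Unset Printing Implicit Defensive.

(** Every blocking pair of M* must be deleted, and no pair of M* may be.  What
    remains is to destroy all other stable matchings.  Let the candidates of an
    agent a be the agents that a ranks below its M*-partner and that prefer a to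
    their own M*-partner, and draw an edge from a to the M*-partner of the first
    candidate of a that has not been deleted, or to a sink if there is none.
    Rotating along a cycle of this functional graph gives another stable matching,
    and every other stable matching yields a set of agents of one side that is
    closed under the edges; so M* is unique iff both graphs are acyclic.  Since the
    j-th candidate (from 0) comes first after exactly j deletions, the number of
    deletions is the number of blocking pairs plus the minimum cost of an
    arborescence into the sink, on the disjoint union of both sides, where the
    j-th edge of a vertex costs j.

    The cost structure makes Edmonds' algorithm quadratic.  A path of contracted
    components is grown from an unfinished vertex; the dual variable of the last
    component is raised by one by advancing the pointer of each of its vertices to
    the next candidate, until some pointer leaves the component.  The component
    is then linked to a new vertex, merged with part of the path, or the whole path
    is finished.  Each advance consumes a list entry, and the minimum cost is the
    number of raises. *)

(** * A structured language compiled to the RAM *)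

(** The costs of the two sides add up for a simple reason. A pair outside M* shows one of four
    preference patterns: both members prefer each other to their M*-partners (blocking), only the
    woman does (a candidate of the man), only the man does (a candidate of the woman), or neither
    does. So a deletion shortens at most one list of candidates. Within such a list only a prefix is
    worth deleting, because the edge depends on the first survivor alone.

    In general Edmonds' algorithm calls for a priority queue and a union-find structure. A merged
    block is scanned again from its start; each merge removes a component and at most 2n are ever
    created, so this costs quadratic time in total.

    The time bound concerns RAM instructions. Programs are therefore written in a language whose
    semantics counts the instructions of the compiled code, and loops are bounded by potentials. *)

Inductive expr : Type :=
| EVar of nat
| ECst of nat
| EAdd of expr & expr
| ESub of expr & expr
| EMem of expr
| EArr of nat & expr.

Inductive cmd : Type :=
| CSkip
| CSet of nat & expr
| CPut of nat & expr & expr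
| CSeq of cmd & cmd
| CIf of expr & expr & cmd & cmd
| CWhile of expr & expr & cmd.

Record env : Type := Env { vars : nat -> nat; arrs : nat -> nat -> nat }.

Definition setv (s : env) (x v : nat) : env := Env (upd (vars s) x v) (arrs s).
Definition seta (s : env) (j x v : nat) : env :=
  Env (vars s) (fun j' => if j' == j then upd (arrs s j) x v else arrs s j').

(* Register 0 holds the base address of the arrays, the other even registers
   are temporaries, the odd registers hold the program variables. *)
Definition tmp (d : nat) : nat := d.*2.
Definition reg (x : nat) : nat := x.*2.+1.
Arguments tmp : simpl never.
Arguments reg : simpl never.

(* Array j occupies the addresses base + 16 x + j. *)
Definition caddr (j d : nat) : seq instr :=
  [:: Iadd (tmp d) (tmp d) (tmp d); Iadd (tmp d) (tmp d) (tmp d);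
      Iadd (tmp d) (tmp d) (tmp d); Iadd (tmp d) (tmp d) (tmp d);
      Iconst (tmp d.+1) j; Iadd (tmp d) (tmp d) (tmp d.+1);
      Iadd (tmp d) (tmp d) (tmp 0)].

Arguments caddr : simpl never.

Fixpoint cexp (e : expr) (d : nat) : seq instr :=
  match e with
  | EVar x => [:: Iconst (tmp d) 0; Iadd (tmp d) (tmp d) (reg x)]
  | ECst k => [:: Iconst (tmp d) k]
  | EAdd e1 e2 => cexp e1 d ++ cexp e2 d.+1 ++ [:: Iadd (tmp d) (tmp d) (tmp d.+1)]
  | ESub e1 e2 => cexp e1 d ++ cexp e2 d.+1 ++ [:: Isub (tmp d) (tmp d) (tmp d.+1)]
  | EMem e1 => cexp e1 d ++ [:: Iload (tmp d) (tmp d)]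
  | EArr j e1 => (cexp e1 d ++ caddr j d) ++ [:: Iload (tmp d) (tmp d)]
  end.

(** Expressions compile to straight-line code, so one number is both the code length and the running
    time. *)
Fixpoint texp (e : expr) : nat :=
  match e with
  | EVar _ => 2
  | ECst _ => 1
  | EAdd e1 e2 => texp e1 + texp e2 + 1
  | ESub e1 e2 => texp e1 + texp e2 + 1
  | EMem e1 => texp e1 + 1
  | EArr j e1 => texp e1 + 8
  end.

Fixpoint scmd (c : cmd) : nat :=
  match c with
  | CSkip => 0
  | CSet _ e => texp e + 2
  | CPut _ e1 e2 => texp e1 + texp e2 + 8
  | CSeq c1 c2 => scmd c1 + scmd c2
  | CIf e1 e2 c1 c2 => texp e1 + texp e2 + scmd c1 + scmd c2 + 2
  | CWhile e1 e2 c => texp e1 + texp e2 + scmd c + 3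
  end.

(** Jump targets are absolute, hence the start address [o]. As [Ijlt] jumps when the test succeeds,
    the else branch is placed first, and in a loop the exit jump precedes the body. *)
Fixpoint ccmd (c : cmd) (o : nat) : seq instr :=
  match c with
  | CSkip => [::]
  | CSet x e => cexp e 1 ++ [:: Iconst (tmp 2) 0; Iadd (reg x) (tmp 1) (tmp 2)]
  | CPut j e1 e2 => (cexp e1 1 ++ caddr j 1) ++ cexp e2 2 ++ [:: Istore (tmp 1) (tmp 2)]
  | CSeq c1 c2 => ccmd c1 o ++ ccmd c2 (o + scmd c1)
  | CIf e1 e2 c1 c2 =>
      let g := o + (texp e1 + texp e2) in
      cexp e1 1 ++ cexp e2 2 ++ Ijlt (tmp 1) (tmp 2) (g.+1 + scmd c2 + 1)
        :: ccmd c2 g.+1 ++ Ijmp (g.+1 + scmd c2 + 1 + scmd c1)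
        :: ccmd c1 (g.+1 + scmd c2 + 1)
  | CWhile e1 e2 c1 =>
      let g := o + (texp e1 + texp e2) in
      cexp e1 1 ++ cexp e2 2 ++ Ijlt (tmp 1) (tmp 2) g.+2
        :: Ijmp (g.+2 + scmd c1 + 1) :: ccmd c1 g.+2 ++ [:: Ijmp o]
  end.

(** With [arr] false no array may be accessed. This is the regime of the code that computes the base
    address, before register 0 holds it. *)
Fixpoint wfexp (arr : bool) (e : expr) : bool :=
  match e with
  | EVar _ | ECst _ => true
  | EAdd e1 e2 | ESub e1 e2 => wfexp arr e1 && wfexp arr e2
  | EMem e1 => wfexp arr e1
  | EArr j e1 => [&& arr, j < 16 & wfexp arr e1]
  end.

Fixpoint wfcmd (arr : bool) (c : cmd) : bool :=
  match c with
  | CSkip => true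
  | CSet _ e => wfexp arr e
  | CPut j e1 e2 => [&& arr, j < 16, wfexp arr e1 & wfexp arr e2]
  | CSeq c1 c2 => wfcmd arr c1 && wfcmd arr c2
  | CIf e1 e2 c1 c2 => [&& wfexp arr e1, wfexp arr e2, wfcmd arr c1 & wfcmd arr c2]
  | CWhile e1 e2 c1 => [&& wfexp arr e1, wfexp arr e2 & wfcmd arr c1]
  end.

Lemma size_cexp e d : size (cexp e d) = texp e.
Proof. elim: e d => //= [e1 IH1 e2 IH2|e1 IH1 e2 IH2|e IH|j e IH] d; rewrite !size_cat ?IH1 ?IH2 ?IH //= ?size_cat ?IH /=; lia. Qed.

Lemma size_ccmd c o : size (ccmd c o) = scmd c.
Proof.
elim: c o => //= [x e|j e1 e2|c1 IH1 c2 IH2|e1 e2 c1 IH1 c2 IH2|e1 e2 c1 IH1] o;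
  rewrite ?size_cat /= ?size_cat ?size_cexp /= ?size_cat ?IH1 ?IH2 /= ?size_cexp /= ?IH1; lia.
Qed.

Section Semantics.
Variables (inp : nat -> nat) (base : nat).

(** Interleaving the 16 arrays, instead of laying them out one after the other, leaves every array
    unbounded, so no access needs a range condition and no two arrays overlap. *)
Definition flat (s : env) (a : nat) : nat :=
  if a < base then inp a else arrs s ((a - base) %% 16) ((a - base) %/ 16).

Fixpoint eval (e : expr) (s : env) : nat :=
  match e with
  | EVar x => vars s x
  | ECst k => k
  | EAdd e1 e2 => eval e1 s + eval e2 s
  | ESub e1 e2 => eval e1 s - eval e2 s
  | EMem e1 => flat s (eval e1 s)
  | EArr j e1 => arrs s j (eval e1 s)
  end.

Inductive bigstep : cmd -> env -> nat -> env -> Prop :=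
| BSkip s : bigstep CSkip s 0 s
| BSet x e s : bigstep (CSet x e) s (texp e + 2) (setv s x (eval e s))
| BPut j e1 e2 s :
    bigstep (CPut j e1 e2) s (texp e1 + texp e2 + 8) (seta s j (eval e1 s) (eval e2 s))
| BSeq c1 c2 s t1 s1 t2 s2 :
    bigstep c1 s t1 s1 -> bigstep c2 s1 t2 s2 -> bigstep (CSeq c1 c2) s (t1 + t2) s2
| BIfT e1 e2 c1 c2 s t s' :
    eval e1 s < eval e2 s -> bigstep c1 s t s' ->
    bigstep (CIf e1 e2 c1 c2) s (texp e1 + texp e2 + 1 + t) s'
| BIfF e1 e2 c1 c2 s t s' :
    ~~ (eval e1 s < eval e2 s) -> bigstep c2 s t s' ->
    bigstep (CIf e1 e2 c1 c2) s (texp e1 + texp e2 + 1 + t + 1) s'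
| BWhileF e1 e2 c s :
    ~~ (eval e1 s < eval e2 s) -> bigstep (CWhile e1 e2 c) s (texp e1 + texp e2 + 2) s
| BWhileT e1 e2 c s t s1 t' s2 :
    eval e1 s < eval e2 s -> bigstep c s t s1 -> bigstep (CWhile e1 e2 c) s1 t' s2 ->
    bigstep (CWhile e1 e2 c) s (texp e1 + texp e2 + 2 + t + t') s2.

(** * Correctness of the compiler *)

Section Compile.
Variable prog : seq instr.

Inductive steps : nat -> state -> state -> Prop :=
| Steps0 s : steps 0 s s
| StepsS k s s' : ~~ is_halted prog s -> steps k (step prog s) s' -> steps k.+1 s s'.

Lemma steps_cat k1 k2 s1 s2 s3 : steps k1 s1 s2 -> steps k2 s2 s3 -> steps (k1 + k2) s1 s3.
Proof. by elim=> // k s s' nh _ IH /IH; rewrite addSn; apply: StepsS. Qed.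

Lemma exec_steps k t s s' : steps k s s' -> exec prog (k + t) s = exec prog t s'.
Proof.
by elim=> // {}k {}s {}s' nh _ IH; rewrite addSn /= (negbTE nh) IH.
Qed.

Lemma exec_halted t s : is_halted prog s -> exec prog t s = Some s.
Proof. by case: t => [|t] /= ->. Qed.

Definition code_at (o : nat) (code : seq instr) : Prop :=
  exists2 post, drop o prog = code ++ post & o <= size prog.

Lemma code_at_cat o c1 c2 :
  code_at o (c1 ++ c2) -> code_at o c1 /\ code_at (o + size c1) c2.
Proof.
case=> post E le; split; first by exists (c2 ++ post); rewrite ?catA.
exists post; first by rewrite addnC -drop_drop E -catA drop_size_cat.
by have := congr1 size E; rewrite size_drop !size_cat; lia.
Qed.

Lemma code_at_cons o i c : code_at o (i :: c) -> nth Ihalt prog o = i /\ code_at o.+1 c.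
Proof.
move=> H; have [[post E le] H2] := code_at_cat (c1 := [:: i]) H.
split; last by rewrite -addn1.
by have := nth_drop o Ihalt prog 0; rewrite addn0 E /= => <-.
Qed.

Definition agrees (arr : bool) (s : env) (m : state) : Prop :=
  [/\ forall x, ram_regs m (reg x) = vars s x,
      ram_mem m =1 flat s & arr -> ram_regs m (tmp 0) = base].

Lemma reg_tmp x d : (reg x == tmp d) = false. Proof. rewrite /reg /tmp; lia. Qed.
Lemma tmp_reg x d : (tmp d == reg x) = false. Proof. rewrite /reg /tmp; lia. Qed.
Lemma reg_reg x y : (reg x == reg y) = (x == y). Proof. rewrite /reg; lia. Qed.
Lemma tmp_tmp x y : (tmp x == tmp y) = (x == y). Proof. rewrite /tmp; lia. Qed.
Definition regE := (reg_tmp, tmp_reg, reg_reg, tmp_tmp).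

(** Temporaries below [d] survive, which keeps a left operand at depth [d] intact while the right
    operand is evaluated at depth [d.+1]. *)
Definition exp_post (d v o k : nat) (R : nat -> nat) (Mm : nat -> nat) (m : state) : Prop :=
  [/\ ram_pc m = o + k, ram_mem m = Mm, ram_regs m (tmp d) = v,
      forall x, ram_regs m (reg x) = R (reg x) &
      forall d', d' < d -> ram_regs m (tmp d') = R (tmp d')].

Lemma step1 o R Mm i k m :
  nth Ihalt prog o = i -> (if i is Ihalt then false else true) ->
  steps k (step prog (State o R Mm)) m -> steps k.+1 (State o R Mm) m.
Proof. by move=> E h H; apply: StepsS => //; rewrite /is_halted /fetch E /=; case: i E h. Qed.

Lemma exp_post_cat d v v' o k k' R Mm m m' :
  exp_post d v o k R Mm m -> exp_post d v' (ram_pc m) k' (ram_regs m) (ram_mem m) m' ->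
  exp_post d v' o (k + k') R Mm m'.
Proof.
case=> [P1 E1 V1 G1 T1] [P2 E2 V2 G2 T2]; split=> // [||x|d' ld].
- by rewrite P2 P1 addnA.
- by rewrite E2.
- by rewrite G2.
- by rewrite T2 ?T1.
Qed.

Lemma step_add o R Mm d r : nth Ihalt prog o = Iadd (tmp d) (tmp d) r ->
  exists2 m, steps 1 (State o R Mm) m & exp_post d (R (tmp d) + R r) o 1 R Mm m.
Proof.
move=> E; eexists; first by apply: step1; [exact: E|by []|rewrite /step /fetch /= E /=; exact: Steps0].
split=> /=; rewrite ?addn1 //.
- by rewrite /upd eqxx.
- by move=> x; rewrite /upd !regE.
- by move=> d' ld; rewrite /upd !regE (ltn_eqF ld).
Qed.

(** The machine cannot multiply; four doublings give the factor 16. Depth 0 is excluded because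
    [tmp 0] holds the base address. *)
Lemma step_addr o R Mm j d :
  0 < d -> code_at o (caddr j d) ->
  exists2 m, steps 7 (State o R Mm) m &
    exp_post d (R (tmp 0) + (16 * R (tmp d) + j)) o 7 R Mm m.
Proof.
move=> d0 /code_at_cons [E1] /code_at_cons [E2] /code_at_cons [E3] /code_at_cons [E4].
move=> /code_at_cons [E5] /code_at_cons [E6] /code_at_cons [E7] _.
have [[pc1 R1 M1] S1 X1] := step_add R Mm E1.
case: (X1) => /= P1 EM1 V1 G1 T1; rewrite addn1 in P1; subst pc1 M1.
have [[pc2 R2 M2] S2 X2] := step_add R1 Mm E2.
case: (X2) => /= P2 EM2 V2 G2 T2; rewrite addn1 in P2; subst pc2 M2.
have [[pc3 R3 M3] S3 X3] := step_add R2 Mm E3.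
case: (X3) => /= P3 EM3 V3 G3 T3; rewrite addn1 in P3; subst pc3 M3.
have [[pc4 R4 M4] S4 X4] := step_add R3 Mm E4.
case: (X4) => /= P4 EM4 V4 G4 T4; rewrite addn1 in P4; subst pc4 M4.
have [m5 S5 X5] : exists2 m, steps 1 (State o.+4 R4 Mm) m &
    exp_post d (R4 (tmp d)) o.+4 1 R4 Mm m /\ ram_regs m (tmp d.+1) = j.
  eexists; first by apply: step1; [exact: E5|by []|rewrite /step /fetch /= E5 /=; exact: Steps0].
  split; last by rewrite /= /upd eqxx.
  split=> /=; rewrite ?addn1 //.
  - by rewrite /upd regE; have -> : (d == d.+1) = false by lia.
  - by move=> x; rewrite /upd !regE.
  - by move=> d' ld; rewrite /upd !regE; have -> : (d' == d.+1) = false by lia.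
case: m5 S5 X5 => pc5 R5 M5 S5 [X5 J5].
case: (X5) => /= P5 EM5 V5 G5 T5; rewrite addn1 in P5; subst pc5 M5.
have [[pc6 R6 M6] S6 X6] := step_add R5 Mm E6.
case: (X6) => /= P6 EM6 V6 G6 T6; rewrite addn1 in P6; subst pc6 M6.
have [m7 S7 X7] := step_add R6 Mm E7.
exists m7.
  exact: steps_cat S1 (steps_cat S2 (steps_cat S3 (steps_cat S4 (steps_cat S5 (steps_cat S6 S7))))).
have -> : R (tmp 0) + (16 * R (tmp d) + j) = R6 (tmp d) + R6 (tmp 0).
  rewrite V6 (T6 0) // (T5 0) // (T4 0) // (T3 0) // (T2 0) // (T1 0) //; move: J5 => /= ->.
  rewrite V5 V4 V3 V2 V1; lia.
have X67 := exp_post_cat X6 X7.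
have X57 := exp_post_cat X5 X67.
have X47 := exp_post_cat X4 X57.
have X37 := exp_post_cat X3 X47.
have X27 := exp_post_cat X2 X37.
exact: exp_post_cat X1 X27.
Qed.

Lemma flat_arr s j x : j < 16 -> flat s (base + (16 * x + j)) = arrs s j x.
Proof.
move=> lj; rewrite /flat; have -> : (base + (16 * x + j) < base) = false by lia.
have -> : base + (16 * x + j) - base = x * 16 + j by lia.
by rewrite modnMDl modn_small // divnMDl // divn_small // addn0.
Qed.

Lemma flat_seta s j x v a : j < 16 ->
  flat (seta s j x v) a = upd (flat s) (base + (16 * x + j)) v a.
Proof.
move=> lj; rewrite /flat /upd; case: ifP => la.
  by have -> : (a == base + (16 * x + j)) = false by lia.
rewrite /=; case: (eqVneq ((a - base) %% 16) j) => E; rewrite ?/upd; last first.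
  case: eqP => // E2; case/eqP: E; have -> : a - base = x * 16 + j by lia.
  by rewrite modnMDl modn_small.
rewrite E; have -> : (a == base + (16 * x + j)) = ((a - base) %/ 16 == x); last by [].
have := divn_eq (a - base) 16; rewrite E; lia.
Qed.

Lemma cexp_correct arr e : forall d o s m, 0 < d -> wfexp arr e ->
  agrees arr s m -> ram_pc m = o -> code_at o (cexp e d) ->
  exists2 m', steps (texp e) m m' &
    exp_post d (eval e s) o (texp e) (ram_regs m) (ram_mem m) m'.
Proof.
elim: e => [x|k|e1 IH1 e2 IH2|e1 IH1 e2 IH2|e IH|j e IH] d o s [pc R Mm] d0 /= wf ag /= Epc; subst pc.
- move=> /code_at_cons [E1 /code_at_cons [E2 _]].
  eexists.
    apply: step1; [exact: E1|by []|rewrite /step /fetch /= E1 /=].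
    apply: step1; [exact: E2|by []|rewrite /step /fetch /= E2 /=].
    apply: Steps0.
  case: ag => /= agR _ _.
  split=> //=; rewrite ?addn2 //.
  + by rewrite /upd !regE !eqxx add0n agR.
  + by move=> y; rewrite /upd !regE.
  + by move=> d' ld; rewrite /upd !regE (ltn_eqF ld).
- move=> /code_at_cons [E1 _].
  eexists.
    apply: step1; [exact: E1|by []|rewrite /step /fetch /= E1 /=].
    apply: Steps0.
  split=> //=; rewrite ?addn1 //.
  + by rewrite /upd !regE !eqxx.
  + by move=> y; rewrite /upd !regE.
  + by move=> d' ld; rewrite /upd !regE (ltn_eqF ld).
- case/andP: wf => w1 w2.
  move=> /code_at_cat [C1 /code_at_cat []]; rewrite !size_cexp => C2 /code_at_cons [E3 _].
  have [[pc1 R1 M1] S1 [/= P1 EM1 V1 G1 T1]] := IH1 d o s _ d0 w1 ag erefl C1; subst pc1 M1.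
  have ag1 : agrees arr s (State (o + texp e1) R1 Mm).
    case: ag => /= a b c; split=> //= [x|/c]; first by rewrite G1.
    by rewrite T1.
  have [[pc2 R2 M2] S2 [/= P2 EM2 V2 G2 T2]] := IH2 d.+1 _ s _ isT w2 ag1 erefl C2; subst pc2 M2.
  eexists.
    apply: steps_cat (steps_cat S1 S2) _.
    by apply: step1; [exact: E3|by []|rewrite /step /fetch /= E3 /=; apply: Steps0].
  split=> //=.
  + lia.
  + by rewrite /upd !regE !eqxx V2 T2 // V1.
  + by move=> y; rewrite /upd !regE G2 G1.
  + move=> d' ld; rewrite /upd !regE (ltn_eqF ld).
    by rewrite T2 ?T1 // ltnW.
- case/andP: wf => w1 w2.
  move=> /code_at_cat [C1 /code_at_cat []]; rewrite !size_cexp => C2 /code_at_cons [E3 _].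
  have [[pc1 R1 M1] S1 [/= P1 EM1 V1 G1 T1]] := IH1 d o s _ d0 w1 ag erefl C1; subst pc1 M1.
  have ag1 : agrees arr s (State (o + texp e1) R1 Mm).
    case: ag => /= a b c; split=> //= [x|/c]; first by rewrite G1.
    by rewrite T1.
  have [[pc2 R2 M2] S2 [/= P2 EM2 V2 G2 T2]] := IH2 d.+1 _ s _ isT w2 ag1 erefl C2; subst pc2 M2.
  eexists.
    apply: steps_cat (steps_cat S1 S2) _.
    by apply: step1; [exact: E3|by []|rewrite /step /fetch /= E3 /=; apply: Steps0].
  split=> //=.
  + lia.
  + by rewrite /upd !regE !eqxx V2 T2 // V1.
  + by move=> y; rewrite /upd !regE G2 G1.
  + move=> d' ld; rewrite /upd !regE (ltn_eqF ld).
    by rewrite T2 ?T1 // ltnW.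
- move=> /code_at_cat [C1]; rewrite !size_cexp => /code_at_cons [E3 _].
  have [[pc1 R1 M1] S1 [/= P1 EM1 V1 G1 T1]] := IH d o s _ d0 wf ag erefl C1; subst pc1 M1.
  eexists.
    apply: steps_cat S1 _.
    by apply: step1; [exact: E3|by []|rewrite /step /fetch /= E3 /=; apply: Steps0].
  case: ag => /= _ agM _.
  split=> //=.
  + lia.
  + by rewrite /upd !regE !eqxx V1 agM.
  + by move=> y; rewrite /upd !regE G1.
  + by move=> d' ld; rewrite /upd !regE (ltn_eqF ld) T1.
- case/and3P: wf => warr lj wf.
  move=> /code_at_cat [/code_at_cat [C1]]; rewrite !size_cat addnA !size_cexp => C2 /code_at_cons [E3 _].
  have [[pc1 R1 M1] S1 [/= P1 EM1 V1 G1 T1]] := IH d o s _ d0 wf ag erefl C1; subst pc1 M1.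
  have [[pc2 R2 M2] S2 [/= P2 EM2 V2 G2 T2]] := step_addr R1 Mm d0 C2; subst pc2 M2.
  eexists.
    rewrite (_ : texp e + 8 = texp e + (7 + 1)) //.
    apply: steps_cat S1 _; apply: steps_cat S2 _.
    by apply: step1; [exact: E3|by []|rewrite /step /fetch /= E3 /=; apply: Steps0].
  case: ag => /= _ agM /(_ warr) agB.
  split=> //=.
  + lia.
  + by rewrite /upd !regE !eqxx V2 V1 T1 // agB agM flat_arr.
  + by move=> y; rewrite /upd !regE G2 G1.
  + by move=> d' ld; rewrite /upd !regE (ltn_eqF ld) T2 // T1.
Qed.

Lemma agrees_exp arr s d v o k m m' : agrees arr s m ->
  exp_post d v o k (ram_regs m) (ram_mem m) m' -> 0 < d -> agrees arr s m'.
Proof.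
move=> [a b c] [_ EM _ G T] d0; split=> [x||/c]; first by rewrite G.
  by rewrite EM.
by rewrite T.
Qed.

(** The induction is on the derivation rather than on the command, so that the remaining iterations
    of a loop are covered by the hypothesis for the same code at the same address. *)
Lemma ccmd_correct arr c s t s' : bigstep c s t s' -> forall o m, wfcmd arr c ->
  agrees arr s m -> ram_pc m = o -> code_at o (ccmd c o) ->
  exists2 m', steps t m m' & agrees arr s' m' /\ ram_pc m' = o + scmd c.
Proof.
elim=> {c s t s'}.
- by move=> s o m _ ag E _; exists m; [apply: Steps0 | rewrite addn0].
- move=> x e s o m /= wf ag E /code_at_cat [C1]; rewrite size_cexp.
  move=> /code_at_cons [E1 /code_at_cons [E2 _]].
  have [[pc1 R1 M1] S1 X1] := cexp_correct (isT : 0 < 1) wf ag E C1.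
  have [a b c] := agrees_exp ag X1 isT.
  case: X1 => /= P1 EM1 V1 G1 T1; subst pc1.
  eexists.
    apply: steps_cat S1 _.
    apply: step1; [exact: E1|by []|rewrite /step /fetch /= E1 /=].
    apply: step1; [exact: E2|by []|rewrite /step /fetch /= E2 /=].
    apply: Steps0.
  split=> /=; last lia.
  split=> [y||/c c0] /=; [|by []|by []].
  by rewrite /upd !regE; case: eqP => // _; rewrite V1 addn0.
- move=> j e1 e2 s o m /= /and4P [warr lj w1 w2] ag E /code_at_cat [/code_at_cat [C1]].
  rewrite !size_cat addnA !size_cexp => C2 /code_at_cat [C3].
  rewrite !size_cexp => /code_at_cons [E1 _].
  have [m1 S1 X1] := cexp_correct (isT : 0 < 1) w1 ag E C1.
  have ag1 := agrees_exp ag X1 isT.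
  case: m1 S1 X1 ag1 => pc1 R1 M1 S1 [/= P1 EM1 V1 G1 T1] ag1; subst pc1.
  have [m2 S2 X2] := step_addr R1 M1 (isT : 0 < 1) C2.
  have ag2 := agrees_exp ag1 X2 isT.
  case: m2 S2 X2 ag2 => pc2 R2 M2 S2 [/= P2 EM2 V2 G2 T2] ag2.
  have C3' : code_at pc2 (cexp e2 2) by rewrite P2.
  have [m3 S3 X3] := cexp_correct (isT : 0 < 2) w2 ag2 erefl C3'.
  have [a b c] := agrees_exp ag2 X3 isT.
  case: m3 S3 X3 a b c => pc3 R3 M3 S3 [/= P3 EM3 V3 G3 T3] a b c; subst pc2 pc3.
  eexists.
    rewrite (_ : texp e1 + texp e2 + 8 = texp e1 + (7 + (texp e2 + 1))); last lia.
    apply: steps_cat S1 _; apply: steps_cat S2 _; apply: steps_cat S3 _.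
    apply: step1; [exact: E1|by []|rewrite /step /fetch /= E1 /=].
    apply: Steps0.
  split=> /=; last lia.
  split=> //= z; rewrite flat_seta // /upd; rewrite -[tmp 1]/(tmp 1) V3 T3 // V2 V1.
  have -> : R1 (tmp 0) = base by case: ag1 => _ _; apply.
  by case: eqP => // _; rewrite b.
- move=> c1 c2 s t1 s1 t2 s2 _ IH1 _ IH2 o m /= /andP [w1 w2] ag E /code_at_cat [C1].
  rewrite size_ccmd => C2.
  have [m1 S1 [ag1 E1]] := IH1 _ _ w1 ag E C1.
  have [m2 S2 [ag2 E2]] := IH2 _ _ w2 ag1 E1 C2.
  exists m2; first by apply: steps_cat S1 S2.
  by split=> //; rewrite E2 /=; lia.
- move=> e1 e2 c1 c2 s t s' lt _ IH o m /= /and4P [w1 w2 w3 w4] ag E /code_at_cat [C1 /code_at_cat []].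
  rewrite !size_cexp => C2 /code_at_cons [E1 /code_at_cat [C3]].
  rewrite size_ccmd => /code_at_cons [E2 C4].
  have [m1 S1 X1] := cexp_correct (isT : 0 < 1) w1 ag E C1.
  have ag1 := agrees_exp ag X1 isT.
  case: X1 => /= P1 EM1 V1 G1 T1.
  have [m2 S2 X2] := cexp_correct (isT : 0 < 2) w2 ag1 P1 C2.
  have ag2 := agrees_exp ag1 X2 isT.
  case: m2 S2 X2 ag2 => pc2 R2 M2 S2 [/= P2 EM2 V2 G2 T2] ag2; subst pc2.
  move: E1; set st := step prog (State (o + texp e1 + texp e2) R2 M2) => E1.
  have Est : st = State ((o + (texp e1 + texp e2)).+1 + scmd c2 + 1) R2 M2.
    by rewrite /st /step /fetch /= E1 V2 T2 // V1 lt.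
  have ag3 : agrees arr s st by rewrite Est; case: ag2.
  have C4' : code_at ((o + (texp e1 + texp e2)).+1 + scmd c2 + 1)
      (ccmd c1 ((o + (texp e1 + texp e2)).+1 + scmd c2 + 1)).
    by move: C4; rewrite (_ : (_ + scmd c2).+1 = (o + (texp e1 + texp e2)).+1 + scmd c2 + 1) //; lia.
  have [m4 S4 [ag4 E4]] := IH _ _ w3 ag3 (congr1 ram_pc Est) C4'.
  exists m4.
    rewrite -!addnA; apply: steps_cat S1 _; apply: steps_cat S2 _.
    by apply: step1; [exact: E1|by []|].
  by split=> //; rewrite E4 /=; lia.
- move=> e1 e2 c1 c2 s t s' lt _ IH o m /= /and4P [w1 w2 w3 w4] ag E /code_at_cat [C1 /code_at_cat []].
  rewrite !size_cexp => C2 /code_at_cons [E1 /code_at_cat [C3]].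
  rewrite size_ccmd => /code_at_cons [E2 C4].
  have [m1 S1 X1] := cexp_correct (isT : 0 < 1) w1 ag E C1.
  have ag1 := agrees_exp ag X1 isT.
  case: X1 => /= P1 EM1 V1 G1 T1.
  have [m2 S2 X2] := cexp_correct (isT : 0 < 2) w2 ag1 P1 C2.
  have ag2 := agrees_exp ag1 X2 isT.
  case: m2 S2 X2 ag2 => pc2 R2 M2 S2 [/= P2 EM2 V2 G2 T2] ag2; subst pc2.
  move: E1; set st := step prog (State (o + texp e1 + texp e2) R2 M2) => E1.
  have Est : st = State ((o + texp e1 + texp e2).+1) R2 M2.
    by rewrite /st /step /fetch /= E1 V2 T2 // V1 (negbTE lt).
  have ag3 : agrees arr s st by rewrite Est; case: ag2.
  have Est' : ram_pc st = (o + (texp e1 + texp e2)).+1 by rewrite Est /= addnA.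
  have C3' : code_at (o + (texp e1 + texp e2)).+1 (ccmd c2 (o + (texp e1 + texp e2)).+1).
    by rewrite {1}addnA.
  have [[pc4 R4 M4] S4 [ag4 /= E4]] := IH _ _ w4 ag3 Est' C3'.
  subst pc4; exists (State ((o + (texp e1 + texp e2)).+1 + scmd c2 + 1 + scmd c1) R4 M4).
    rewrite -!addnA; apply: steps_cat S1 _; apply: steps_cat S2 _.
    apply: step1; [exact: E1|by []|].
    apply: steps_cat S4 _.
    have E2' : nth Ihalt prog ((o + (texp e1 + texp e2)).+1 + scmd c2) =
      Ijmp ((o + (texp e1 + texp e2)).+1 + scmd c2 + 1 + scmd c1) by rewrite -E2 addnA.
    apply: step1; [exact: E2'|by []|rewrite /step /fetch /= E2' /=; rewrite ?addnA; exact: Steps0].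
  by split; [case: ag4 | rewrite /=; lia].
- move=> e1 e2 c s lt o m /= /and3P [w1 w2 w3] ag E /code_at_cat [C1 /code_at_cat []].
  rewrite !size_cexp => C2 /code_at_cons [E1 /code_at_cons [E2 _]].
  have [m1 S1 X1] := cexp_correct (isT : 0 < 1) w1 ag E C1.
  have ag1 := agrees_exp ag X1 isT.
  case: X1 => /= P1 EM1 V1 G1 T1.
  have [m2 S2 X2] := cexp_correct (isT : 0 < 2) w2 ag1 P1 C2.
  have ag2 := agrees_exp ag1 X2 isT.
  case: m2 S2 X2 ag2 => pc2 R2 M2 S2 [/= P2 EM2 V2 G2 T2] ag2; subst pc2.
  eexists.
    rewrite -!addnA; apply: steps_cat S1 _; apply: steps_cat S2 _.
    apply: step1; [exact: E1|by []|rewrite /step /fetch /= E1 V2 T2 // V1 (negbTE lt)].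
    apply: step1; [exact: E2|by []|rewrite /step /fetch /= E2; exact: Steps0].
  by split; [case: ag2 | rewrite /=; lia].
- move=> e1 e2 c s t s1 t' s2 lt _ IH1 _ IH2 o m /= /[dup] wf /and3P [w1 w2 w3] ag E /[dup] C.
  move=> /code_at_cat [C1 /code_at_cat []].
  rewrite !size_cexp => C2 /code_at_cons [E1 /code_at_cons [E2 /code_at_cat [C3]]].
  rewrite size_ccmd => /code_at_cons [E3 _].
  have [m1 S1 X1] := cexp_correct (isT : 0 < 1) w1 ag E C1.
  have ag1 := agrees_exp ag X1 isT.
  case: X1 => /= P1 EM1 V1 G1 T1.
  have [m2 S2 X2] := cexp_correct (isT : 0 < 2) w2 ag1 P1 C2.
  have ag2 := agrees_exp ag1 X2 isT.
  case: m2 S2 X2 ag2 => pc2 R2 M2 S2 [/= P2 EM2 V2 G2 T2] ag2; subst pc2.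
  move: E1; set st := step prog (State (o + texp e1 + texp e2) R2 M2) => E1.
  have Est : st = State ((o + (texp e1 + texp e2)).+2) R2 M2.
    by rewrite /st /step /fetch /= E1 V2 T2 // V1 lt.
  have ag3 : agrees arr s st by rewrite Est; case: ag2.
  have C3' : code_at (o + (texp e1 + texp e2)).+2 (ccmd c (o + (texp e1 + texp e2)).+2).
    by rewrite {1}addnA.
  have [m4 S4 [ag4 E4]] := IH1 _ _ w3 ag3 (congr1 ram_pc Est) C3'.
  have E3' : nth Ihalt prog (ram_pc m4) = Ijmp o by rewrite -E3 E4 addnA.
  have Ej : step prog m4 = State o (ram_regs m4) (ram_mem m4) by rewrite /step /fetch E3'.
  have ag5 : agrees arr s1 (step prog m4) by rewrite Ej; case: ag4.
  have [m6 S6 [ag6 E6]] := IH2 _ _ wf ag5 (congr1 ram_pc Ej) C.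
  exists m6 => //.
  rewrite (_ : _ + _ = texp e1 + (texp e2 + (1 + (t + (1 + t'))))); last lia.
  apply: steps_cat S1 _; apply: steps_cat S2 _.
  apply: (steps_cat (s2 := st)); first by apply: step1; [exact: E1|by []|apply: Steps0].
  apply: steps_cat S4 _.
  by apply: (steps_cat (s2 := step prog m4)) S6; case: (m4) E3' => *; apply: step1; [eassumption|by []|apply: Steps0].
Qed.

End Compile.
End Semantics.

(** * Timed Hoare triples *)

Fixpoint wvars (c : cmd) : seq nat :=
  match c with
  | CSkip | CPut _ _ _ => [::]
  | CSet x _ => [:: x]
  | CSeq c1 c2 | CIf _ _ c1 c2 => wvars c1 ++ wvars c2
  | CWhile _ _ c1 => wvars c1
  end.

Fixpoint warrs (c : cmd) : seq nat :=
  match c with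
  | CSkip | CSet _ _ => [::]
  | CPut j _ _ => [:: j]
  | CSeq c1 c2 | CIf _ _ c1 c2 => warrs c1 ++ warrs c2
  | CWhile _ _ c1 => warrs c1
  end.

(** The footprint is syntactic, so loop invariants need not list what a body leaves alone. *)
Definition frame (c : cmd) (s s' : env) : Prop :=
  (forall x, x \notin wvars c -> vars s' x = vars s x) /\
  (forall j, j \notin warrs c -> arrs s' j = arrs s j).

Lemma frame_refl c s : frame c s s. Proof. by []. Qed.

Lemma frame_trans c s1 s2 s3 : frame c s1 s2 -> frame c s2 s3 -> frame c s1 s3.
Proof. by move=> [a b] [a' b']; split=> x nx; rewrite ?a' ?a ?b' ?b. Qed.

Fixpoint loopfree (c : cmd) : bool :=
  match c with
  | CSkip | CSet _ _ | CPut _ _ _ => true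
  | CSeq c1 c2 | CIf _ _ c1 c2 => loopfree c1 && loopfree c2
  | CWhile _ _ _ => false
  end.

(** Adding the times of both branches is a crude bound for their maximum. The value at a loop is a
    dummy: the function is applied to loop-free commands. *)
Fixpoint tmax (c : cmd) : nat :=
  match c with
  | CSkip => 0
  | CSet _ e => texp e + 2
  | CPut _ e1 e2 => texp e1 + texp e2 + 8
  | CSeq c1 c2 => tmax c1 + tmax c2
  | CIf e1 e2 c1 c2 => texp e1 + texp e2 + 2 + (tmax c1 + tmax c2)
  | CWhile _ _ _ => 0
  end.

Section Hoare.
Variables (inp : nat -> nat) (base : nat).
Local Notation ev := (eval inp base).

Fixpoint run (c : cmd) (s : env) : env :=
  match c with
  | CSkip | CWhile _ _ _ => s
  | CSet x e => setv s x (ev e s)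
  | CPut j e1 e2 => seta s j (ev e1 s) (ev e2 s)
  | CSeq c1 c2 => run c2 (run c1 s)
  | CIf e1 e2 c1 c2 =>
      if ev e1 s < ev e2 s then run c1 s else run c2 s
  end.

(** Total correctness from one given state; what is known about [s] stays in the context and takes
    the place of a precondition. *)
Definition tri (c : cmd) (s : env) (t : nat) (Q : env -> Prop) : Prop :=
  exists t' s', [/\ bigstep inp base c s t' s', t' <= t & Q s'].

Lemma bigstep_frame c s t s' : bigstep inp base c s t s' -> frame c s s'.
Proof.
elim=> {c s t s'} //=.
- by move=> x e s; split=> // y; rewrite inE /= /upd => /negbTE ->.
- by move=> j e1 e2 s; split=> // y; rewrite inE /= => /negbTE ->.
- move=> c1 c2 s t1 s1 t2 s2 _ [a b] _ [a' b'].
  by split=> x; rewrite mem_cat negb_or => /andP [n1 n2]; rewrite ?a' ?a ?b' ?b.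
- move=> e1 e2 c1 c2 s t s' _ _ [a b].
  by split=> x; rewrite mem_cat negb_or => /andP [n1 n2]; rewrite ?a ?b.
- move=> e1 e2 c1 c2 s t s' _ _ [a b].
  by split=> x; rewrite mem_cat negb_or => /andP [n1 n2]; rewrite ?a ?b.
- by move=> e1 e2 c s t s1 t' s2 _ _ f1 _; apply: frame_trans.
Qed.

Lemma tri_frame c s t Q : tri c s t Q -> tri c s t (fun s' => Q s' /\ frame c s s').
Proof. by move=> [t' [s' [B le q]]]; exists t', s'; split=> //; split=> //; apply: bigstep_frame B. Qed.

Lemma tri_weaken c s t t0 (Q0 Q : env -> Prop) :
  tri c s t0 Q0 -> t0 <= t -> (forall s', Q0 s' -> Q s') -> tri c s t Q.
Proof.
by move=> [t' [s' [B le q]]] le2 H; exists t', s'; split; [|exact: leq_trans le2|exact: H].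
Qed.

Lemma tri_seq c1 c2 s t1 t2 t Q :
  tri c1 s t1 (fun s1 => tri c2 s1 t2 Q) -> t1 + t2 <= t -> tri (CSeq c1 c2) s t Q.
Proof.
move=> [t1' [s1 [B1 le1 [t2' [s2 [B2 le2 q]]]]]] le; exists (t1' + t2'), s2.
by split=> //; [apply: BSeq B1 B2 | lia].
Qed.

Lemma tri_if e1 e2 c1 c2 s t t' Q :
  (ev e1 s < ev e2 s -> tri c1 s t' Q) ->
  (ev e2 s <= ev e1 s -> tri c2 s t' Q) ->
  texp e1 + texp e2 + 2 + t' <= t -> tri (CIf e1 e2 c1 c2) s t Q.
Proof.
move=> H1 H2 le; case: (ltnP (ev e1 s) (ev e2 s)) => c.
  have [t1 [s1 [B le1 q]]] := H1 c; exists (texp e1 + texp e2 + 1 + t1), s1.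
  by split=> //; [apply: BIfT | lia].
have [t1 [s1 [B le1 q]]] := H2 c; exists (texp e1 + texp e2 + 1 + t1 + 1), s1.
by split=> //; [apply: BIfF; rewrite // -leqNgt | lia].
Qed.

Lemma tri_run c s t (Q : env -> Prop) : loopfree c -> Q (run c s) -> tmax c <= t -> tri c s t Q.
Proof.
move=> lf q le.
have H : tri c s (tmax c) (fun s' => s' = run c s); last by apply: tri_weaken H le _ => s' ->.
elim: c s lf {q le} => //=.
- by move=> s _; exists 0, s; split=> //; apply: BSkip.
- by move=> x e s _; do 2 eexists; split; [apply: BSet | |].
- by move=> j e1 e2 s _; do 2 eexists; split; [apply: BPut | |].
- move=> c1 IH1 c2 IH2 s /andP [l1 l2].
  by apply: tri_seq (leqnn _); apply: tri_weaken (IH1 s l1) _ _ => // s' ->; apply: IH2.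
- move=> e1 e2 c1 IH1 c2 IH2 s /andP [l1 l2].
  apply: (tri_if (t' := tmax c1 + tmax c2)) => // c.
    by rewrite c; apply: tri_weaken (IH1 s l1) _ _ => //; lia.
  by rewrite ltnNge c /=; apply: tri_weaken (IH2 s l2) _ _ => //; lia.
Qed.

(* The potential [phi] bounds the time that the loop still needs. *)
Lemma tri_while e1 e2 c (Inv : nat -> env -> Prop) s phi :
  (forall phi s1, Inv phi s1 -> frame c s s1 -> ev e1 s1 < ev e2 s1 ->
     exists tb, tri c s1 tb (fun s2 =>
       exists2 phi', Inv phi' s2 & tb + (texp e1 + texp e2 + 2) + phi' <= phi)) ->
  Inv phi s ->
  tri (CWhile e1 e2 c) s (phi + (texp e1 + texp e2 + 2))
    (fun s' => [/\ exists phi', Inv phi' s', frame c s s' & ev e2 s' <= ev e1 s']).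
Proof.
move=> H I0; move: (frame_refl c s) => fr0.
(* The test alone costs at least 2, so the potential drops strictly in each round; induction on a
   bound [K] for it yields termination. *)
suff G K : forall phi, phi <= K -> forall s1, Inv phi s1 -> frame c s s1 ->
    tri (CWhile e1 e2 c) s1 (phi + (texp e1 + texp e2 + 2))
    (fun s' => [/\ exists phi', Inv phi' s', frame c s s' & ev e2 s' <= ev e1 s']).
  exact: G (leqnn _) _ I0 fr0.
elim: K {phi I0 fr0} => [|K IH] phi leK s1 I1 fr.
  case: (ltnP (ev e1 s1) (ev e2 s1)) => g.
    have [tb [t' [s2 [_ _ [phi' _]]]]] := H _ _ I1 fr g; lia.
  exists (texp e1 + texp e2 + 2), s1; split; [|lia|by split=> //; exists phi].
  by apply: BWhileF; rewrite -leqNgt.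
case: (ltnP (ev e1 s1) (ev e2 s1)) => g; last first.
  exists (texp e1 + texp e2 + 2), s1; split; [|lia|by split=> //; exists phi].
  by apply: BWhileF; rewrite -leqNgt.
have [tb [t' [s2 [B le [phi' I2 le2]]]]] := H _ _ I1 fr g.
have fr2 := frame_trans fr (bigstep_frame B).
have le3 : phi' <= K by lia.
have [t3 [s3 [B3 le4 q]]] := IH _ le3 _ I2 fr2.
exists (texp e1 + texp e2 + 2 + t' + t3), s3; split=> //; last lia.
exact: BWhileT g B B3.
Qed.

(** The constant 6 is the price of a round apart from its body: 2 for each of the two variables and
    2 for the jumps. *)
Lemma tri_for x y c (P : nat -> env -> Prop) s tb m k0 : y \notin wvars c ->
  (forall k s1, k < m -> P k s1 -> frame c s s1 -> vars s1 x = k ->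
     tri c s1 tb (fun s2 => P k.+1 s2 /\ vars s2 x = k.+1)) ->
  vars s x = k0 -> k0 <= m -> vars s y = m -> P k0 s ->
  tri (CWhile (EVar x) (EVar y) c) s ((m - k0) * (tb + 6) + 6)
    (fun s' => [/\ P m s', frame c s s' & vars s' x = m]).
Proof.
move=> ny H xk lek ym P0.
pose Inv phi s1 := exists k, [/\ P k s1, k <= m, vars s1 x = k & phi = (m - k) * (tb + 6)].
have I0 : Inv ((m - k0) * (tb + 6)) s by exists k0.
apply: tri_weaken (tri_while (Inv := Inv) (c := c) (e1 := EVar x) (e2 := EVar y) _ I0) _ _ => //=.
  move=> phi s1 [k [Pk lekm xk1 ->]] fr; rewrite /= xk1 (proj1 fr) // ym => lkm.
  exists tb; apply: tri_weaken (H _ _ lkm Pk fr xk1) _ _ => // s2 [P2 x2].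
  exists ((m - k.+1) * (tb + 6)); first by exists k.+1.
  have -> : m - k = (m - k.+1).+1 by lia.
  lia.
move=> s' [[phi [k [Pk lekm xk1 _]]] fr]; rewrite /= xk1 (proj1 fr) // ym => lmk.
by have -> : m = k by lia.
Qed.

Lemma tri_step c1 c2 s t Q : loopfree c1 -> tmax c1 <= t ->
  tri c2 (run c1 s) (t - tmax c1) Q -> tri (CSeq c1 c2) s t Q.
Proof.
move=> lf le H; apply: (tri_seq (t1 := tmax c1) (t2 := t - tmax c1)); last by rewrite subnKC.
exact: tri_run.
Qed.

Lemma tri_ifT e1 e2 c1 c2 s t Q : ev e1 s < ev e2 s -> texp e1 + texp e2 + 2 <= t ->
  tri c1 s (t - (texp e1 + texp e2 + 2)) Q -> tri (CIf e1 e2 c1 c2) s t Q.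
Proof.
by move=> g le H; apply: (tri_if _ _ (_ : _ + (t - (texp e1 + texp e2 + 2)) <= t)) => //; lia.
Qed.

Lemma tri_ifF e1 e2 c1 c2 s t Q : ev e2 s <= ev e1 s -> texp e1 + texp e2 + 2 <= t ->
  tri c2 s (t - (texp e1 + texp e2 + 2)) Q -> tri (CIf e1 e2 c1 c2) s t Q.
Proof.
by move=> g le H; apply: (tri_if _ _ (_ : _ + (t - (texp e1 + texp e2 + 2)) <= t)) => //; lia.
Qed.

Lemma tri_framed c s t Q : tri c s t Q -> tri c s t (fun s' => frame c s s' /\ Q s').
Proof. by move=> H; apply: tri_weaken (tri_frame H) (leqnn _) _ => s' []. Qed.

End Hoare.

(** * Minimum-cost arborescences with unit cost steps *)

Section Arborescence.
Variables (N : nat) (T : nat -> seq nat).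

(* The sink N is the default target. *)
Definition tgt (v j : nat) : nat := nth N (T v) j.

(** In a finite functional graph a cycle avoiding the sink exists iff some non-empty set avoiding
    the sink is closed under the edges. The form with sets needs no paths and matches
    [closed_set]. *)
Definition acyclic (j : nat -> nat) : Prop :=
  forall A : pred nat, (forall v, A v -> v < N /\ A (tgt v (j v))) -> forall v, ~~ A v.

(* [good X l c]: some choice of cost [c] on the vertices of [l], listed in
   topological order, leads all of them into [X]. *)
Inductive good (X : seq nat) : seq nat -> nat -> Prop :=
| GoodNil : good X [::] 0
| GoodCons u j l c : good X l c -> u \notin l -> j <= size (T u) ->
    tgt u j \in l ++ X -> good X (u :: l) (j + c).

Definition drains (X C : seq nat) (c : nat) : Prop :=
  exists2 l, perm_eq l C & good X l c.

Lemma good_cat X Y l1 l2 c1 c2 : good X l1 c1 -> good Y l2 c2 ->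
  {subset Y <= l1 ++ X} -> uniq (l2 ++ l1) -> good X (l2 ++ l1) (c2 + c1).
Proof.
move=> g1 g2 sub; elim: g2 => //= u j l c g IH nu lej tin /andP [nul un].
rewrite -addnA; apply: GoodCons => //; first exact: IH.
by rewrite -catA; move: tin; rewrite !mem_cat => /orP [->//|/sub]; rewrite mem_cat => ->; rewrite orbT.
Qed.

Lemma drains_cat X Y C1 C2 c1 c2 : drains X C1 c1 -> drains Y C2 c2 ->
  {subset Y <= C1 ++ X} -> uniq (C2 ++ C1) -> drains X (C2 ++ C1) (c2 + c1).
Proof.
move=> [l1 p1 g1] [l2 p2 g2] sub un; exists (l2 ++ l1); first exact: perm_cat.
apply: good_cat g1 g2 _ _; last by rewrite (perm_uniq (perm_cat p2 p1)).
by move=> x /sub; rewrite !mem_cat (perm_mem p1).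
Qed.

Lemma drains_perm X C C' c : perm_eq C C' -> drains X C c -> drains X C' c.
Proof. by move=> pC [l pl g]; exists l => //; apply: perm_trans pC. Qed.

(* [x.2] is the total of the dual variables of the sets inside the component [x.1]: with v as
   root, an in-tree of the component costs [x.2] minus the pointer of v, so that an edge out of
   v at its pointer completes the cost to [x.2]. *)
Definition comp_ok (p : nat -> nat) (x : seq nat * nat) : Prop :=
  [/\ x.1 != [::], uniq x.1, all (gtn N) x.1,
      forall v j, v \in x.1 -> j < p v -> tgt v j \in x.1 &
      forall v, v \in x.1 -> exists l c', [/\ drains [:: v] l c', perm_eq (v :: l) x.1 & c' + p v = x.2]].

Definition verts (cs : seq (seq nat * nat)) : seq nat := flatten [seq x.1 | x <- cs].
Definition path_cost (cs : seq (seq nat * nat)) : nat := sumn [seq x.2 | x <- cs].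

(** The list starts with the end of the path, so each edge leads from a component to the one before
    it in the list. *)
Fixpoint linked (p : nat -> nat) (C : seq nat) (cs : seq (seq nat * nat)) : Prop :=
  if cs is x :: cs' then (exists2 v, v \in x.1 & tgt v (p v) \in C) /\ linked p x.1 cs'
  else True.

Lemma verts_cat cs1 cs2 : verts (cs1 ++ cs2) = verts cs1 ++ verts cs2.
Proof. by rewrite /verts map_cat flatten_cat. Qed.

Lemma path_cost_cat cs1 cs2 : path_cost (cs1 ++ cs2) = path_cost cs1 + path_cost cs2.
Proof. by rewrite /path_cost map_cat sumn_cat. Qed.

Definition bounded (p : nat -> nat) : Prop := forall v, v < N -> p v <= size (T v).

(** Take the in-tree towards [v] and then the pointer edge of [v]. The two costs sum to [x.2]
    whichever vertex serves as the exit. *)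
Lemma drains_comp p x X v : bounded p ->
  comp_ok p x -> v \in x.1 -> tgt v (p v) \in X -> drains X x.1 x.2.
Proof.
move=> ple [_ un /allP ltN _ H] vin tX; have [l [c [g pl <-]]] := H v vin.
have g0 : drains X [:: v] (p v + 0).
  by exists [:: v] => //; apply: GoodCons; [apply: GoodNil| | apply/ple/ltN | ].
apply: (drains_perm (C := l ++ [:: v])); first by rewrite perm_catC.
rewrite addn0 in g0; apply: drains_cat g0 g _ _ => [x0|]; first by rewrite mem_cat => ->.
by rewrite (perm_uniq (_ : perm_eq _ x.1)) // perm_catC.
Qed.

Lemma drains_path p C cs : bounded p -> (forall x, x \in cs -> comp_ok p x) ->
  linked p C cs -> uniq (verts cs) -> drains C (verts cs) (path_cost cs).
Proof.
move=> ple; elim: cs C => [|x cs IH] C ok /=; first by move=> _ _; exists [::] => //; apply: GoodNil.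
move=> [[v vin tin] lk]; rewrite -cat1s verts_cat path_cost_cat => un.
have okx : comp_ok p x by apply: ok; rewrite mem_head.
have d1 := drains_comp ple okx vin tin.
have d2 : drains x.1 (verts cs) (path_cost cs).
  apply: IH => // [y yin|]; first by apply: ok; rewrite inE yin orbT.
  by move: un; rewrite cat_uniq => /and3P [].
apply: (drains_perm (C := verts cs ++ x.1)).
  by rewrite perm_catC /verts /= cats0.
rewrite addnC /path_cost /= addn0; apply: drains_cat d1 d2 _ _ => [y|]; first by rewrite mem_cat => ->.
by move: un; rewrite uniq_catC /verts /= cats0.
Qed.

Lemma linked_cat p x cs1 cs2 :
  linked p x.1 (cs1 ++ cs2) <-> linked p x.1 cs1 /\ linked p (last x cs1).1 cs2.
Proof.
elim: cs1 x => [|y cs IH] x /=; first by split=> [|[]].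
rewrite IH; tauto.
Qed.

Lemma linked_sub p C C' cs : {subset C <= C'} -> linked p C cs -> linked p C' cs.
Proof. by case: cs => //= x cs sub [[v vin /sub tin] H]; split=> //; exists v. Qed.

Lemma linked_ext p p' C cs : {in verts cs, p =1 p'} -> linked p C cs -> linked p' C cs.
Proof.
elim: cs C => //= x cs IH C E [[v vin tin] H]; split.
  by exists v; rewrite // -E // /verts /= mem_cat vin.
by apply: IH => // u uin; apply: E; rewrite /verts /= mem_cat uin orbT.
Qed.

Lemma verts_sub (x : seq nat * nat) cs : x \in cs -> {subset x.1 <= verts cs}.
Proof. by move=> xin v vin; apply/flattenP; exists x.1 => //; apply: map_f. Qed.

(** The components form a cycle closed by the edge of [v]. To root the union at [r], cut the cycle
    at the component [y] of [r]: [y] keeps its in-tree towards [r], and every other component leaves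
    along its edge of the cycle at its full cost. *)
Lemma comp_ok_merge p x seg v : bounded p -> uniq (verts (x :: seg)) ->
  (forall y, y \in x :: seg -> comp_ok p y) -> linked p x.1 seg ->
  v \in x.1 -> tgt v (p v) \in (last x seg).1 ->
  comp_ok p (verts (x :: seg), path_cost (x :: seg)).
Proof.
move=> ple un ok lk vin tin; split=> //=.
- have [] := ok x (mem_head _ _); rewrite /verts /=.
  by case: (x.1).
- apply/allP => u /flattenP [C /mapP [y yin ->]].
  by have [_ _ /allP H _ _] := ok y yin; apply: H.
- move=> u j /flattenP [C /mapP [y yin ->]] uin lj; apply: (verts_sub yin).
  by have [_ _ _ H _] := ok y yin; apply: H.
- move=> r /flattenP [C /mapP [y yin ->]] rin {C}.
  have [_ _ _ _ /(_ r rin) [l [c [dl pl Ey]]]] := ok y yin.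
  suff [L [C' [dL EC]]] : exists L c', drains [:: r] L c' /\
      (perm_eq (r :: L) (verts (x :: seg)) /\ c' + p r = path_cost (x :: seg)) by exists L, C'; case: EC.
  case/splitPr E: {-1}_ / yin ok un lk tin => [[|z s1] s2] ok un lk tin.
    (* The root lies in [x] itself: all of [seg] flows down the path into [x], and the closing edge
       is dropped. *)
    case: E => Ex Es; subst y s2; exists (verts seg ++ l), (path_cost seg + c).
    have pr : perm_eq (r :: verts seg ++ l) (verts (x :: seg)).
      by apply/seq.permP => a; have /seq.permP/(_ a) := pl; rewrite /verts /= !count_cat; lia.
    split; last by split=> //; rewrite /path_cost /= -Ey; lia.
    have := perm_uniq pr; rewrite un cons_uniq => /andP [_ un2].
    have dseg : drains x.1 (verts seg) (path_cost seg).
      apply: (@drains_path p) => // [y yin|]; first by apply: ok; rewrite inE yin orbT.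
      by move: un2; rewrite cat_uniq => /and3P [].
    apply: drains_cat dl dseg _ un2 => u; rewrite -(perm_mem pl) inE mem_cat mem_seq1.
    by rewrite orbC.
  (* The root lies further back on the path: [s2] flows into [y], [x] leaves through [v] into the
     last component, and [s1] flows into [x]. *)
  case: E => Ez Es; subst z seg.
  exists (verts s1 ++ x.1 ++ verts s2 ++ l), (path_cost s1 + (x.2 + (path_cost s2 + c))).
  have pr : perm_eq (r :: verts s1 ++ x.1 ++ verts s2 ++ l) (verts (x :: s1 ++ y :: s2)).
    apply/seq.permP => a; have /seq.permP/(_ a) := pl.
    have -> : verts (x :: s1 ++ y :: s2) = x.1 ++ verts s1 ++ y.1 ++ verts s2.
      by rewrite /verts /= map_cat flatten_cat.
    by rewrite /= !count_cat; move=> /= *; lia.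
  split; last first.
    have -> : path_cost (x :: s1 ++ y :: s2) = x.2 + (path_cost s1 + (y.2 + path_cost s2)).
      by rewrite /path_cost /= map_cat sumn_cat.
    by split=> //; rewrite -Ey; lia.
  have := perm_uniq pr; rewrite un cons_uniq => /andP [_ un2].
  have /and3P [u1 _ un3] : [&& uniq (verts s1), ~~ has (mem (verts s1)) (x.1 ++ verts s2 ++ l)
      & uniq (x.1 ++ verts s2 ++ l)] by rewrite -cat_uniq.
  have /and3P [_ _ un4] : [&& uniq x.1, ~~ has (mem x.1) (verts s2 ++ l)
      & uniq (verts s2 ++ l)] by rewrite -cat_uniq.
  have /and3P [u2 _ _] : [&& uniq (verts s2), ~~ has (mem (verts s2)) l
      & uniq l] by rewrite -cat_uniq.
  move/linked_cat: lk => [lk1 /= [_ lk2]].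
  have oks1 : forall w, w \in s1 -> comp_ok p w.
    by move=> w win; apply: ok; rewrite inE mem_cat win orbT.
  have oks2 : forall w, w \in s2 -> comp_ok p w.
    by move=> w win; apply: ok; rewrite inE mem_cat inE win !orbT.
  have d2 := drains_path ple oks2 lk2 u2.
  have d12 : drains [:: r] (verts s2 ++ l) (path_cost s2 + c).
    apply: drains_cat dl d2 _ un4 => u; rewrite -(perm_mem pl) inE mem_cat mem_seq1.
    by rewrite orbC.
  rewrite last_cat /= in tin.
  have d3 := drains_comp ple (ok x (mem_head _ _)) vin tin.
  have d4 := drains_path ple oks1 lk1 u1.
  apply: drains_cat d4 _ un2 => [|u ux]; last by rewrite !mem_cat ux.
  apply: drains_cat d12 d3 _ un3 => u uin.
  have := mem_last y s2; rewrite inE => /orP [/eqP E|lin].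
    move: uin; rewrite E -(perm_mem pl) inE !mem_cat mem_seq1.
    by case/orP=> ->; rewrite ?orbT.
  by rewrite !mem_cat (verts_sub lin uin).
Qed.

(* F is the finished part and cs the current path of components, last one first.  [inv_dual]
   lists the sets raised so far and [inv_primal] carries a solution of the same value. *)
Record arb_inv (F : seq nat) (cs : seq (seq nat * nat)) (p : nat -> nat) (c : nat) : Prop := Inv {
  inv_uniq : uniq (F ++ verts cs);
  inv_lt : all (gtn N) F;
  inv_unvisited : forall v, v \notin F ++ verts cs -> p v = 0;
  inv_bounded : bounded p;
  inv_comp : forall x, x \in cs -> comp_ok p x;
  inv_linked : if cs is x :: cs' then linked p x.1 cs' else True;
  inv_dual : exists Ss : seq (seq nat), [/\ size Ss = c,
      forall S, S \in Ss -> S != [::] /\ all (gtn N) S,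
      forall v, p v = count (fun S : seq nat => v \in S) Ss &
      forall v j, v < N -> j <= size (T v) ->
        count (fun S : seq nat => (v \in S) && (tgt v j \notin S)) Ss <= j];
  inv_primal : exists2 y, drains [:: N] F y & y + path_cost cs = c }.

Lemma inv_init : arb_inv [::] [::] (fun _ => 0) 0.
Proof.
split=> //; first by exists [::].
by exists 0 => //; exists [::] => //; apply: GoodNil.
Qed.

Lemma inv_push F cs p c t : arb_inv F cs p c -> t < N -> t \notin F ++ verts cs ->
  (if cs is x :: _ then exists2 v, v \in x.1 & tgt v (p v) = t else True) ->
  arb_inv F (([:: t], 0) :: cs) p c.
Proof.
move=> I tN nt lk; case: I => un lt unv bd ok lks du [y dr Ey].
have pt : p t = 0 by apply: unv.
have verts1 : verts (([:: t], 0) :: cs) = t :: verts cs by [].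
split=> //.
- by rewrite verts1 -cat1s uniq_catCA /= nt.
- by move=> v; rewrite verts1 -cat1s mem_cat mem_cat orbCA -!mem_cat => nv; apply: unv; move: nv; rewrite inE negb_or => /andP [].
- move=> x; rewrite inE => /orP [/eqP ->|/ok //]; split=> //=; first by rewrite tN.
    by move=> v j; rewrite inE => /eqP ->; rewrite pt.
  move=> v; rewrite inE => /eqP ->; exists [::], 0; split=> //.
  by exists [::] => //; apply: GoodNil.
- by case: cs lk lks {un unv ok dr Ey nt verts1} => //= x cs [v vin <-] lks; split=> //; exists v; rewrite ?mem_head.
- by exists y.
Qed.

Lemma inv_finish F cs p c x v : arb_inv F (x :: cs) p c -> v \in x.1 ->
  tgt v (p v) \in N :: F -> arb_inv (verts (x :: cs) ++ F) [::] p c.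
Proof.
move=> I vin tin; case: I => un lt unv bd ok lks du [y dr Ey].
split=> //; rewrite ?cats0.
- by rewrite uniq_catC.
- rewrite all_cat lt andbT; apply/allP => u /flattenP [C /mapP [z zin ->]].
  by have [_ _ /allP H _ _] := ok z zin; apply: H.
- by move=> u nu; apply: unv; rewrite mem_cat orbC -mem_cat.
- exists c; last by rewrite addn0.
  have unx : uniq (verts (x :: cs)) by move: un; rewrite cat_uniq => /and3P [].
  have dx := drains_comp bd (ok x (mem_head _ _)) vin tin.
  have dcs : drains x.1 (verts cs) (path_cost cs).
    apply: (@drains_path p) => // [z zin|]; first by apply: ok; rewrite inE zin orbT.
    by move: unx; rewrite /verts /= cat_uniq => /and3P [].
  have dd : drains (N :: F) (verts cs ++ x.1) (path_cost cs + x.2).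
    apply: drains_cat dx dcs _ _ => [u|]; first by rewrite mem_cat => ->.
    by rewrite uniq_catC.
  have pe : perm_eq ((verts cs ++ x.1) ++ F) (verts (x :: cs) ++ F).
    by rewrite perm_cat2r perm_catC.
  apply: (drains_perm pe); rewrite -Ey (_ : y + path_cost (x :: cs) = path_cost cs + x.2 + y).
    apply: drains_cat dr dd _ _ => [u|]; first by rewrite inE mem_cat inE orbC.
    by rewrite (perm_uniq pe) uniq_catC.
  by rewrite /path_cost /=; lia.
Qed.

Lemma inv_merge F x seg rest p c v : arb_inv F (x :: seg ++ rest) p c -> v \in x.1 ->
  tgt v (p v) \in (last x seg).1 ->
  arb_inv F ((verts (x :: seg), path_cost (x :: seg)) :: rest) p c.
Proof.
move=> I vin tin; case: I => un lt unv bd ok lks du [y dr Ey].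
have E : verts ((verts (x :: seg), path_cost (x :: seg)) :: rest) = verts (x :: seg ++ rest).
  by rewrite -[x :: seg ++ rest]/((x :: seg) ++ rest) verts_cat.
have [lk1 lk2] := (linked_cat p x seg rest).1 lks.
split=> //; rewrite ?E //.
- move=> z; rewrite inE => /orP [/eqP ->|zin]; last by apply: ok; rewrite inE mem_cat zin !orbT.
  apply: comp_ok_merge vin tin => //.
    have /and3P [_ _] : [&& uniq F, ~~ has (mem F) (verts (x :: seg ++ rest))
      & uniq (verts (x :: seg ++ rest))] by rewrite -cat_uniq.
    by rewrite -[x :: seg ++ rest]/((x :: seg) ++ rest) verts_cat cat_uniq => /and3P [].
  by move=> w; rewrite inE => win; apply: ok; rewrite inE mem_cat; case/orP: win => ->; rewrite ?orbT.
- apply: linked_sub lk2; apply: verts_sub; exact: mem_last.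
- exists y => //; rewrite -Ey -[x :: seg ++ rest]/((x :: seg) ++ rest) path_cost_cat; congr addn.
Qed.

(** No edge at a current pointer leaves the component, so there is slack for one more copy of [x.1]
    among the dual sets. Every pointer and the total move up together, so the in-trees keep their
    cost. *)
Lemma inv_raise F x cs p c : arb_inv F (x :: cs) p c ->
  {in x.1, forall v, tgt v (p v) \in x.1} ->
  arb_inv F ((x.1, x.2.+1) :: cs) (fun v => p v + (v \in x.1)) c.+1.
Proof.
move=> I tin; case: I => un lt unv bd ok lks du [y dr Ey].
have [ne unx /allP ltx inx prx] := ok x (mem_head _ _).
have E : verts ((x.1, x.2.+1) :: cs) = verts (x :: cs) by [].
have unx2 : uniq (verts (x :: cs)) by move: un; rewrite cat_uniq => /and3P [].
have disj u : u \in verts cs -> u \notin x.1.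
  move=> uin; apply/negP => ux; move: unx2; rewrite /verts /= cat_uniq => /and3P [_ /hasP []].
  by exists u.
(* An exhausted list would lead to the sink [N], which is outside the component. *)
have ples v : v \in x.1 -> p v < size (T v).
  move=> vin; rewrite ltnNge; apply/negP => le; have := ltx _ (tin v vin).
  by rewrite /tgt nth_default //= ltnn.
have pE : {in verts cs, p =1 (fun v => p v + (v \in x.1))}.
  by move=> v /disj /negbTE ->; rewrite addn0.
split=> //; rewrite ?E.
- move=> v nv; rewrite unv //; move: nv; rewrite /verts /= !mem_cat !negb_or.
  by case/and3P=> _ /negbTE ->.
- move=> v lv; case: (boolP (v \in x.1)) => [/ples|_]; first lia.
  by rewrite addn0; apply: bd.
- move=> z; rewrite inE => /orP [/eqP ->|zin].
    split=> /=; [by []|by []|exact/allP| |].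
      move=> v j vin; rewrite vin addn1 ltnS leq_eqVlt => /orP [/eqP ->|]; first exact: tin.
      exact: inx.
    move=> v vin; have [l [c' [d pl Ex]]] := prx v vin; exists l, c'; split=> //.
    by rewrite vin -Ex addn1 addnS.
  have zin2 : z \in x :: cs by rewrite inE zin orbT.
  have [a1 a2 a3 a4 a5] := ok z zin2.
  by split=> // [v j vin|v vin]; rewrite -pE ?(verts_sub zin) //; [apply: a4|apply: a5].
- by apply: linked_ext lks.
- case: du => Ss [sz ne2 pc cnt]; exists (x.1 :: Ss); split=> //=.
  + by rewrite sz.
  + by move=> S; rewrite inE => /orP [/eqP ->|/ne2 //]; split=> //; apply/allP.
  + by move=> v; rewrite pc addnC.
  + move=> v j vN lej; case: (boolP (v \in x.1)) => vx /=; last exact: cnt.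
    case: (boolP (tgt v j \in x.1)) => tx /=; first exact: cnt.
    (* All entries up to the pointer stay inside, so an edge that leaves costs more than [p v], the
       number of earlier sets containing [v]; the new set still fits. *)
    have : p v < j.
      rewrite ltnNge leq_eqVlt; apply/negP => /orP [/eqP ej|lj].
        by move: (tin v vx); rewrite -ej (negbTE tx).
      by move: (inx v j vx lj); rewrite (negbTE tx).
    rewrite pc add1n; apply: leq_ltn_trans; apply: sub_count => S; by case/andP.
- by exists y => //; rewrite -Ey /path_cost /= -addnS.
Qed.

(** * Optimality by duality *)

Lemma good_choice X l c : good X l c -> exists jf : nat -> nat,
  [/\ forall v, v \in l -> jf v <= size (T v), sumn (map jf l) = c &
     forall A : pred nat, (forall v, v \in l -> A v -> A (tgt v (jf v))) ->
      (forall x, x \in X -> ~~ A x) -> forall v, v \in l -> ~~ A v].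
Proof.
elim=> [|u j {}l {}c g [jf [le Es H]] nu lej tin]; first by exists (fun _ => 0).
exists (fun v => if v == u then j else jf v).
have En v : v \in l -> (v == u) = false by move=> vin; apply: contraNF nu => /eqP <-.
split=> [v||A Acl AX].
- by rewrite inE; case: eqP => [->|_] //=; apply: le.
- rewrite /= eqxx -Es; congr (j + sumn _); apply/eq_in_map => v vin.
  by rewrite En.
have Hl v : v \in l -> ~~ A v.
  apply: H AX v => v vin Av; have := Acl v; rewrite En // inE vin orbT; exact.
move=> v; rewrite inE => /orP [/eqP ->|]; last exact: Hl.
apply/negP => /(Acl u (mem_head _ _)); rewrite eqxx; apply/negP.
by move: tin; rewrite mem_cat => /orP [/Hl|/AX].
Qed.

(** Weak duality by double counting: an acyclic choice must leave each of the [c] raised sets by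
    some edge, while an edge of cost [j] leaves at most [j] of them. *)
Lemma inv_optimal F p c : arb_inv F [::] p c -> (forall v, v < N -> v \in F) ->
  (exists j, [/\ acyclic j, bounded j & \sum_(v < N) j v = c]) /\
  (forall j, acyclic j -> bounded j -> c <= \sum_(v < N) j v).
Proof.
move=> [un /allP lt _ _ _ _ [Ss [sz ne pc cnt]] [y [l pl g] Ey]] all_in; split.
  have [jf [le Es H]] := good_choice g.
  have lN v : (v \in l) = (v < N).
    by rewrite (perm_mem pl); apply/idP/idP => [/lt|/all_in].
  exists jf; split=> [A HA v|v vN|].
  - apply/negP => Av; have [vN _] := HA v Av.
    move: Av; apply/negP; apply: (H A); last by rewrite lN.
      by move=> u _ /HA [].
    by move=> x; rewrite inE => /eqP ->; apply/negP => /HA []; rewrite ltnn.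
  - by apply: le; rewrite lN.
  - move: Ey; rewrite /path_cost addn0 => <-; rewrite -Es sumnE big_map.
    rewrite -(big_mkord xpredT) /=; apply: perm_big.
    apply: uniq_perm; rewrite ?iota_uniq //; first by rewrite (perm_uniq pl); rewrite cats0 in un.
    by move=> v; rewrite mem_index_iota lN.
move=> j ac bd.
have le : \sum_(v < N) count (fun S : seq nat => (val v \in S) && (tgt v (j v) \notin S)) Ss
    <= \sum_(v < N) j v.
  by apply: leq_sum => v _; apply: cnt; [exact: ltn_ord|apply: bd; exact: ltn_ord].
apply: leq_trans le.
rewrite -sz -sum1_size.
under [X in _ <= X]eq_bigr => v _ do rewrite -sum1_count big_mkcond /=.
rewrite exchange_big /= big_seq [X in _ <= X]big_seq; apply: leq_sum => S SS.
have [neS /allP ltS] := ne S SS.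
have [|nex] := boolP [exists v : 'I_N, (val v \in S) && (tgt v (j v) \notin S)].
  by case/existsP=> v vP; rewrite (bigD1 v) //= vP.
(* If no chosen edge leaves [S], then [S] is closed, and acyclicity makes it empty. *)
have : forall v, ~~ (v \in S).
  apply: ac => v vS; have vN := ltS _ vS; split=> //.
  move: nex; rewrite negb_exists => /forallP/(_ (Ordinal vN)) /=.
  by rewrite vS /= negbK.
by case: (S) neS => // u S' _ /(_ u); rewrite mem_head.
Qed.

End Arborescence.

(** * Stable matchings and closed sets *)

Section Marriage.
Variable n : nat.
Implicit Types (LM LW : 'I_n -> seq 'I_n) (mu : {perm 'I_n}) (m w : 'I_n) (M : {set 'I_n * 'I_n}).

Definition cand LM LW mu w : seq 'I_n :=
  [seq m <- LW w | prefers (LW w) ((mu^-1)%g w) m && prefers (LM m) w (mu m)].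

Definition closed_set (C : 'I_n -> seq 'I_n) mu (A : {set 'I_n}) : bool :=
  (A != set0) && [forall w in A, if C w is m :: _ then mu m \in A else false].

Definition symmetric_lists LM LW : Prop :=
  (forall i, uniq (LM i) /\ uniq (LW i)) /\ forall m w, (w \in LM m) = (m \in LW w).

Lemma in_matching_of_perm mu m w : ((m, w) \in matching_of_perm mu) = (w == mu m).
Proof.
apply/imsetP/eqP => [[x _ [-> ->]] //|->]; by exists m.
Qed.

(** One membership suffices: an absent element has index [size l] and thus ranks behind everything
    present. *)
Lemma prefers_total (l : seq 'I_n) a b : a \in l -> a != b -> prefers l a b \/ prefers l b a.
Proof.
move=> al ne; rewrite /prefers; case: ltngtP; [by left|by right|] => E; case/eqP: ne.
have bl : b \in l by rewrite -index_mem -E index_mem.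
by rewrite -(nth_index a al) E nth_index.
Qed.

Lemma prefers_trans (l : seq 'I_n) a b c : prefers l a b -> prefers l b c -> prefers l a c.
Proof. exact: ltn_trans. Qed.

Lemma prefersxx (l : seq 'I_n) a : prefers l a a = false.
Proof. exact: ltnn. Qed.

Lemma blocks_perm LM LW mu m w : blocks LM LW (matching_of_perm mu) m w <->
  [/\ acceptable LM LW m w, prefers (LM m) w (mu m) & prefers (LW w) m ((mu^-1)%g w)].
Proof.
split=> [[a [p q]]|[a p q]].
  by split=> //; [apply: p | apply: q]; rewrite in_matching_of_perm ?permKV.
split=> //; split=> [w'|m']; rewrite in_matching_of_perm => /eqP E; first by rewrite E.
by rewrite E permK -E in q.
Qed.

Section OneSided.
Variables (LM LW : 'I_n -> seq 'I_n) (mu : {perm 'I_n}).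
Hypothesis sym : symmetric_lists LM LW.
Hypothesis acc : forall m, acceptable LM LW m (mu m).
Hypothesis nblock : forall m w, ~ blocks LM LW (matching_of_perm mu) m w.

Lemma cand_head w m s : cand LM LW mu w = m :: s ->
  [/\ m \in LW w, prefers (LW w) ((mu^-1)%g w) m & prefers (LM m) w (mu m)].
Proof.
by move=> E; have := mem_head m s; rewrite -E mem_filter => /andP [/andP [-> ->] ->].
Qed.

Lemma filter_head_first (P : pred 'I_n) (l : seq 'I_n) m s x :
  filter P l = m :: s -> x \in l -> P x -> x = m \/ prefers l m x.
Proof.
elim: l => //= y l IH; case: ifP => [Py [<- _]|nPy E].
  rewrite inE => /orP [/eqP ->|xl Px]; first by left.
  by case: (eqVneq x y) => [|ne]; [left|right; rewrite /prefers /= eqxx eq_sym (negbTE ne)].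
rewrite inE => /orP [/eqP -> Px|xl Px]; first by rewrite Px in nPy.
have [|pr] := IH E xl Px; [by left|right].
have Pm : P m by have := mem_head m s; rewrite -E mem_filter => /andP [].
by rewrite /prefers /=; do 2 (case: eqP => [e|_]; first by rewrite e ?Px ?Pm in nPy).
Qed.

(* Rotating a closed set that is minimal yields another stable matching. *)
Lemma closed_set_rotation A : closed_set (cand LM LW mu) mu A ->
  exists2 M, stable LM LW M & M <> matching_of_perm mu.
Proof.
move=> /minset_exists [B /minsetP [/andP [B0 /forall_inP clB] minB] _] {A}.
pose hd w := head ((mu^-1)%g w) (cand LM LW mu w).
pose g w := mu (hd w).
have hdP w : w \in B -> exists s, cand LM LW mu w = hd w :: s.
  by move=> /clB; rewrite /hd; case: (cand _ _ _ w) => // m s _; exists s.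
have gB w : w \in B -> g w \in B.
  by move=> wB; have := clB w wB; rewrite /g; have [s ->] := hdP w wB.
(* The image of [B] is again closed, so minimality makes [g] a permutation of [B]. This is what
   makes the rotated assignment [h] injective. *)
have gE : g @: B = B.
  apply: minB; last by apply/subsetP => _ /imsetP [w wB ->]; apply: gB.
  apply/andP; split; first by rewrite imset_eq0.
  apply/forall_inP => _ /imsetP [w wB ->]; have [s ->] := hdP _ (gB _ wB).
  by rewrite -[mu _]/(g (g w)) imset_f ?gB.
have ginj : {in B &, injective g} by apply/imset_injP; rewrite gE.
pose h w := if w \in B then hd w else (mu^-1)%g w.
have hinj : injective h.
  move=> w1 w2; rewrite /h; case: ifP => b1; case: ifP => b2.
  - by move=> E; apply: ginj => //; rewrite /g E.
  - by move=> E; have := gB _ b1; rewrite /g E permKV b2.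
  - by move=> E; have := gB _ b2; rewrite /g -E permKV b1.
  - exact: perm_inj.
have hacc w : acceptable LM LW (h w) w.
  rewrite /h; case: ifP => wB; last by have := acc ((mu^-1)%g w); rewrite permKV.
  have [s /cand_head [mL _ _]] := hdP w wB.
  by rewrite /acceptable (proj2 sym) mL.
pose M := [set (h w, w) | w : 'I_n].
have MP m w : ((m, w) \in M) = (m == h w).
  by apply/imsetP/eqP => [[x _ [-> ->]] //|->]; exists w.
exists M; last first.
  move=> EM; have [w wB] := set0Pn _ B0; have [s /cand_head [_ pr _]] := hdP w wB.
  have : (h w, w) \in M by rewrite MP.
  rewrite EM in_matching_of_perm /h wB => /eqP Ew.
  have E : (mu^-1)%g w = hd w by rewrite [in LHS]Ew permK.
  by rewrite E prefersxx in pr.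
split.
  split; first by move=> [m w]; rewrite MP => /eqP ->; apply: hacc.
  split=> [[m1 w1] [m2 w2]|[m1 w1] [m2 w2]]; rewrite !MP => /eqP -> /eqP -> /= E.
    by rewrite (hinj _ _ E).
  by rewrite E.
move=> m w [am [pm pw]]; have hmw : (h w, w) \in M by rewrite MP.
have {}pw := pw _ hmw.
have [w' Ew'] : exists w', h w' = m by have [h' _ hK] := injF_bij hinj; exists (h' m).
have {}pm : prefers (LM m) w w' by apply: pm; rewrite MP Ew'.
(* No man loses by the rotation, so preferring [w] to the new partner implies preferring her to the
   old one. *)
have pmu : prefers (LM m) w (mu m).
  move: Ew'; rewrite /h; case: ifP => w'B Ew'; last by move: pm; rewrite -Ew' permKV.
  have [s /cand_head [_ _]] := hdP w' w'B; rewrite Ew'; exact: prefers_trans pm.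
have [/andP [wLM mLW]] := am.
(* Otherwise the pair would already block M*. Hence [m] is a candidate of [w], and [w] holds her
   first candidate or her old partner, both at least as good as [m]. *)
have pmw : prefers (LW w) ((mu^-1)%g w) m.
  have nb : ~~ prefers (LW w) m ((mu^-1)%g w).
    by apply/negP => p; apply: (nblock (m := m) (w := w)); apply/blocks_perm.
  have [||p|//] := @prefers_total (LW w) m ((mu^-1)%g w) => //.
    by apply: contraTneq pmu => ->; rewrite permKV prefersxx.
  by rewrite p in nb.
move: pw; rewrite /h; case: ifP => wB pw.
  have [s E] := hdP w wB.
  have [|e|p] := filter_head_first E mLW; first by rewrite pmw pmu.
    by rewrite e prefersxx in pw.
  by have := prefers_trans pw p; rewrite prefersxx.
by have := prefers_trans pw pmw; rewrite prefersxx.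
Qed.

(** The closed set consists of the women whose partner in [M] is better off there than in M*. Such a
    woman is worse off, and a counting argument shows that the M*-partners of these women are
    exactly the better-off men. *)
Lemma better_man_closed_set M m0 w0 : stable LM LW M -> (m0, w0) \in M ->
  prefers (LM m0) w0 (mu m0) -> exists A, closed_set (cand LM LW mu) mu A.
Proof.
move=> [[Macc [Mf1 Mf2]] Mst] M0 p0.
have Macc' m w : (m, w) \in M -> (w \in LM m) /\ (m \in LW w) by move=> /Macc /andP.
pose better m w := ((m, w) \in M) && prefers (LM m) w (mu m).
pose A0 := [set m | [exists w, better m w]].
pose A := [set w | [exists m, better m w]].
have worse m w : better m w -> prefers (LW w) ((mu^-1)%g w) m.
  move=> /andP [mw p]; have [wL mL] := Macc' _ _ mw.
  have nb : ~~ prefers (LW w) m ((mu^-1)%g w).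
    apply/negP => q; apply: (nblock (m := m) (w := w)); apply/blocks_perm.
    by split=> //; rewrite /acceptable wL.
  have [||q|//] := @prefers_total (LW w) m ((mu^-1)%g w) => //.
    by apply: contraTneq p => ->; rewrite permKV prefersxx.
  by rewrite q in nb.
(* Unless [m1] is better off in [M], he would block [M] together with [w]. *)
have up m w m1 : better m w -> m1 \in LW w -> prefers (LW w) m1 m ->
    (w = mu m1 \/ prefers (LM m1) w (mu m1)) -> m1 \in A0.
  move=> bmw m1L pr pm1; have /andP [mw _] := bmw.
  rewrite inE; apply/existsP; case: (boolP [exists w', better m1 w']) => [/existsP //|/existsPn nb]; exfalso.
  apply: (Mst m1 w); split; first by rewrite /acceptable (proj2 sym) m1L.
  split=> [w' m1w'|m' m'w]; last by have [->] := Mf2 _ _ m'w mw erefl.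
  have [w'L m1L'] := Macc' _ _ m1w'.
  have nww : w' != w.
    apply: contraTneq pr => Ew; rewrite Ew in m1w'.
    by have [->] := Mf2 _ _ m1w' mw erefl; rewrite prefersxx.
  have nbw := nb w'; rewrite /better m1w' /= in nbw.
  have [||//|q] := @prefers_total (LM m1) w w' => //.
  - by rewrite (proj2 sym).
  - by rewrite eq_sym.
  - case: pm1 => [Ew|pm1]; first by rewrite -Ew q in nbw.
    by rewrite (prefers_trans q pm1) in nbw.
have AA0 : mu @^-1: A \subset A0.
  apply/subsetP => m1; rewrite !inE => /existsP [m bm].
  have := up m (mu m1) m1 bm; rewrite inE; apply; [|by have := worse _ _ bm; rewrite permK|by left].
  by have /andP [] := acc m1.
pose f m := odflt m [pick w | better m w].
have fP m : m \in A0 -> better m (f m).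
  rewrite inE /f; case: pickP => //= nb /existsP [w]; by rewrite nb.
have fA : f @: A0 \subset A.
  by apply/subsetP => _ /imsetP [m mA ->]; rewrite inE; apply/existsP; exists m; apply: fP.
have cf : #|f @: A0| = #|A0|.
  apply: card_in_imset => m1 m2 /fP /andP [i1 _] /fP /andP [i2 _] E.
  by rewrite E in i1; have [] := Mf2 _ _ i1 i2 erefl.
have cA : #|mu @^-1: A| = #|A|.
  by apply: on_card_preimset; apply: onW_bij; exists (mu^-1)%g; [exact: permK|exact: permKV].
(* Both [mu] and [M] match these sets injectively: the size of [A] is at most that of [A0] by [mu],
   and at least that by [M]. *)
have eqA : mu @^-1: A = A0.
  by apply/eqP; rewrite eqEcard AA0 cA -cf subset_leq_card.
exists A; apply/andP; split.
  by apply/set0Pn; exists w0; rewrite inE; apply/existsP; exists m0; apply/andP.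
apply/forall_inP => w; rewrite inE => /existsP [m bm]; have /andP [mw pm] := bm.
have [wL mL] := Macc' _ _ mw.
have : m \in cand LM LW mu w by rewrite mem_filter worse // pm.
case E: (cand LM LW mu w) => [//|m1 s] _.
have [m1L _ p1] := cand_head E.
have m1A : m1 \in A0.
  have [|<-|p] := filter_head_first E mL; first by rewrite worse.
    by rewrite inE; apply/existsP; exists w.
  by apply: (up m w m1) => //; right.
by move: m1A; rewrite -eqA inE.
Qed.

End OneSided.

(** * Exchange of the two sides *)

Definition swap M : {set 'I_n * 'I_n} := [set p | (p.2, p.1) \in M].

Lemma in_swap M m w : ((m, w) \in swap M) = ((w, m) \in M). Proof. by rewrite inE. Qed.

Lemma swapK M : swap (swap M) = M.
Proof. by apply/setP => [[m w]]; rewrite !in_swap. Qed.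

Lemma swap_perm mu : swap (matching_of_perm mu) = matching_of_perm mu^-1.
Proof.
apply/setP => [[m w]]; rewrite in_swap !in_matching_of_perm.
by apply/eqP/eqP => ->; rewrite ?permK ?permKV.
Qed.

Lemma acceptable_swap LM LW m w : acceptable LW LM w m = acceptable LM LW m w.
Proof. exact: andbC. Qed.

Lemma blocks_swap LM LW M m w : blocks LW LM (swap M) w m -> blocks LM LW M m w.
Proof.
move=> [a [p q]]; split; first by rewrite acceptable_swap in a.
by split=> [w' i|m' i]; [apply: q | apply: p]; rewrite in_swap.
Qed.

Lemma stable_swap LM LW M : stable LM LW M -> stable LW LM (swap M).
Proof.
move=> [[a [f1 f2]] st]; split; last first.
  by move=> w m b; apply: (st m w); apply: blocks_swap b.
split=> [[w m]|].
  by rewrite in_swap => /a; rewrite acceptable_swap.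
split=> [[w1 m1] [w2 m2]|[w1 m1] [w2 m2]]; rewrite !in_swap => i1 i2 /= E.
  by have [-> ->] := f2 _ _ i1 i2 E.
by have [-> ->] := f1 _ _ i1 i2 E.
Qed.

Lemma symmetric_swap LM LW : symmetric_lists LM LW -> symmetric_lists LW LM.
Proof. by move=> [u s]; split=> [i|m w]; [have [] := u i | rewrite s]. Qed.

(** The graph on women rules out matchings with a better-off man; the graph on men, obtained by
    exchanging the sides, rules out those with a better-off woman. *)
Lemma unique_stable_iff LM LW mu : symmetric_lists LM LW ->
  (forall m, acceptable LM LW m (mu m)) ->
  unique_stable LM LW (matching_of_perm mu) <->
  [/\ forall m w, ~ blocks LM LW (matching_of_perm mu) m w,
      forall A, ~~ closed_set (cand LM LW mu) mu A &
      forall A, ~~ closed_set (cand LW LM mu^-1) mu^-1 A].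
Proof.
move=> sym acc; have sym' := symmetric_swap sym.
have acc' w : acceptable LW LM w ((mu^-1)%g w).
  by rewrite acceptable_swap; have := acc ((mu^-1)%g w); rewrite permKV.
have stP : (forall m w, ~ blocks LM LW (matching_of_perm mu) m w) ->
    stable LM LW (matching_of_perm mu).
  move=> nb; split=> //; split=> [[m w]|].
    by rewrite in_matching_of_perm => /eqP ->.
  split=> [[m1 w1] [m2 w2]|[m1 w1] [m2 w2]]; rewrite !in_matching_of_perm => /eqP -> /eqP -> /= E.
    by rewrite E.
  by rewrite (perm_inj E).
have nb' : (forall m w, ~ blocks LM LW (matching_of_perm mu) m w) ->
    forall w m, ~ blocks LW LM (matching_of_perm mu^-1) w m.
  by move=> nb w m b; apply: (nb m w); apply: blocks_swap; rewrite swap_perm.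
split=> [[[_ nb] uni]|[nb clW clM]].
  split=> // A; apply/negP => cl.
    by have [M st ne] := closed_set_rotation sym acc nb cl; apply/ne/uni.
  have [M /stable_swap st ne] := closed_set_rotation sym' acc' (nb' nb) cl.
  by apply: ne; rewrite -[M]swapK (uni _ st) swap_perm.
split; first exact: stP.
move=> M st.
have nobetterM m w : (m, w) \in M -> ~~ prefers (LM m) w (mu m).
  move=> i; apply/negP => p.
  by have [A] := better_man_closed_set sym acc nb st i p; rewrite (negbTE (clW A)).
have nobetterW m w : (m, w) \in M -> ~~ prefers (LW w) m ((mu^-1)%g w).
  rewrite -in_swap => i; apply/negP => p.
  have [A] := better_man_closed_set sym' acc' (nb' nb) (stable_swap st) i p.
  by rewrite (negbTE (clM A)).
have [[Macc [f1 f2]] Mst] := st.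
(* With nobody better off than in M*, a pair of M* missing from [M] would block [M]. *)
have sub m : (m, mu m) \in M.
  apply/negPn/negP => nin; apply: (Mst m (mu m)); split=> //; split=> [w' i|m' i].
    have /andP [wL _] := Macc _ i; have [||//|q] := @prefers_total (LM m) (mu m) w' => //.
    - by have /andP [] := acc m.
    - by apply: contraNneq nin => ->.
    - by rewrite (negbTE (nobetterM _ _ i)) in q.
  have := nobetterW _ _ i; rewrite permK => nbet.
  have [||//|q] := @prefers_total (LW (mu m)) m m' => //.
  - by have /andP [] := acc m.
  - by apply: contraNneq nin => E; rewrite [X in (X, _)]E.
  - by rewrite q in nbet.
apply/setP => [[m w]]; rewrite in_matching_of_perm; apply/idP/eqP => [i|->//].
by have [] := f1 _ _ i (sub m) erefl.
Qed.

Lemma prefers_filter (P : pred 'I_n) (l : seq 'I_n) a b :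
  P a -> P b -> prefers (filter P l) a b = prefers l a b.
Proof.
move=> Pa Pb; rewrite /prefers; elim: l => //= x l IH.
case: ifP => Px /=.
  by case: eqP => _; case: eqP => _ //; rewrite !ltnS.
do 2 (case: eqP => [e|_]; first by rewrite e ?Pa ?Pb in Px).
by rewrite ltnS.
Qed.

(** * Stability after deletions *)

Section Instance.
Variables (pM pW : 'I_n -> seq 'I_n) (mu : {perm 'I_n}).
Hypothesis SM : SM_instance pM pW.

Lemma SM_mem i j : (j \in pM i) * (j \in pW i).
Proof. by have [p q] := SM i; rewrite (perm_mem p) (perm_mem q) !mem_enum. Qed.

Lemma SM_uniq i : uniq (pM i) * uniq (pW i).
Proof. by have [p q] := SM i; rewrite (perm_uniq p) (perm_uniq q) enum_uniq. Qed.

Definition blocking : {set 'I_n * 'I_n} :=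
  [set p | prefers (pM p.1) p.2 (mu p.1) && prefers (pW p.2) p.1 ((mu^-1)%g p.2)].

Lemma EUDA_iff ell : EUDA pM pW mu ell <-> exists D : {set 'I_n * 'I_n},
  [/\ #|D| <= ell, blocking \subset D, forall m, (m, mu m) \notin D,
      forall A, ~~ closed_set (fun w => [seq m <- cand pM pW mu w | (m, w) \notin D]) mu A &
      forall A, ~~ closed_set (fun m => [seq w <- cand pW pM mu^-1 m | (m, w) \notin D]) mu^-1 A].
Proof.
have sym D : symmetric_lists (delM pM D) (delW pW D).
  split=> [i|m w]; first by rewrite !filter_uniq ?SM_uniq.
  by rewrite !mem_filter !SM_mem.
have accE D m w : acceptable (delM pM D) (delW pW D) m w = ((m, w) \notin D).
  by rewrite /acceptable !mem_filter !SM_mem !andbT andbb.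
(* While the pairs of M* survive, every comparison with a partner is unaffected, so deletions merely
   filter the original lists of candidates. *)
have key (D : {set 'I_n * 'I_n}) : (forall m, (m, mu m) \notin D) ->
  [/\ cand (delM pM D) (delW pW D) mu =1 (fun w => [seq m <- cand pM pW mu w | (m, w) \notin D]),
   cand (delW pW D) (delM pM D) mu^-1 =1 (fun m => [seq w <- cand pW pM mu^-1 m | (m, w) \notin D]) &
   (forall m w, ~ blocks (delM pM D) (delW pW D) (matching_of_perm mu) m w) <-> blocking \subset D].
  move=> nD; have nD' w : ((mu^-1)%g w, w) \notin D by have := nD ((mu^-1)%g w); rewrite permKV.
  split=> [w|m|].
  - rewrite /cand -!filter_predI; apply: eq_filter => m /=.
    case: (boolP ((m, w) \in D)) => [_|i]; rewrite ?andbF //= andbT.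
    by rewrite !(prefers_filter (P := fun m => (m, w) \notin D)) // (prefers_filter (P := fun w => (m, w) \notin D)).
  - rewrite /cand -!filter_predI; apply: eq_filter => w /=.
    case: (boolP ((m, w) \in D)) => [_|i]; rewrite ?andbF //= andbT.
    rewrite invgK !(prefers_filter (P := fun w => (m, w) \notin D)) //.
    by rewrite (prefers_filter (P := fun m => (m, w) \notin D)).
  - split=> [nb|/subsetP sub m w /blocks_perm [a p q]].
      apply/subsetP => [[m w]]; rewrite inE /= => /andP [p q]; apply/negPn/negP => i.
      apply: (nb m w); apply/blocks_perm; split; first by rewrite accE.
        by rewrite (prefers_filter (P := fun w => (m, w) \notin D)).
      by rewrite (prefers_filter (P := fun m => (m, w) \notin D)).
    rewrite accE in a; case/negP: (a); apply: sub; rewrite inE /=.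
    rewrite (prefers_filter (P := fun w => (m, w) \notin D)) // in p.
    by rewrite (prefers_filter (P := fun m => (m, w) \notin D)) // in q; rewrite p.
have clE C C' nu A : C =1 C' -> closed_set C nu A = closed_set C' nu A.
  by move=> E; rewrite /closed_set; congr andb; apply: eq_forallb_in => w _; rewrite E.
split=> [[D [le us]]|[D [le bD nD clW clM]]]; exists D.
  have nD m : (m, mu m) \notin D.
    have [[[a _] _] _] := us; rewrite -accE; apply: (a (m, mu m)).
    by rewrite in_matching_of_perm.
  have [k1 k2 k3] := key D nD.
  have acc m : acceptable (delM pM D) (delW pW D) m (mu m) by rewrite accE.
  have [/k3 bD clW clM] := (unique_stable_iff (sym D) acc).1 us.
  by split=> // A; [rewrite -(clE _ _ _ _ k1)|rewrite -(clE _ _ _ _ k2)].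
have [k1 k2 k3] := key D nD.
have acc m : acceptable (delM pM D) (delW pW D) m (mu m) by rewrite accE.
split=> //; apply/(unique_stable_iff (sym D) acc); split; first exact/k3.
  by move=> A; rewrite (clE _ _ _ _ k1).
by move=> A; rewrite (clE _ _ _ _ k2).
Qed.

End Instance.
End Marriage.

(** * Deletions as choices in the preference graph *)

Lemma take_findN (T : eqType) (P : pred T) (s : seq T) x : x \in take (find P s) s -> ~~ P x.
Proof.
by elim: s => //= y s IH; case: ifP => //= Py; rewrite inE => /orP [/eqP -> | /IH]; rewrite ?Py.
Qed.

Lemma filter_find_drop (T : Type) (P : pred T) (s : seq T) :
  filter P s = if drop (find P s) s is x :: s' then x :: filter P s' else [::].
Proof. by elim: s => //= y s IH; case: ifP. Qed.

Lemma filter_notin_take (T : eqType) (s : seq T) k : uniq s ->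
  [seq x <- s | x \notin take k s] = drop k s.
Proof.
move=> us; rewrite -[in LHS](cat_take_drop k s) filter_cat.
have /= := us; rewrite -{1}(cat_take_drop k s) cat_uniq => /and3P [_ /hasPn nh _].
rewrite cat_take_drop (eq_in_filter (a2 := pred0)); last by move=> x /= ->.
rewrite filter_pred0 /= (eq_in_filter (a2 := predT)) ?filter_predT //.
Qed.

Lemma nth_map_drop (T : Type) (f : T -> nat) d k s x s' :
  drop k s = x :: s' -> nth d (map f s) k = f x.
Proof. by elim: s k => [|y s IH] [|k] //= => [[->]|/IH]. Qed.

Lemma drop_nil_size (T : Type) k (s : seq T) : drop k s = [::] -> size s <= k.
Proof. by move=> /(congr1 size) /=; rewrite size_drop; lia. Qed.

Section Targets.
Variables (n : nat) (pM pW : 'I_n -> seq 'I_n) (mu : {perm 'I_n}).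
Hypothesis SM : SM_instance pM pW.
Let CM := cand pW pM mu^-1.
Let CW := cand pM pW mu.

Definition man_targets m := [seq val ((mu^-1)%g w) | w <- CM m].
Definition woman_targets w := [seq n + val (mu m) | m <- CW w].

(* Vertex m < n is a man, vertex n + w is a woman, and n + n is the sink. *)
Definition targets (v : nat) : seq nat :=
  if insub v is Some m then man_targets m
  else if insub (v - n) is Some w then woman_targets w else [::].

Lemma targets_man (m : 'I_n) : targets m = man_targets m.
Proof. by rewrite /targets insubT //= => lt; rewrite (_ : Sub _ _ = m) //; apply: val_inj. Qed.

Lemma targets_woman (w : 'I_n) : targets (n + w) = woman_targets w.
Proof.
rewrite /targets insubF; last by rewrite ltnNge leq_addr.
rewrite addKn insubT //= => lt; rewrite (_ : Sub _ _ = w) //; exact: val_inj.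
Qed.

Lemma vertex_cases v : v < n + n -> (exists m : 'I_n, v = m) \/ (exists w : 'I_n, v = n + w).
Proof.
move=> lt; case: (ltnP v n) => h; first by left; exists (Ordinal h).
have h2 : v - n < n by lia.
by right; exists (Ordinal h2) => /=; lia.
Qed.

Section Side.
Variables (C : 'I_n -> seq 'I_n) (nu : {perm 'I_n}) (o : nat) (j : nat -> nat).
Hypothesis o_le : o <= n.
Hypothesis targetsE : forall i : 'I_n, targets (o + i) = [seq o + val (nu x) | x <- C i].

(** One statement serves both sides: offset 0 with [mu^-1] for the men, offset [n] with [mu] for the
    women. [P i] selects the surviving candidates, and [find] counts the deleted ones in front of
    the first survivor. *)
Lemma closed_pred_closed_set (P : 'I_n -> pred 'I_n) (A : pred nat) :
  (forall i : 'I_n, j (o + i) = find (P i) (C i)) ->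
  (forall v, A v -> v < n + n /\ A (tgt (n + n) targets v (j v))) ->
  (forall B, ~~ closed_set (fun i => filter (P i) (C i)) nu B) ->
  forall i : 'I_n, ~~ A (o + i).
Proof.
move=> jE HA ncl i; apply/negP => Ai.
case/negP: (ncl [set i : 'I_n | A (o + i)]); apply/andP; split.
  by apply/set0Pn; exists i; rewrite inE.
apply/forall_inP => {Ai} {}i; rewrite inE => Ai.
have [_ At] := HA _ Ai; rewrite filter_find_drop.
rewrite /tgt targetsE jE in At.
case E: (drop (find (P i) (C i)) (C i)) => [|x s].
    by move: At; rewrite nth_default ?size_map ?drop_nil_size // => /HA []; rewrite ltnn.
by move: At; rewrite (nth_map_drop _ _ E) inE.
Qed.

Lemma acyclic_closed_set (B : {set 'I_n}) : acyclic (n + n) targets j ->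
  ~~ closed_set (fun i => drop (j (o + i)) (C i)) nu B.
Proof.
move=> ac; apply/negP => /andP [/set0Pn [i0 i0B] /forall_inP cl].
pose A v := [exists i in B, v == o + i].
have : ~~ A (o + i0).
  apply: (ac A) => _ /exists_inP [i iB /eqP ->]; split; first by have := ltn_ord i; lia.
  have := cl i iB; case E: (drop _ _) => [//|x s] xB.
  by rewrite /tgt targetsE (nth_map_drop _ _ E); apply/exists_inP; exists (nu x).
by case/exists_inP; exists i0.
Qed.

End Side.

Lemma mem_CW m w : (m \in CW w) = prefers (pW w) ((mu^-1)%g w) m && prefers (pM m) w (mu m).
Proof. by rewrite mem_filter (SM_mem SM) andbT. Qed.

Lemma mem_CM m w : (w \in CM m) = prefers (pM m) (mu m) w && prefers (pW w) m ((mu^-1)%g w).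
Proof. by rewrite mem_filter (SM_mem SM) andbT invgK. Qed.

Lemma uniq_cand i : uniq (CM i) * uniq (CW i).
Proof. by rewrite !filter_uniq ?(SM_uniq SM). Qed.

Definition first_deletions (j : nat -> nat) : {set 'I_n * 'I_n} :=
  blocking pM pW mu :|: ([set p : 'I_n * 'I_n | p.2 \in take (j p.1) (CM p.1)]
    :|: [set p : 'I_n * 'I_n | p.1 \in take (j (n + p.2)) (CW p.2)]).

Lemma prefers_asym (l : seq 'I_n) a b : prefers l a b -> prefers l b a -> False.
Proof. by rewrite /prefers; lia. Qed.

Lemma card_take_pairs (C : 'I_n -> seq 'I_n) (k : 'I_n -> nat) :
  (forall i, uniq (C i)) -> (forall i, k i <= size (C i)) ->
  #|[set p : 'I_n * 'I_n | p.2 \in take (k p.1) (C p.1)]| = \sum_i k i.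
Proof.
move=> un le; rewrite -sum1_card big_mkcond /=.
under eq_bigr => p _ do rewrite inE.
rewrite -(pair_bigA _ (fun a b => if b \in take (k a) (C a) then 1 else 0)) /=.
apply: eq_bigr => i _; rewrite -big_mkcond sum1_card /=.
by rewrite (card_uniqP (take_uniq (k i) (un i))) size_takel.
Qed.

(** The three parts are disjoint because they require different preference patterns: both members,
    only the woman, or only the man would rather have the other than the M*-partner. *)
Lemma card_first_deletions j : bounded (n + n) targets j ->
  #|first_deletions j| = #|blocking pM pW mu| + \sum_(v < n + n) j v.
Proof.
move=> bd; rewrite big_split_ord /=.
have b1 (m : 'I_n) : j m <= size (CM m).
  have := bd m; rewrite targets_man size_map; apply; have := ltn_ord m; lia.
have b2 (w : 'I_n) : j (n + w) <= size (CW w).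
  have := bd (n + w); rewrite targets_woman size_map; apply; have := ltn_ord w; lia.
rewrite /first_deletions cardsU disjoint_setI0 ?cards0 ?subn0; last first.
  apply/pred0P => [[m w]] /=; rewrite !inE /=; apply/negbTE/negP => /andP [/andP [p q]].
  case/orP => /mem_take; rewrite ?mem_CM ?mem_CW => /andP [p' q'].
    exact: prefers_asym p p'.
  exact: prefers_asym q p'.
rewrite cardsU disjoint_setI0 ?cards0 ?subn0; last first.
  apply/pred0P => [[m w]] /=; rewrite !inE /=; apply/negbTE/negP => /andP [].
  move=> /mem_take; rewrite mem_CM => /andP [p q] /mem_take; rewrite mem_CW => /andP [p' q'].
  exact: prefers_asym p q'.
congr (_ + (_ + _)).
  by rewrite (card_take_pairs (k := fun i => j (val i))) // => i; rewrite uniq_cand.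
rewrite -(card_take_pairs (C := CW) (k := fun i => j (n + val i))) //; last by move=> i; rewrite uniq_cand.
rewrite -!sum1_card !(big_mkcond (fun i => i \in _)) /=.
rewrite (reindex (fun p : 'I_n * 'I_n => (p.2, p.1))) /=; last first.
  by apply: onW_bij; exists (fun p => (p.2, p.1)); case.
by apply: eq_bigr => p _; rewrite !inE.
Qed.

(** A deletion set can be thinned to [first_deletions j], with [j] counting the deleted candidates
    before the first survivor; no first survivor changes, so neither do the graphs. *)
Lemma EUDA_choice ell : EUDA pM pW mu ell <->
  exists j, [/\ acyclic (n + n) targets j, bounded (n + n) targets j &
    #|blocking pM pW mu| + \sum_(v < n + n) j v <= ell].
Proof.
have tM (m : 'I_n) : targets (0 + m) = [seq 0 + val ((mu^-1)%g w) | w <- CM m].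
  by rewrite targets_man.
have tW (w : 'I_n) : targets (n + w) = [seq n + val (mu m) | m <- CW w].
  by rewrite targets_woman.
split=> [/(EUDA_iff mu SM) [D [le bD nD clW clM]]|[j [ac bd le]]].
  pose j v := if insub v is Some m then find (fun w => (m, w) \notin D) (CM m)
    else if insub (v - n) is Some w then find (fun m => (m, w) \notin D) (CW w) else 0.
  have jM (m : 'I_n) : j m = find (fun w => (m, w) \notin D) (CM m).
    by rewrite /j insubT //= => lt; rewrite (_ : Sub _ _ = m) //; apply: val_inj.
  have jW (w : 'I_n) : j (n + w) = find (fun m => (m, w) \notin D) (CW w).
    rewrite /j insubF; last by rewrite ltnNge leq_addr.
    by rewrite addKn insubT //= => lt; rewrite (_ : Sub _ _ = w) //; apply: val_inj.
  have bd : bounded (n + n) targets j.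
    move=> v /vertex_cases [[m ->]|[w ->]].
      by rewrite jM targets_man size_map find_size.
    by rewrite jW targets_woman size_map find_size.
  exists j; split=> //.
    move=> A HA v; apply/negP => Av; have [/vertex_cases [[m Ev]|[w Ev]] _] := HA v Av; move: Av; rewrite Ev; apply/negP.
      exact: (closed_pred_closed_set tM (P := fun m w => (m, w) \notin D) jM HA clM m).
    exact: (closed_pred_closed_set tW (P := fun w m => (m, w) \notin D) jW HA clW w).
  (* Everything in [first_deletions j] was deleted already: blocking pairs by necessity, the
     prefixes by the choice of [j]. *)
  rewrite -card_first_deletions //; apply: leq_trans le; apply/subset_leq_card/subsetP => [[m w]].
  rewrite !inE /= => /orP [p|/orP []].
  - by apply: (subsetP bD); rewrite inE.
  - by rewrite jM => /take_findN; rewrite negbK.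
  - by rewrite jW => /take_findN; rewrite negbK.
apply/(EUDA_iff mu SM); exists (first_deletions j); split.
- by rewrite card_first_deletions.
- exact: subsetUl.
- move=> m; rewrite !inE /= !negb_or; apply/and3P; split.
  + by rewrite prefersxx.
  + by apply/negP => /mem_take; rewrite mem_CM prefersxx.
  + by apply/negP => /mem_take; rewrite mem_CW prefersxx andbF.
(* On the candidates of a woman the other two parts of [first_deletions j] are void, so filtering
   amounts to dropping the prefix. *)
- move=> A; have := acyclic_closed_set (leqnn n) tW A ac; rewrite /closed_set.
  congr (~~ (_ && _)); apply: eq_forallb_in => w _; rewrite -filter_notin_take ?uniq_cand //.
  rewrite (eq_in_filter (a2 := fun m => (m, w) \notin first_deletions j)) // => m; rewrite mem_CW => /andP [p q].
  rewrite !inE /= !negb_or.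
  have -> : prefers (pM m) w (mu m) && prefers (pW w) m ((mu^-1)%g w) = false.
    by apply/negbTE/negP => /andP [_]; apply: prefers_asym.
  case: (boolP (w \in _)) => // /mem_take; rewrite mem_CM => /andP [p' _].
  by case: (prefers_asym q p').
- move=> A; have := acyclic_closed_set (leq0n n) tM A ac; rewrite /closed_set.
  congr (~~ (_ && _)); apply: eq_forallb_in => m _; rewrite -filter_notin_take ?uniq_cand //.
  rewrite (eq_in_filter (a2 := fun w => (m, w) \notin first_deletions j)) // => w; rewrite mem_CM => /andP [p q].
  rewrite !inE /= !negb_or.
  have -> : prefers (pM m) w (mu m) && prefers (pW w) m ((mu^-1)%g w) = false.
    by apply/negbTE/negP => /andP [p' _]; apply: prefers_asym p p'.
  case: (boolP (m \in take (j (n + w)) _)) => [/mem_take|_]; last by rewrite andbT.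
  by rewrite mem_CW => /andP [_ q']; case: (prefers_asym p q').
Qed.

End Targets.

(** * The program *)

Declare Scope cmd_scope.
Delimit Scope cmd_scope with cmd.
Notation "$ x" := (EVar x) (at level 8, x at level 0, format "$ x") : cmd_scope.
Notation "# k" := (ECst k) (at level 8, k at level 0, format "# k") : cmd_scope.
Notation "e1 + e2" := (EAdd e1 e2) : cmd_scope.
Notation "e1 - e2" := (ESub e1 e2) : cmd_scope.
Notation "'MEM' [ e ]" := (EMem e) (at level 8, format "'MEM' [ e ]") : cmd_scope.
Notation "a .@ [ e ]" := (EArr a e) (at level 8, format "a .@ [ e ]") : cmd_scope.
Notation "x ::= e" := (CSet x e) (at level 60) : cmd_scope.
Notation "'ARR' a [ e1 ] ::= e2" := (CPut a e1 e2) (at level 60, a at level 0, e1 at level 69) : cmd_scope.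
Notation "c1 ;; c2" := (CSeq c1 c2) (at level 65, right associativity) : cmd_scope.
Notation "'IF' e1 '<' e2 'THEN' c1 'ELSE' c2 'END'" := (CIf e1 e2 c1 c2)
  (at level 8, e1 at level 69, e2 at level 69) : cmd_scope.
Notation "'WHILE' e1 '<' e2 'DO' c 'END'" := (CWhile e1 e2 c)
  (at level 8, e1 at level 69, e2 at level 69) : cmd_scope.
Bind Scope cmd_scope with expr cmd.

Module Var.
Notation n := 0 (only parsing).
Notation nn := 1 (only parsing).
Notation N := 2 (only parsing).
Notation a := 3 (only parsing).
Notation k := 4 (only parsing).
Notation acc := 5 (only parsing).
Notation y := 6 (only parsing).
Notation z := 7 (only parsing).
Notation cnt := 8 (only parsing).
Notation blk := 9 (only parsing).
Notation u := 10 (only parsing).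
Notation c := 11 (only parsing).
Notation f := 12 (only parsing).
Notation top := 13 (only parsing).
Notation b := 14 (only parsing).
Notation i := 15 (only parsing).
Notation v := 16 (only parsing).
Notation t := 17 (only parsing).
Notation q := 18 (only parsing).
Notation r := 19 (only parsing).
Notation la := 20 (only parsing).
Notation ans := 21 (only parsing).
Notation base := 22 (only parsing).
End Var.

Module Arr.
Notation off := 0 (only parsing).
Notation opp := 1 (only parsing).
Notation pl := 2 (only parsing).
Notation rk := 3 (only parsing).
Notation T := 4 (only parsing).
Notation st := 5 (only parsing).
Notation pos := 6 (only parsing).
Notation prev := 7 (only parsing).
Notation p := 8 (only parsing).
End Arr.

Open Scope cmd_scope.

Definition square_body : cmd := Var.nn ::= $Var.nn + $Var.n ;; Var.a ::= $Var.a + #1.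

Definition layout_cmd : cmd :=
  Var.n ::= MEM[#0] ;; Var.a ::= #0 ;; Var.nn ::= #0 ;;
  WHILE $Var.a < $Var.n DO square_body END ;;
  Var.base ::= $Var.nn + $Var.nn + $Var.n + #2.

(** [Arr.off] tabulates the row starts [a * n], which replaces multiplication; [Arr.opp] is the
    first number of the opposite side, so entry [y] in the list of [a] is agent [opp a + y]. *)
Definition offsets_body : cmd :=
  ARR Arr.off [$Var.a] ::= $Var.acc ;; Var.acc ::= $Var.acc + $Var.n ;;
  IF $Var.a < $Var.n THEN ARR Arr.opp [$Var.a] ::= $Var.n ELSE ARR Arr.opp [$Var.a] ::= #0 END ;;
  Var.a ::= $Var.a + #1.

Definition offsets_cmd : cmd :=
  Var.N ::= $Var.n + $Var.n ;; Var.a ::= #0 ;; Var.acc ::= #0 ;;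
  WHILE $Var.a < $Var.N DO offsets_body END.

Definition partners_body : cmd :=
  Var.y ::= MEM[$Var.nn + $Var.nn + #2 + $Var.a] ;;
  ARR Arr.pl [$Var.a] ::= $Var.y ;; ARR Arr.pl [$Var.n + $Var.y] ::= $Var.a ;;
  Var.a ::= $Var.a + #1.

Definition partners_cmd : cmd :=
  Var.a ::= #0 ;; WHILE $Var.a < $Var.n DO partners_body END.

(** Inverting the lists makes every comparison of two agents a constant-time operation. *)
Definition ranks_inner : cmd :=
  ARR Arr.rk [Arr.off.@[$Var.a] + MEM[Arr.off.@[$Var.a] + $Var.k + #2]] ::= $Var.k ;;
  Var.k ::= $Var.k + #1.

Definition ranks_body : cmd :=
  Var.k ::= #0 ;; WHILE $Var.k < $Var.n DO ranks_inner END ;; Var.a ::= $Var.a + #1.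

Definition ranks_cmd : cmd :=
  Var.a ::= #0 ;; WHILE $Var.a < $Var.N DO ranks_body END.

(** A blocking pair is met in the lists of both its members; it is counted only at the man. *)
Definition targets_inner : cmd :=
  Var.y ::= MEM[Arr.off.@[$Var.a] + $Var.k + #2] ;;
  Var.z ::= Arr.opp.@[$Var.a] + $Var.y ;;
  IF Arr.rk.@[Arr.off.@[$Var.z] + $Var.la] < Arr.rk.@[Arr.off.@[$Var.z] + Arr.pl.@[$Var.z]] THEN
    IF $Var.r < $Var.k THEN
      ARR Arr.T [Arr.off.@[$Var.a] + $Var.cnt] ::= Arr.opp.@[$Var.z] + Arr.pl.@[$Var.z] ;;
      Var.cnt ::= $Var.cnt + #1
    ELSE IF $Var.k < $Var.r THEN
      IF $Var.a < $Var.n THEN Var.blk ::= $Var.blk + #1 ELSE CSkip END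
    ELSE CSkip END END
  ELSE CSkip END ;;
  Var.k ::= $Var.k + #1.

Definition targets_body : cmd :=
  Var.k ::= #0 ;; Var.cnt ::= #0 ;;
  Var.r ::= Arr.rk.@[Arr.off.@[$Var.a] + Arr.pl.@[$Var.a]] ;;
  Var.la ::= $Var.a + Arr.opp.@[$Var.a] - $Var.n ;;
  WHILE $Var.k < $Var.n DO targets_inner END ;;
  ARR Arr.T [Arr.off.@[$Var.a] + $Var.cnt] ::= $Var.N ;;
  Var.a ::= $Var.a + #1.

Definition targets_cmd : cmd :=
  Var.a ::= #0 ;; Var.blk ::= #0 ;; WHILE $Var.a < $Var.N DO targets_body END.

Definition push_cmd : cmd :=
  ARR Arr.st [$Var.top] ::= $Var.t ;; ARR Arr.prev [$Var.top] ::= $Var.b ;;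
  Var.b ::= $Var.top ;; Var.i ::= $Var.top ;; Var.top ::= $Var.top + #1 ;;
  ARR Arr.pos [$Var.t] ::= $Var.top.

(** Positions in [Var.q] count from 1 and block starts in [Var.b] from 0, hence the test against
    [b + 1]: the loop runs until the block starting at [b] reaches down to the target. *)
Definition merge_loop : cmd :=
  WHILE $Var.q < $Var.b + #1 DO Var.b ::= Arr.prev.@[$Var.b] END.

Definition raise_body : cmd :=
  Var.v ::= Arr.st.@[$Var.i] ;; ARR Arr.p [$Var.v] ::= Arr.p.@[$Var.v] + #1 ;;
  Var.i ::= $Var.i + #1.

Definition raise_cmd : cmd :=
  Var.i ::= $Var.b ;; WHILE $Var.i < $Var.top DO raise_body END ;;
  Var.i ::= $Var.b ;; Var.c ::= $Var.c + #1.

(** The position of the target tells its status: 0 unvisited, up to [f] finished, up to [b] in an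
    earlier component of the path, above [b] in the current component. *)
Definition scan_cmd : cmd :=
  (Var.v ::= Arr.st.@[$Var.i] ;;
   Var.t ::= Arr.T.@[Arr.off.@[$Var.v] + Arr.p.@[$Var.v]] ;;
   Var.q ::= Arr.pos.@[$Var.t]) ;;
  IF #0 < $Var.q THEN
    IF $Var.f < $Var.q THEN
      IF $Var.b < $Var.q THEN Var.i ::= $Var.i + #1
      ELSE merge_loop ;; Var.i ::= $Var.b END
    ELSE Var.f ::= $Var.top END
  ELSE push_cmd END.

Definition start_cmd : cmd :=
  Var.t ::= $Var.u ;;
  IF #0 < Arr.pos.@[$Var.u] THEN Var.u ::= $Var.u + #1 ELSE push_cmd END.

Definition arborescence_body : cmd :=
  IF $Var.f < $Var.top THEN IF $Var.i < $Var.top THEN scan_cmd ELSE raise_cmd END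
  ELSE start_cmd END.

(** The sink starts as the only finished vertex, so reaching it and reaching the finished part are
    one test. *)
Definition arborescence_init : cmd :=
  Var.u ::= #0 ;; Var.c ::= #0 ;; ARR Arr.st [#0] ::= $Var.N ;; ARR Arr.pos [$Var.N] ::= #1 ;;
  Var.f ::= #1 ;; Var.top ::= #1 ;; Var.b ::= #1 ;; Var.i ::= #1.

Definition arborescence_cmd : cmd :=
  arborescence_init ;; WHILE $Var.u < $Var.N DO arborescence_body END.

Definition decide_cmd : cmd :=
  IF $Var.blk + $Var.c < MEM[#1] + #1 THEN Var.ans ::= #1 ELSE Var.ans ::= #0 END.

Definition main_cmd : cmd :=
  offsets_cmd ;; partners_cmd ;; ranks_cmd ;; targets_cmd ;; arborescence_cmd ;; decide_cmd.

Close Scope cmd_scope.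

(** * Correctness of the table-building phases *)

Arguments upd /.
Arguments setv /.
Arguments seta /.

Lemma mul_add_inj n a b x y : x < n -> y < n -> a * n + x = b * n + y -> a = b /\ x = y.
Proof.
move=> xn yn E.
have n0 : 0 < n by lia.
have H z w : w < n -> (z * n + w) %/ n = z by move=> wn; rewrite divnMDl // divn_small // addn0.
have ab : a = b by rewrite -(H a x) // E H.
by split=> //; move: E; rewrite ab; lia.
Qed.

Section Build.
Variables (n : nat) (L : nat -> seq nat) (P : nat -> nat) (inp : nat -> nat).
Let base := n * n + n * n + n + 2.
Local Notation tri := (tri inp base).

Hypothesis inpL : forall a k, a < n + n -> k < n -> inp (a * n + k + 2) = nth 0 (L a) k.
Hypothesis inpP : forall a, a < n -> inp (n * n + n * n + 2 + a) = P a.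
Hypothesis sizeL : forall a, a < n + n -> size (L a) = n.
Hypothesis uniqL : forall a, a < n + n -> uniq (L a).
Hypothesis memL : forall a y, a < n + n -> (y \in L a) = (y < n).

Definition opp (a : nat) : nat := if a < n then n else 0.
Definition loc (a : nat) : nat := a + opp a - n.

Hypothesis ltP : forall a, a < n + n -> P a < n.
Hypothesis PK : forall a, a < n + n -> P (opp a + P a) = loc a.

Lemma flat_inp s a : a < base -> flat inp base s a = inp a.
Proof. by rewrite /flat => ->. Qed.

Lemma offsets_cmd_ok s : vars s Var.n = n ->
  tri offsets_cmd s ((n + n) * 100 + 100) (fun s' => frame offsets_cmd s s' /\
    (vars s' Var.N = n + n /\
     forall a, a < n + n -> arrs s' Arr.off a = a * n /\ arrs s' Arr.opp a = opp a)).
Proof.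
move=> sn; apply: tri_framed.
do 3 (apply: tri_step; [by []|by rewrite /=; lia|]).
set s0 := run _ _ _ _.
have [e1 e2 e3 e4] : [/\ vars s0 Var.n = n, vars s0 Var.N = n + n, vars s0 Var.a = 0 & vars s0 Var.acc = 0].
  by rewrite /s0 /= sn.
pose I k (s1 : env) := vars s1 Var.acc = k * n /\
  forall a, a < k -> arrs s1 Arr.off a = a * n /\ arrs s1 Arr.opp a = opp a.
apply: tri_weaken (tri_for (P := I) (tb := 80) (m := n + n) (k0 := 0) _ _ _ _ _ _) _ _ => //.
- move=> k s1 lk [acc tab] fr sa; apply: tri_run => //=.
  have sn1 : vars s1 Var.n = n by rewrite (proj1 fr).
  rewrite sa sn1 /I; case: (ltnP k n) => lkn /=; split; try lia; split; try lia;
  move=> a; rewrite ltnS leq_eqVlt => /orP [/eqP ->|la];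
  rewrite ?eqxx ?acc ?(ltn_eqF la) ?[opp k]/opp ?lkn //; try exact: tab.
  by rewrite ltnNge lkn.
- by rewrite /=; lia.
- by move=> s' [[_ tab] [fr _] _]; split=> //; rewrite fr.
Qed.

Lemma partners_cmd_ok s : vars s Var.n = n -> vars s Var.nn = n * n ->
  tri partners_cmd s (n * 100 + 100) (fun s' => frame partners_cmd s s' /\
    (forall a, a < n + n -> arrs s' Arr.pl a = P a)).
Proof.
move=> sn snn; apply: tri_framed.
apply: tri_step; [by []|by rewrite /=; lia|].
set s0 := run _ _ _ _.
have [e1 e2 e3] : [/\ vars s0 Var.n = n, vars s0 Var.nn = n * n & vars s0 Var.a = 0].
  by rewrite /s0 /= sn.
pose I k (s1 : env) := (forall a, a < k -> arrs s1 Arr.pl a = P a) /\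
  (forall a, a < k -> arrs s1 Arr.pl (n + P a) = a).
have PK' a : a < n -> P (n + P a) = a.
  by move=> la; have := PK (_ : a < n + n); rewrite /loc /opp la addnK; apply; lia.
apply: tri_weaken (tri_for (P := I) (tb := 80) (m := n) (k0 := 0) _ _ _ _ _ _) _ _ => //.
- move=> k s1 lk [tab1 tab2] fr sa; apply: tri_run => //=.
  have sn1 : vars s1 Var.n = n by rewrite (proj1 fr).
  have snn1 : vars s1 Var.nn = n * n by rewrite (proj1 fr).
  rewrite sa sn1 snn1 /I flat_inp /base; last lia.
  rewrite inpP //; split; last lia.
  split=> a; rewrite ltnS leq_eqVlt => /orP [/eqP ->|la]; rewrite ?eqxx /=.
  + by rewrite (_ : (k == n + P k) = false) ?eqxx //; lia.
  + rewrite (_ : (a == n + P k) = false); last lia.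
    by rewrite (ltn_eqF la); apply: tab1.
  + by rewrite eqxx.
  + have ne : (P a == P k) = false.
      by apply/eqP => E; have := PK' a; rewrite E PK' //; lia.
    rewrite eqn_add2l ne (_ : (n + P a == k) = false); last lia.
    exact: tab2.
- by rewrite /=; lia.
- move=> s' [[tab1 tab2] _ _] a la; case: (ltnP a n) => lan; first exact: tab1.
  have E := PK la; rewrite /loc /opp ltnNge lan /= add0n in E.
  have := ltP la => lP; have := tab2 (P a) lP; rewrite E.
  by rewrite (_ : n + (a + 0 - n) = a) //; lia.
Qed.

Lemma L_lt a k : a < n + n -> k < n -> nth 0 (L a) k < n.
Proof. by move=> la lk; rewrite -(memL _ la) mem_nth // sizeL. Qed.

Lemma index_nth a k : a < n + n -> k < n -> index (nth 0 (L a) k) (L a) = k.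
Proof. by move=> la lk; rewrite index_uniq ?sizeL ?uniqL. Qed.

Lemma row_lt a y : a < n + n -> y < n -> a * n + y < n * n + n * n.
Proof.
move=> la ly; have : (a.+1) * n <= (n + n) * n by rewrite leq_mul2r la orbT.
by rewrite mulSn mulnDl; lia.
Qed.

Lemma MEM_list s a k : a < n + n -> k < n -> flat inp base s (a * n + k + 2) = nth 0 (L a) k.
Proof. by move=> la lk; rewrite flat_inp ?inpL // /base; have := row_lt la lk; lia. Qed.

Definition ranks_upto (k : nat) (s : env) : Prop :=
  forall a y, a < k -> y < n -> arrs s Arr.rk (a * n + y) = index y (L a).

Definition offsets_spec (s : env) : Prop :=
  forall a, a < n + n -> arrs s Arr.off a = a * n.

Lemma ranks_cmd_ok s : vars s Var.n = n -> vars s Var.N = n + n -> offsets_spec s ->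
  tri ranks_cmd s ((n + n) * (n * 100 + 100) + 100) (fun s' => frame ranks_cmd s s' /\
    ranks_upto (n + n) s').
Proof.
move=> sn sN soff; apply: tri_framed.
apply: tri_step; [by []|by rewrite /=; lia|].
set s0 := run _ _ _ _.
have [e1 e2 e3 e4] : [/\ vars s0 Var.n = n, vars s0 Var.N = n + n, vars s0 Var.a = 0 & offsets_spec s0].
  by rewrite /s0 /= sn.
apply: tri_weaken (tri_for (P := ranks_upto) (tb := n * 100 + 50) (m := n + n) (k0 := 0) _ _ _ _ _ _) _ _ => //.
- move=> a s1 la tab fr sa.
  have sn1 : vars s1 Var.n = n by rewrite (proj1 fr).
  have soff1 : offsets_spec s1 by move=> x lx; rewrite (proj2 fr) // e4.
  apply: tri_step; [by []|by rewrite /=; lia|].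
  set s2 := run _ _ _ _.
  pose I k (s' : env) := ranks_upto a s' /\
    forall y, y < n -> index y (L a) < k -> arrs s' Arr.rk (a * n + y) = index y (L a).
  apply: (tri_seq (t1 := n * 90 + 10) (t2 := 20)); last by rewrite /=; lia.
  apply: tri_weaken (tri_for (P := I) (tb := 80) (m := n) (k0 := 0) _ _ _ _ _ _) _ _ => //.
  + move=> k s3 lk [tab1 tab2] fr3 sk; apply: tri_run => //=.
    have sa3 : vars s3 Var.a = a by rewrite (proj1 fr3).
    have soff3 : offsets_spec s3 by move=> x lx; rewrite (proj2 fr3) // soff1.
    rewrite sa3 soff3 // sk MEM_list //.
    split; last lia.
    split=> [a' y la' ly|y ly]; rewrite /=; case: eqP => [E|ne].
    * by have [] := mul_add_inj ly (L_lt la lk) E; lia.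
    * exact: tab1.
    * have [_ ->] := mul_add_inj ly (L_lt la lk) E; by rewrite index_nth.
    * rewrite ltnS leq_eqVlt => /orP [/eqP E|]; last exact: tab2.
      by case: ne; rewrite -E nth_index // memL.
  + by rewrite subn0; lia.
  + move=> s' [[tab1 tab2] fr' _]; apply: tri_run => //=.
    rewrite (proj1 fr') //= sa; split; last lia.
    move=> a' y; rewrite /= ltnS leq_eqVlt => /orP [/eqP ->|la'] ly; last exact: tab1.
    by apply: tab2 => //; rewrite -(sizeL la) index_mem memL.
- by rewrite /=; lia.
- by move=> s' [].
Qed.

(** * Candidates and blocking pairs on the encoded lists *)

Definition beats (a y : nat) : bool :=
  let z := opp a + y in index (loc a) (L z) < index (P z) (L z).

Definition is_target (a y : nat) : bool :=
  (index (P a) (L a) < index y (L a)) && beats a y.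

Definition is_blocking (a y : nat) : bool :=
  (index y (L a) < index (P a) (L a)) && beats a y.

Definition target_of (a y : nat) : nat := let z := opp a + y in opp z + P z.

Definition target_list (a : nat) : seq nat := [seq target_of a y | y <- L a & is_target a y].

Definition blocking_count : nat := \sum_(a < n) count (is_blocking a) (L a).

(** The partner occurs in the list but is never a candidate; this leaves a cell of the row for the
    terminating sink. *)
Lemma size_target_list a : a < n + n -> size (target_list a) < n.
Proof.
move=> la; rewrite size_map size_filter -(sizeL la) ltn_neqAle count_size andbT -all_count.
apply/negP => /allP/(_ (P a)); rewrite memL // => /(_ (ltP la)).
by rewrite /is_target ltnn.
Qed.

(** The range of [j] includes the terminating cell, where the default [n + n] of [nth] is the
    sink. *)
Definition targets_upto (k : nat) (s : env) : Prop :=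
  forall a j, a < k -> j <= size (target_list a) ->
    arrs s Arr.T (a * n + j) = nth (n + n) (target_list a) j.

Lemma targets_cmd_ok s : vars s Var.n = n -> vars s Var.N = n + n -> offsets_spec s ->
  (forall a, a < n + n -> arrs s Arr.opp a = opp a) ->
  (forall a, a < n + n -> arrs s Arr.pl a = P a) -> ranks_upto (n + n) s ->
  tri targets_cmd s ((n + n) * (n * 300 + 300) + 100) (fun s' => frame targets_cmd s s' /\
    (targets_upto (n + n) s' /\ vars s' Var.blk = blocking_count)).
Proof.
move=> sn sN soff sopp spl srk; apply: tri_framed.
do 2 (apply: tri_step; [by []|by rewrite /=; lia|]).
set s0 := run _ _ _ _.
have [e1 e2 e3 e4] : [/\ vars s0 Var.n = n, vars s0 Var.N = n + n, vars s0 Var.a = 0 & vars s0 Var.blk = 0].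
  by rewrite /s0 /= sn.
have arrs0 j : arrs s0 j = arrs s j by [].
pose B k := \sum_(a < k | a < n) count (is_blocking a) (L a).
pose I k (s1 : env) := targets_upto k s1 /\ vars s1 Var.blk = B k.
have tabs s1 : frame targets_body s0 s1 -> [/\ offsets_spec s1,
    (forall a, a < n + n -> arrs s1 Arr.opp a = opp a),
    (forall a, a < n + n -> arrs s1 Arr.pl a = P a) & ranks_upto (n + n) s1].
  move=> [_ fr]; split=> [a|a|a|a y]; rewrite fr //; [exact: soff|exact: sopp|exact: spl|exact: srk].
apply: tri_weaken (tri_for (P := I) (tb := n * 300 + 200) (m := n + n) (k0 := 0) _ _ _ _ _ _) _ _ => //.
- move=> a s1 la [tab sblk] fr sa.
  have sn1 : vars s1 Var.n = n by rewrite (proj1 fr).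
  have sN1 : vars s1 Var.N = n + n by rewrite (proj1 fr).
  have [soff1 sopp1 spl1 srk1] := tabs s1 fr.
  have lPa := ltP la.
  have lloc : loc a < n by rewrite /loc /opp; case: ifP; lia.
  do 4 (apply: tri_step; [by []|by rewrite /=; lia|]).
  set s2 := run _ _ _ _.
  have [f1 f2 f3 f4] : [/\ vars s2 Var.cnt = 0, vars s2 Var.k = 0,
      vars s2 Var.r = index (P a) (L a) & vars s2 Var.la = loc a].
    by rewrite /s2 /= sa soff1 // spl1 // sopp1 // srk1 // sn1.
  have [f5 f6 f7 f8] : [/\ vars s2 Var.n = n, vars s2 Var.N = n + n, vars s2 Var.a = a &
      vars s2 Var.blk = B a] by rewrite /s2 /= sa sN1 sn1.
  have arrs2 j : arrs s2 j = arrs s1 j by [].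
  clearbody s2.
  pose J k (s' : env) := [/\ targets_upto a s',
    vars s' Var.cnt = size (filter (is_target a) (take k (L a))),
    forall j, j < vars s' Var.cnt -> arrs s' Arr.T (a * n + j) =
      nth (n + n) (map (target_of a) (filter (is_target a) (take k (L a)))) j &
    vars s' Var.blk = B a + (if a < n then count (is_blocking a) (take k (L a)) else 0)].
  have J0 : J 0 s2.
    split; rewrite ?take0 ?f1 //=; last by rewrite f8 if_same addn0.
    by move=> a' j; rewrite arrs2; apply: tab.
  apply: (tri_seq (t1 := n * 260 + 20) (t2 := 80)); last by rewrite /=; lia.
  apply: tri_weaken (tri_for (P := J) (tb := 250) (m := n) (k0 := 0) _ _ _ _ _ _) _ _ => //.
  + move=> k s3 lk [tab1 scnt tabk sblk3] fr3 sk; apply: tri_run => //.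
    have sa3 : vars s3 Var.a = a by rewrite (proj1 fr3).
    have sn3 : vars s3 Var.n = n by rewrite (proj1 fr3).
    have sr3 : vars s3 Var.r = index (P a) (L a) by rewrite (proj1 fr3).
    have sla3 : vars s3 Var.la = loc a by rewrite (proj1 fr3).
    have arrs3 j : j != Arr.T -> arrs s3 j = arrs s1 j.
      by move=> nj; rewrite (proj2 fr3) ?arrs2 // inE.
    set y := nth 0 (L a) k.
    have ly : y < n by apply: L_lt.
    have iy : index y (L a) = k by apply: index_nth.
    set z := opp a + y.
    have lz : z < n + n by rewrite /z /opp; case: ifP; lia.
    have lcnt : size (filter (is_target a) (take k (L a))) < n.
      apply: leq_ltn_trans (size_target_list la); rewrite size_map !size_filter.
      by rewrite -{2}(cat_take_drop k (L a)) count_cat leq_addr.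
    have tk : take k.+1 (L a) = rcons (take k (L a)) y by rewrite (take_nth 0) // sizeL.
    have crc p : count p (rcons (take k (L a)) y) = count p (take k (L a)) + p y.
      by rewrite -cats1 count_cat /= addn0.
    have tks : forall a' j, a' < a -> j <= size (target_list a') ->
        a' * n + j == a * n + size (filter (is_target a) (take k (L a))) = false.
      move=> a' j la' lj; apply/eqP => /mul_add_inj [||]; rewrite ?scnt //; try lia.
      by apply: leq_ltn_trans lj _; apply: size_target_list; lia.
    rewrite /= sa3 (arrs3 0) // (arrs3 1) // (arrs3 2) // (arrs3 3) // (soff1 a) // sk MEM_list // -/y (sopp1 a) // -/z (soff1 z) // (spl1 z) //.
    rewrite sla3 (srk1 z (loc a)) // (srk1 z (P z)) ?ltP // sr3 sn3 (sopp1 z) //.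
    rewrite -[_ < index (P z) (L z)]/(beats a y) /J tk filter_rcons crc.
    rewrite /is_target /is_blocking iy -/(is_target a).
    case: (beats a y) => /=; last first.
      by rewrite !andbF /= !addn0; split; [split|lia].
    rewrite !andbT; case: ltngtP => cmp /=.
    * rewrite !addn0 sk; split; last lia.
      split; rewrite ?size_rcons ?scnt ?addn1 //=.
      + by move=> a' j la' lj; rewrite /= tks //; apply: tab1.
      move=> j.
      rewrite map_rcons nth_rcons size_map ltnS eqn_add2l leq_eqVlt => /orP [/eqP ->|lj].
        by rewrite eqxx ltnn.
      by rewrite lj (ltn_eqF lj); apply: tabk; rewrite scnt.
    * by case: ifP => lan /=; rewrite sk; (split; last by lia); split=> //; rewrite /= sblk3 lan ?addn0 // -addnA.
    * by rewrite !addn0 sk; split; [split|lia].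
  + by rewrite subn0; lia.
  + move=> s' [[tab1 scnt tabk sblk'] fr' _]; apply: tri_run => //=.
    have soff' : offsets_spec s' by move=> x lx; rewrite (proj2 fr') // arrs2 soff1.
    have Ea : vars s' Var.a = a by rewrite (proj1 fr').
    have EN : vars s' Var.N = n + n by rewrite (proj1 fr').
    have tkn : take n (L a) = L a by rewrite -(sizeL la) take_size.
    rewrite Ea soff' // EN; split; last lia.
    rewrite tkn in scnt tabk sblk'.
    have cntE : vars s' Var.cnt = size (target_list a) by rewrite size_map.
    split; last first.
      rewrite /= sblk' /B [in RHS]big_mkcond big_ord_recr /= -big_mkcond.
      by case: ifP.
    move=> a' j; rewrite /= ltnS leq_eqVlt => /orP [/eqP ->|la'] lj.
      rewrite eqn_add2l; case: (eqVneq j (vars s' Var.cnt)) => [->|ne].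
        by rewrite nth_default // cntE.
      by rewrite tabk //; move: lj ne; rewrite cntE; lia.
    case: eqP => [|_]; last exact: tab1.
    move=> /mul_add_inj [||]; rewrite ?cntE ?size_target_list //; try lia.
    by apply: leq_ltn_trans lj _; apply: size_target_list; lia.
- by split=> //; rewrite e4 /B big_ord0.
- by rewrite /=; lia.
- move=> s' [[tab sb] _ _]; split=> //; rewrite sb /B /blocking_count big_split_ord /=.
  rewrite [X in _ + X]big_pred0 ?addn0; last by move=> i; rewrite ltnNge leq_addr.
  by apply: eq_bigl => i; rewrite ltn_ord.
Qed.

End Build.

(** * Correctness of the arborescence phase *)

Lemma sum_mem N (s : seq nat) : uniq s -> all (gtn N) s -> \sum_(v < N) (val v \in s) = size s.
Proof.
move=> us /allP lt; rewrite -(big_mkord xpredT (fun v => nat_of_bool (v \in s))).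
have -> : \sum_(0 <= v < N) nat_of_bool (v \in s) = count (mem s) (index_iota 0 N).
  by rewrite -sum1_count [RHS]big_mkcond /=; apply: eq_bigr => i _; case: (i \in s).
rewrite -size_filter; apply: perm_size; apply: uniq_perm => // [|v].
  by rewrite filter_uniq ?iota_uniq.
rewrite mem_filter mem_index_iota /=; apply: andb_idr => vs; exact: lt vs.
Qed.

(* [prev b] is the stack position of the first vertex of the component below the one that
   starts at position b. *)
Fixpoint chain (prev : nat -> nat) (top : nat) (cs : seq (seq nat * nat)) (b : nat) : Prop :=
  if cs is x :: cs' then b + size x.1 = top /\ chain prev b cs' (prev b) else True.

Lemma chain_ext prev prev' top cs b : (forall x, x \in cs -> x.1 != [::]) ->
  (forall x, x < top -> prev x = prev' x) -> chain prev top cs b -> chain prev' top cs b.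
Proof.
elim: cs top b => //= x cs IH top b ne E [Et H]; split=> //.
have lb : b < top.
  by have := ne x (mem_head _ _); rewrite -Et; case: (x.1) => //= *; lia.
rewrite -(E b lb).
apply: (IH _ _ _ _ H) => [y yin|y ly]; first by apply: ne; rewrite inE yin orbT.
by apply: E; lia.
Qed.

Section Loop.
Variables (n : nat) (T : nat -> seq nat) (inp : nat -> nat) (base : nat).
Let N := n + n.
Local Notation tri := (tri inp base).
Local Notation run := (run inp base).
Local Notation tgtN := (tgt N T).
Hypothesis sizeT : forall v, v < N -> size (T v) < n.
Hypothesis T_lt : forall v x, v < N -> x \in T v -> x < N.

Definition static (s : env) : Prop :=
  [/\ vars s Var.N = N, (forall v, v < N -> arrs s Arr.off v = v * n) &
      forall v j, v < N -> j <= size (T v) -> arrs s Arr.T (v * n + j) = tgtN v j].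

(* The stack from its top down; the sink is at the bottom.  Array pos holds positions counted
   from 1, with 0 for an unvisited vertex; a vertex is finished iff its position is at most f. *)
Definition stack (F : seq nat) (cs : seq (seq nat * nat)) : seq nat := verts cs ++ F ++ [:: N].

(** Blocks are scanned upwards from [b], while [stack] lists them downwards from the top; hence the
    vertices already scanned form a suffix of [x.1]. *)
Record rel (F : seq nat) cs (p : nat -> nat) (s : env) : Prop := Rel {
  rel_f : vars s Var.f = (size F).+1;
  rel_top : vars s Var.top = size (stack F cs);
  rel_st : forall x, x < size (stack F cs) ->
    arrs s Arr.st x = nth 0 (stack F cs) (size (stack F cs) - x.+1);
  rel_pos : forall v, v <= N -> arrs s Arr.pos v = size (stack F cs) - index v (stack F cs);
  rel_p : forall v, v < N -> arrs s Arr.p v = p v;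
  rel_chain : chain (arrs s Arr.prev) (size (stack F cs)) cs (vars s Var.b);
  rel_scan : if cs is x :: _ then
      [/\ vars s Var.b <= vars s Var.i, vars s Var.i <= vars s Var.top &
       forall v, v \in drop (vars s Var.top - vars s Var.i) x.1 -> tgtN v (p v) \in x.1]
    else True }.

Lemma tgt_le v j : v < N -> tgtN v j <= N.
Proof.
move=> vN; case: (ltnP j (size (T v))) => h; last by rewrite /tgt nth_default.
by apply/ltnW/(T_lt vN)/mem_nth.
Qed.

Lemma push_ok F cs p s : rel F cs p s -> (forall x, x \in cs -> x.1 != [::]) ->
  vars s Var.t \notin stack F cs ->
  rel F (([:: vars s Var.t], 0) :: cs) p (run push_cmd s).
Proof.
set t := vars s Var.t => R ne nt; case: R => Rf Rt Rst Rpos Rp Rc Rs.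
have E : stack F (([:: t], 0) :: cs) = t :: stack F cs by [].
have Ew : size (t :: stack F cs) = (size (stack F cs)).+1 by [].
split; rewrite ?E ?Ew //.
- by rewrite /= Rt addn1.
- move=> x lx; rewrite /= Rt; case: eqP => [->|/eqP ne']; first by rewrite subSS subnn.
  have lx' : x < size (stack F cs) by rewrite ltn_neqAle ne' -ltnS.
  by rewrite Rst // subSS -(subSS x) subSn.
- move=> v lv; rewrite /= -/t eq_sym; case: (eqVneq t v) => [Ev|ne']; first by rewrite Rt addn1.
  by rewrite Rpos // subSS.
- rewrite /= Rt; split; first by rewrite addn1.
  rewrite eqxx; apply: chain_ext Rc => // x lx.
  by rewrite (ltn_eqF lx).
- by rewrite /= Rt addn1 subSnn; split.
Qed.

Lemma chain_last prev top x cs b : chain prev top (x :: cs) b -> b = top - size x.1 /\ size x.1 <= top.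
Proof. by move=> [<- _]; rewrite addnK leq_addl. Qed.

Lemma size_stack F cs : size (stack F cs) = size (verts cs) + (size F).+1.
Proof. by rewrite /stack !size_cat addn1. Qed.

Lemma nth_stack_top x F cs j : j < size x.1 ->
  nth 0 (stack F (x :: cs)) j = nth 0 x.1 j.
Proof. by move=> lj; rewrite /stack /verts /= -!catA nth_cat lj. Qed.

(** [y] is arbitrary because the dual totals of components exist only in the proof, not in
    memory. *)
Lemma raise_ok F x y cs p s : rel F (x :: cs) p s -> uniq x.1 -> all (gtn N) x.1 ->
  tri raise_cmd s (size x.1 * 100 + 100) (fun s' => frame raise_cmd s s' /\
    [/\ rel F ((x.1, y) :: cs) (fun v => p v + (v \in x.1)) s',
        vars s' Var.i = vars s' Var.b & vars s' Var.c = (vars s Var.c).+1]).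
Proof.
case: x => xs xy R; case: R => Rf Rt Rst Rpos Rp Rc Rs ux /allP ltx; apply: tri_framed.
have [Eb lx] := chain_last Rc.
set W := stack F _ in Rt Rst Rpos Rc Eb lx.
have EW : stack F ((xs, y) :: cs) = W by [].
apply: tri_step; [by []|by rewrite /=; lia|]; set s0 := run _ _.
pose I k (s1 : env) := vars s Var.b <= k /\
  forall v, v < N -> arrs s1 Arr.p v = p v + (v \in drop (size W - k) xs).
rewrite /= in lx.
apply: (tri_seq (t1 := size xs * 90 + 10) (t2 := 50)); last by rewrite /=; lia.
apply: tri_weaken (tri_for (P := I) (tb := 60) (m := size W) (k0 := vars s Var.b) _ _ _ _ _ _) _ _ => //.
- move=> k s1 lk [lbk tab] fr si; apply: tri_run => //=.
  have st1 : arrs s1 Arr.st k = nth 0 W (size W - k.+1) by rewrite (proj2 fr) // Rst.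
  have lj : size W - k.+1 < size xs by rewrite /= in Eb; lia.
  have lw : nth 0 xs (size W - k.+1) < N by apply: ltx; apply: mem_nth.
  rewrite si st1 (nth_stack_top F (x := (xs, xy)) cs lj) /=; split; last lia.
  split; first lia.
  move=> v lv; have -> : size W - k.+1 = (size W - k).-1 by lia.
  have Ek : size W - k = (size W - k.+1).+1 by lia.
  have -> : (size W - k).-1 = size W - k.+1 by lia.
  rewrite (drop_nth 0 lj) -Ek inE /=.
  case: eqP => [->|_]; last by rewrite tab.
  rewrite tab // -addnA; congr addn.
  have : uniq (drop (size W - k.+1) xs) by apply: drop_uniq.
  by rewrite (drop_nth 0 lj) -Ek /= => /andP [/negbTE -> _].
- by rewrite Eb leq_subr.
- split=> // v lv; rewrite Eb /= drop_oversize ?addn0 ?in_nil; last lia.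
  exact: Rp.
- by rewrite Eb /=; lia.
- move=> s' [[_ tab] fr si]; apply: tri_run => //=.
  have [fv fa] := fr.
  split; [|by []|by rewrite fv //= addn1].
  split; rewrite ?EW /= ?fv //.
  + by move=> x lx'; rewrite fa // Rst.
  + by move=> v lv; rewrite fa // Rpos.
  + by move=> v lv; rewrite tab // subnn drop0.
  + by rewrite fa //; case: Rc.
  + rewrite -[vars s0 _]/(vars s Var.b) -[vars s0 Var.top]/(vars s Var.top) Rt Eb leq_subr.
    by split=> // v; rewrite drop_oversize //=; lia.
Qed.

(** This turns membership in the top components into a comparison of positions, which is all that
    the program can test. *)
Lemma mem_stack_prefix F seg rest t :
  (index t (stack F (seg ++ rest)) < size (verts seg)) = (t \in verts seg).
Proof.
rewrite /stack verts_cat -!catA index_cat -index_mem; case: ifP => // h.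
by rewrite ltnNge leq_addr.
Qed.

Lemma merge_loop_ok F x cs p s t : rel F (x :: cs) p s ->
  vars s Var.q = size (stack F (x :: cs)) - index t (stack F (x :: cs)) ->
  t \in verts (x :: cs) -> t \notin x.1 ->
  tri merge_loop s (size cs * 100 + 100) (fun s' => frame merge_loop s s' /\
    exists seg rest, [/\ cs = seg ++ rest, t \in (last x seg).1, 0 < size seg &
      chain (arrs s Arr.prev) (size (stack F (x :: cs))) ((verts (x :: seg), path_cost (x :: seg)) :: rest)
        (vars s' Var.b)]).
Proof.
move=> R Eq tin tx; case: R => Rf Rt Rst Rpos Rp Rc Rs; apply: tri_framed.
set W := stack F _ in Eq Rt Rst Rpos Rc *.
(* Either the block swallowed last contains [t], or [t] lies in none of the swallowed blocks. At the
   exit this pins [t] to the last component of [seg]. *)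
pose I phi (s1 : env) := exists seg rest, [/\ cs = seg ++ rest,
  (t \in (last x seg).1) || (t \notin verts (x :: seg)),
  vars s1 Var.b + size (verts (x :: seg)) = size W,
  chain (arrs s Arr.prev) (vars s1 Var.b) rest (arrs s Arr.prev (vars s1 Var.b)) &
  phi = size rest * 100].
have qE seg rest b : cs = seg ++ rest -> b + size (verts (x :: seg)) = size W ->
    (b < vars s Var.q) = (t \in verts (x :: seg)).
  move=> Ecs Eb; rewrite -(mem_stack_prefix F (x :: seg) rest) /= -Ecs -/W Eq.
  have : index t W < size W by rewrite index_mem mem_cat tin.
  by lia.
have I0 : I (size cs * 100) s.
  exists [::], cs; split=> //; case: Rc => [Eb H] //.
    by rewrite /verts /= cats0 tx orbT.
  by rewrite /verts /= cats0.
apply: tri_weaken (tri_while (Inv := I) _ I0) _ _ => //; last first.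
- move=> s' [[phi [seg [rest [Ecs tor Eb ch _]]]] fr g]; exists seg, rest.
  have qs : vars s' Var.q = vars s Var.q by rewrite (proj1 fr).
  have tv : t \in verts (x :: seg).
    by rewrite -(qE seg rest _ Ecs Eb) -qs; move: g; rewrite /= addn1.
  have tl : t \in (last x seg).1 by move: tor; rewrite tv orbF.
  split=> //; first by rewrite lt0n size_eq0; apply: contraNneq tx => Es; rewrite Es in tl.
- by rewrite /=; lia.
move=> phi s1 [seg [rest [Ecs tor Eb ch ->]]] fr /= g.
have qs : vars s1 Var.q = vars s Var.q by rewrite (proj1 fr).
have tnv : t \notin verts (x :: seg).
  by rewrite -(qE seg rest _ Ecs Eb) -qs -leqNgt; move: g; rewrite addn1.
case: rest Ecs ch => [|y rest] Ecs ch; first by rewrite cats0 in Ecs; rewrite -Ecs tin in tnv.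
exists 20; apply: tri_run => //=; exists (size rest * 100); last by lia.
have ps : arrs s1 Arr.prev = arrs s Arr.prev by rewrite (proj2 fr).
exists (rcons seg y), rest; rewrite cat_rcons; case: ch => Ey ch; split=> //=.
- rewrite last_rcons -[x :: rcons seg y]/(rcons (x :: seg) y) -cats1 verts_cat mem_cat negb_or tnv /=.
  by rewrite /verts /= cats0 orbN.
- rewrite ps -[x :: rcons seg y]/(rcons (x :: seg) y) -cats1 verts_cat size_cat.
  have -> : size (verts [:: y]) = size y.1 by rewrite /verts /= cats0.
  by rewrite -Eb -[in RHS]Ey; lia.
- by rewrite ps.
Qed.

(** * Amortised analysis of the main loop *)

Lemma inv_sizes F cs p c : arb_inv N T F cs p c ->
  [/\ size F + size (verts cs) <= N, size cs <= size (verts cs) &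
   forall v, v \in F ++ verts cs -> v < N].
Proof.
move=> I; have lt v : v \in F ++ verts cs -> v < N.
  rewrite mem_cat => /orP [vF|/flattenP [C /mapP [x xin ->] vx]].
    exact: (allP (inv_lt I)).
  by have [_ _ /allP H _ _] := inv_comp I xin; apply: H.
split=> //.
  rewrite -size_cat -(size_iota 0 N); apply: uniq_leq_size; first exact: inv_uniq I.
  by move=> v /lt; rewrite mem_iota.
have ne x : x \in cs -> x.1 != [::] by move=> /(inv_comp I) [].
elim: (cs) ne => //= x cs' IH ne; rewrite /verts /= size_cat.
have := ne x (mem_head _ _); rewrite -size_eq0 => nx.
have : size cs' <= size (flatten [seq z.1 | z <- cs']).
  by apply: IH => y yin; apply: ne; rewrite inE yin orbT.
by move=> H; rewrite -add1n; apply: leq_add; rewrite ?lt0n.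
Qed.

(* A new vertex trades weight 3 for weight 2, a merge loses weight 2 per component, and both
   leave at most N positions to be scanned again; a raise loses 3 per vertex and regains 1. *)
Definition potential (u : nat) (F : seq nat) (cs : seq (seq nat * nat)) (p : nat -> nat) (i top : nat) : nat :=
  (N - u) + (N + 2) * (3 * (N - size F - size (verts cs)) + 2 * size cs)
  + 3 * \sum_(v < N) (n - p v) + (if cs is [::] then 0 else top - i).

(** A unit of potential pays for 500 instructions: a constant-time body is bounded by 490 and the
    loop test takes 6. Since [u] stays below [N] while a path is open, the loop can only end with an
    empty path. *)
Definition loop_inv (phi : nat) (s : env) : Prop := exists F cs p,
  [/\ arb_inv N T F cs p (vars s Var.c), rel F cs p s, static s,
      [/\ vars s Var.u <= N, (forall v, v < vars s Var.u -> v \in stack F cs) &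
        cs != [::] -> vars s Var.u < N] &
      phi = 500 * potential (vars s Var.u) F cs p (vars s Var.i) (vars s Var.top)].

Lemma push_step F cs p s : arb_inv N T F cs p (vars s Var.c) -> rel F cs p s -> static s ->
  vars s Var.u < N -> (forall v, v < vars s Var.u -> v \in stack F cs) ->
  vars s Var.t < N -> vars s Var.t \notin stack F cs ->
  (if cs is x :: _ then exists2 v, v \in x.1 & tgtN v (p v) = vars s Var.t else True) ->
  exists2 phi', loop_inv phi' (run push_cmd s) &
    500 + phi' <= 500 * potential (vars s Var.u) F cs p (vars s Var.i) (vars s Var.top).
Proof.
move=> I R S lu us lt nt lk.
have ne x : x \in cs -> x.1 != [::] by move=> /(inv_comp I) [].
have nt' : vars s Var.t \notin F ++ verts cs.
  by apply: contraNN nt; rewrite /stack !mem_cat orbCA orbA => ->.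
have I' := inv_push I lt nt' lk.
have R' := push_ok R ne nt.
have [sz _ _] := inv_sizes I'.
eexists.
  exists F, (([:: vars s Var.t], 0) :: cs), p; split; [exact: I'|exact: R'| | |reflexivity].
    by case: S.
  split; [exact: ltnW|move=> v /us|by []].
  by move=> h; rewrite /stack /verts /= inE; apply/orP; right.
rewrite /potential /= (_ : vars s Var.top + 1 - vars s Var.top = 1); last lia.
have sv : size (verts (([:: vars s Var.t], 0) :: cs)) = (size (verts cs)).+1 by [].
rewrite sv in sz *; move: (size F) (size (verts cs)) sz (size cs) (\sum_(v < N) _) => f V sz l Sg.
have -> : N - f - V = (N - f - V.+1).+1 by lia.
by move: (match cs with [::] => _ | _ :: _ => _ end) => e; nia.
Qed.

Lemma static_frame c s s' : Var.N \notin wvars c -> Arr.off \notin warrs c -> Arr.T \notin warrs c ->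
  frame c s s' -> static s -> static s'.
Proof.
move=> n1 n2 n3 [fv fa] [a b d]; split; first by rewrite fv.
  by move=> v lv; rewrite fa // b.
by move=> v j lv lj; rewrite fa // d.
Qed.

Lemma verts_merge (x : seq nat * nat) seg rest c :
  verts ((verts (x :: seg), c) :: rest) = verts (x :: seg ++ rest).
Proof. by rewrite -[x :: seg ++ rest]/((x :: seg) ++ rest) verts_cat. Qed.

Lemma sum_raise p (xs : seq nat) : bounded N T (fun v => p v + (v \in xs)) -> uniq xs -> all (gtn N) xs ->
  \sum_(v < N) (n - p v) = \sum_(v < N) (n - (p v + (val v \in xs))) + size xs.
Proof.
move=> bd ux ltx; rewrite -(sum_mem ux ltx) -big_split /=; apply: eq_bigr => v _.
by have := bd v (ltn_ord v); have := sizeT (ltn_ord v); lia.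
Qed.

Definition step_ok (phi : nat) (s : env) : Prop := exists tb, tri arborescence_body s tb
  (fun s2 => exists2 phi', loop_inv phi' s2 & tb + 6 + phi' <= phi).

Definition live F cs p s : Prop :=
  [/\ arb_inv N T F cs p (vars s Var.c), rel F cs p s, static s, vars s Var.u < N &
      forall v, v < vars s Var.u -> v \in stack F cs].

Definition time_left F cs p s : nat :=
  500 * potential (vars s Var.u) F cs p (vars s Var.i) (vars s Var.top).

Lemma start_step F p s : live F [::] p s -> step_ok (time_left F [::] p s) s.
Proof.
move=> [I R S lu us]; exists 490; apply: tri_ifF.
- by rewrite /= (rel_f R) (rel_top R) size_stack.
- by [].
rewrite [texp _ + _ + _]/=; case: (boolP (vars s Var.u \in stack F [::])) => us'.
  have pu : 0 < arrs s Arr.pos (vars s Var.u).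
    by rewrite (rel_pos R (ltnW lu)) subn_gt0 index_mem.
  apply: tri_run => //; rewrite /= pu.
  exists (500 * potential (vars s Var.u).+1 F [::] p (vars s Var.i) (vars s Var.top)).
    exists F, [::], p; split=> //=; rewrite ?addn1 //; first by case: R.
    split=> //.
    by move=> v; rewrite ltnS leq_eqVlt => /orP [/eqP ->|/us].
  rewrite /time_left /potential; set A := _ * (_ + _ * _); set B := 3 * _; lia.
have pu : arrs s Arr.pos (vars s Var.u) = 0.
  by apply/eqP; rewrite (rel_pos R (ltnW lu)) subn_eq0 leqNgt index_mem.
apply: tri_run => //.
have -> : run start_cmd s = if 0 < arrs s Arr.pos (vars s Var.u)
  then setv (setv s Var.t (vars s Var.u)) Var.u (vars s Var.u + 1)
  else run push_cmd (setv s Var.t (vars s Var.u)) by [].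
rewrite pu ltnn.
have R1 : rel F [::] p (setv s Var.t (vars s Var.u)) by case: R.
have [//|phi' L le] := @push_step F [::] p (setv s Var.t (vars s Var.u)) I R1 S lu us lu us'.
by exists phi' => //; apply: leq_trans le; rewrite leq_add2r.
Qed.

Lemma raise_step F x cs' p s : live F (x :: cs') p s -> vars s Var.top <= vars s Var.i ->
  step_ok (time_left F (x :: cs') p s) s.
Proof.
move=> [I R S lu us] le.
have [ne ux ltx _ _] := inv_comp I (mem_head _ _).
have [sz _ _] := inv_sizes I.
have nx : 0 < size x.1 by rewrite lt0n size_eq0.
have vx : verts (x :: cs') = x.1 ++ verts cs' by [].
exists (size x.1 * 100 + 200); apply: tri_ifT; first by rewrite /= (rel_f R) (rel_top R) size_stack vx size_cat; lia.
  by rewrite /=; lia.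
rewrite [texp _ + _ + _]/=; apply: tri_ifF => //; first by rewrite /=; lia.
rewrite [texp _ + _ + _]/=.
have tin : {in x.1, forall v, tgtN v (p v) \in x.1}.
  have [lb li H] := rel_scan R; move=> v vin; apply: H.
  by rewrite (_ : _ - _ = 0) ?drop0 //; apply/eqP; rewrite subn_eq0.
have I' := inv_raise I tin.
apply: tri_weaken (raise_ok x.2.+1 R ux ltx) _ _; first by lia.
move=> s' [fr [R' Ei Ec]].
have Eu : vars s' Var.u = vars s Var.u by rewrite (proj1 fr).
eexists.
  exists F, ((x.1, x.2.+1) :: cs'), (fun v => p v + (v \in x.1)); split; [by rewrite Ec|exact: R'| | |reflexivity].
    exact: static_frame fr S.
  by rewrite Eu; split=> //; apply: ltnW.
(* The pointer sum drops by [size x.1] with weight 3: one share refills the scan term, the other two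
   pay for the raise. *)
rewrite Eu /time_left /potential Ei (rel_top R').
have [Eb lb] := chain_last (rel_chain R'); rewrite /= in Eb lb.
have -> : size (stack F ((x.1, x.2.+1) :: cs')) - vars s' Var.b = size x.1.
  by rewrite Eb subKn.
rewrite (sum_raise (inv_bounded I') ux ltx) -[verts (_ :: _)]/(verts (x :: cs')) -[size (_ :: _)]/(size (x :: cs')).
by rewrite /=; set A := _ * (_ + _ * _); set B := \sum_(v < N) _; lia.
Qed.

Lemma scan_step F x cs' p s : live F (x :: cs') p s -> vars s Var.i < vars s Var.top ->
  step_ok (time_left F (x :: cs') p s) s.
Proof.
move=> [I R S lu us] li.
have [ne ux ltx _ _] := inv_comp I (mem_head _ _).
have [sz lcs ltv] := inv_sizes I.
have nx : 0 < size x.1 by rewrite lt0n size_eq0.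
have vx : verts (x :: cs') = x.1 ++ verts cs' by [].
have fp : vars s Var.f < vars s Var.top by rewrite (rel_f R) (rel_top R) size_stack vx size_cat; lia.
have [lb _ scanned] := rel_scan R.
have [Eb lex] := chain_last (rel_chain R).
have Et := rel_top R.
set W := stack F (x :: cs') in Eb lex Et.
pose j := size W - (vars s Var.i).+1.
have lj : j < size x.1 by rewrite /j; lia.
pose v := nth 0 x.1 j.
have vin : v \in x.1 by apply: mem_nth.
have lv : v < N by apply: (allP ltx).
have st_i : arrs s Arr.st (vars s Var.i) = v.
  by rewrite (rel_st R) -/W -/j ?nth_stack_top // -Et.
pose t := tgtN v (p v).
have ltN : t <= N by apply: tgt_le.
pose q := size W - index t W.
pose s1 := setv (setv (setv s Var.v v) Var.t t) Var.q q.
have run1 : run (CSeq (CSet Var.v (EArr Arr.st (EVar Var.i)))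
    (CSeq (CSet Var.t (EArr Arr.T (EAdd (EArr Arr.off (EVar Var.v)) (EArr Arr.p (EVar Var.v)))))
      (CSet Var.q (EArr Arr.pos (EVar Var.t))))) s = s1.
  have [_ Soff ST] := S.
  rewrite /= st_i Soff // (rel_p R) // ST //; last exact: (inv_bounded I).
  by rewrite (rel_pos R).
have R1 : rel F (x :: cs') p s1 by case: R.
have S1 : static s1 by case: S.
have bq : (vars s Var.b < q) = (t \in x.1).
  have := mem_stack_prefix F [:: x] cs' t; have -> : verts [:: x] = x.1 by rewrite /verts /= cats0.
  move=> <-.
  by rewrite -/W /q Eb; have := index_size t W; lia.
have fq : (vars s Var.f < q) = (t \in verts (x :: cs')).
  have := mem_stack_prefix F (x :: cs') [::] t; rewrite cats0 => <-.
  rewrite -/W /q (rel_f R); have := size_stack F (x :: cs'); rewrite -/W.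
  by have := index_size t W; lia.
have q0 : (0 < q) = (t \in W) by rewrite /q subn_gt0 index_mem.
have start T0 tb (Q : env -> Prop) : 200 + T0 <= tb ->
    tri (CIf (ECst 0) (EVar Var.q)
      (CIf (EVar Var.f) (EVar Var.q)
        (CIf (EVar Var.b) (EVar Var.q) (CSet Var.i (EAdd (EVar Var.i) (ECst 1)))
          (CSeq merge_loop (CSet Var.i (EVar Var.b))))
        (CSet Var.f (EVar Var.top))) push_cmd) s1 T0 Q ->
    tri arborescence_body s tb Q.
  move=> le H; apply: tri_ifT => //; first by rewrite /=; lia.
  rewrite [texp _ + _ + _]/=; apply: tri_ifT => //; first by rewrite /=; lia.
  rewrite [texp _ + _ + _]/=; apply: tri_step; [by []|by rewrite /=; lia|].
  rewrite run1; apply: tri_weaken H _ _ => //.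
  by rewrite [tmax _]/=; lia.
(* Four outcomes, in this order: the target is unvisited, finished, in the current component, or in
   an earlier component of the path. *)
case: (boolP (t \in W)) => tW; last first.
  exists 490; apply: (start 250) => //; apply: tri_ifF; [by rewrite /= leqNgt q0|by []|].
  rewrite [texp _ + _ + _]/=; apply: tri_run; [by []| |by []].
  have tN : t < N.
    by rewrite ltn_neqAle ltN andbT; apply: contraNneq tW => ->; rewrite !mem_cat mem_head !orbT.
  have [|phi' L le] := @push_step F (x :: cs') p s1 I R1 S1 lu us tN tW; first by exists v.
  by exists phi' => //; apply: leq_trans (_ : 500 + phi' <= _); [lia|exact: le].
case: (boolP (t \in verts (x :: cs'))) => tv; last first.
  exists 490; apply: (start 250) => //; apply: tri_ifT; [by rewrite /= q0|by []|].
  rewrite [texp _ + _ + _]/=; apply: tri_ifF; [by rewrite /= leqNgt fq|by []|].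
  rewrite [texp _ + _ + _]/=; apply: tri_run; [by []| |by []].
  have tF : tgtN v (p v) \in N :: F.
    by rewrite inE; move: tW; rewrite mem_cat (negbTE tv) /= mem_cat mem_seq1 orbC.
  have I' := inv_finish I vin tF.
  eexists.
    exists (verts (x :: cs') ++ F), [::], p; split; [exact: I'| |by case: S| |reflexivity].
      have EW : stack (verts (x :: cs') ++ F) [::] = W by rewrite /stack /= -catA.
      case: R => Rf Rt Rst Rpos Rp Rc Rs; split; rewrite ?EW //=.
      by rewrite -/W in Rt; rewrite Rt /W size_stack size_cat addnS.
    split=> /=; [exact: ltnW| |by []].
    by move=> w /us; rewrite /stack /= -catA.
  rewrite /time_left /potential /= size_cat.
  have -> : N - (size (verts (x :: cs')) + size F) - 0 = N - size F - size (verts (x :: cs')) by lia.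
  by move: (N - _ - _) (\sum_(v < N) _) => a b; nia.
case: (boolP (t \in x.1)) => tx.
  exists 490; apply: (start 250) => //; apply: tri_ifT; [by rewrite /= q0|by []|].
  rewrite [texp _ + _ + _]/=; apply: tri_ifT; [by rewrite /= fq|by []|].
  rewrite [texp _ + _ + _]/=; apply: tri_ifT; [by rewrite /= bq|by []|].
  rewrite [texp _ + _ + _]/=; apply: tri_run; [by []| |by []].
  eexists.
    exists F, (x :: cs'), p; split; [exact: I| |by case: S| |reflexivity].
      case: R => Rf Rt Rst Rpos Rp Rc Rs; split=> //=; split; try lia.
      move=> w; rewrite Et addn1 -/j (drop_nth 0 lj) inE => /orP [/eqP -> //|].
      have -> : j.+1 = vars s Var.top - vars s Var.i by rewrite /j Et; lia.
      exact: scanned.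
    by split=> //=; apply: ltnW.
  rewrite /time_left /potential /=; move: (_ * _) (3 * \sum_(v < N) _) => a b.
  by have : vars s Var.top - (vars s Var.i + 1) = (vars s Var.top - vars s Var.i).-1; lia.
(* At least one component vanishes and releases [2 * (N + 2)] units, enough for rescanning at most
   [N] positions and for walking down at most [N] blocks. *)
exists (490 + size cs' * 100); apply: (start (250 + size cs' * 100)); first lia.
apply: tri_ifT; [by rewrite /= q0|by rewrite /=; lia|].
rewrite [texp _ + _ + _]/=; apply: tri_ifT; [by rewrite /= fq|by rewrite /=; lia|].
rewrite [texp _ + _ + _]/=; apply: tri_ifF; [by rewrite /= leqNgt bq|by rewrite /=; lia|].
rewrite [texp _ + _ + _]/=.
apply: (tri_seq (t1 := size cs' * 100 + 100) (t2 := 20)); last by lia.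
apply: tri_weaken (merge_loop_ok R1 (t := t) erefl tv tx) _ _ => //.
move=> s2 [fr [seg [rest [Ecs' tl ls ch]]]]; apply: tri_run => //.
have I' : arb_inv N T F ((verts (x :: seg), path_cost (x :: seg)) :: rest) p (vars s Var.c).
  by apply: inv_merge vin tl; rewrite -Ecs'.
have EW : stack F ((verts (x :: seg), path_cost (x :: seg)) :: rest) = W.
  by rewrite /stack verts_merge -Ecs'.
have [fv fa] := fr.
have [Ebv lev] := ch; rewrite -/W in Ebv.
eexists.
  exists F, ((verts (x :: seg), path_cost (x :: seg)) :: rest), p.
  split; [by rewrite /= fv| | | |reflexivity].
  - case: R => Rf Rt Rst Rpos Rp Rc Rs; split; rewrite ?EW /=.
    + by rewrite fv.
    + by rewrite fv.
    + by move=> y ly; rewrite fa // Rst.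
    + by move=> y ly; rewrite fa // Rpos.
    + by move=> y ly; rewrite fa // Rp.
    + by rewrite fa.
    + rewrite (fv Var.top) // -[vars s1 Var.top]/(vars s Var.top) Et leqnn; split=> //; first by rewrite -Ebv leq_addr.
      by move=> w; rewrite drop_oversize // -Ebv addKn.
  - by apply: (static_frame _ _ _ fr S1).
  - by rewrite EW /= fv; split=> //; apply: ltnW.
rewrite /time_left /potential verts_merge -Ecs' /= (fv Var.u) // (fv Var.top) //= Et -Ebv addKn.
have lv2 : size (verts (x :: seg)) <= N.
  by move: sz; rewrite Ecs' -[x :: seg ++ rest]/((x :: seg) ++ rest) verts_cat size_cat; lia.
have lcs' : size cs' <= N by move: lcs => /=; lia.
have E2 : size cs' = size seg + size rest by rewrite Ecs' size_cat.
move: (size (verts (x :: seg))) (size seg) (size rest) (size cs') lv2 lcs' E2 ls => a b d e h1 h2 h3 h4.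
by move: (N - _ - _) (\sum_(w < N) _) => g1 g2; nia.
Qed.

Lemma arborescence_cmd_ok s : static s -> (forall a, arrs s Arr.pos a = 0) ->
  (forall a, arrs s Arr.p a = 0) ->
  tri arborescence_cmd s (500 * (N + (N + 2) * (3 * N) + 3 * (N * n)) + 200) (fun s' =>
    frame arborescence_cmd s s' /\
    ((exists j, [/\ acyclic N T j, bounded N T j & \sum_(v < N) j v = vars s' Var.c]) /\
     (forall j, acyclic N T j -> bounded N T j -> vars s' Var.c <= \sum_(v < N) j v))).
Proof.
move=> S pos0 p0; apply: tri_framed; have [SN _ _] := S.
apply: tri_step; [by []|by rewrite /=; lia|]; set s0 := run _ _.
have S0 : static s0 by case: S.
pose phi := 500 * potential 0 [::] [::] (fun _ => 0) 1 1.
have L0 : loop_inv phi s0.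
  exists [::], [::], (fun _ => 0); split=> //; first exact: inv_init.
    split=> //=.
    - by case=> //= _; rewrite SN.
    - move=> v lv; rewrite SN eq_sym; case: eqP => //= _; by rewrite pos0.
apply: tri_weaken (tri_while (Inv := loop_inv) _ L0) _ _; last 1 first.
- move=> s' [[phi' [F [cs [p [I R [SN' _ _] [ul us uc] _]]]]] _ g].
  rewrite /= SN' in g; have Eu : vars s' Var.u = N by lia.
  have Ecs : cs = [::] by case: (cs) uc => // x cs' /(_ isT); rewrite Eu ltnn.
  rewrite Ecs in I; apply: inv_optimal I _ => v lv.
  have := us v; rewrite Eu Ecs => /(_ lv); rewrite /stack /= mem_cat mem_seq1.
  by rewrite (ltn_eqF lv) orbF.
- move=> phi1 s1 [F [cs [p [I R S1 [ul us uc] ->]]]] fr g.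
  have lu : vars s1 Var.u < N by move: g; rewrite /=; case: S1 => ->.
  case: cs I R us uc => [|x cs] I R us uc; first exact: start_step.
  case: (ltnP (vars s1 Var.i) (vars s1 Var.top)) => li.
    exact: scan_step.
  exact: raise_step.
rewrite /phi /potential /= big_const_ord iter_addn_0 subn0 !subn0 addn0 muln0 addn0.
by rewrite /=; lia.
Qed.

End Loop.

(** * The solver and its input encoding *)

Lemma layout_cmd_ok n inp (base := n * n + n * n + n + 2) : inp 0 = n ->
  tri inp base layout_cmd (Env (fun _ => 0) (fun _ _ => 0)) (n * 100 + 100) (fun s' =>
    [/\ vars s' Var.n = n, vars s' Var.nn = n * n, vars s' Var.base = base &
      forall j a, arrs s' j a = 0]).
Proof.
move=> inp0.
do 3 (apply: tri_step; [by []|by rewrite /=; lia|]).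
set s0 := run _ _ _ _.
have [e1 e2 e3] : [/\ vars s0 Var.n = n, vars s0 Var.a = 0 & vars s0 Var.nn = 0].
  by rewrite /s0 /= flat_inp // /base; lia.
pose I k (s1 : env) := vars s1 Var.nn = k * n.
apply: (tri_seq (t1 := n * 80 + 10) (t2 := 50)); last by rewrite /=; lia.
apply: tri_weaken (tri_for (P := I) (tb := 60) (m := n) (k0 := 0) _ _ _ _ _ _) _ _ => //.
- move=> k s1 lk E fr sa; apply: tri_run => //=.
  by rewrite /I /= sa E (proj1 fr) // e1; split; lia.
- by rewrite subn0; lia.
move=> s' [E [fv fa] _]; apply: tri_run => //=.
by rewrite (fv Var.n) // e1 E; split=> // j a; rewrite fa.
Qed.

Section Main.
Variables (n ell : nat) (L : nat -> seq nat) (P : nat -> nat) (inp : nat -> nat).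
Let base := n * n + n * n + n + 2.
Local Notation tri := (tri inp base).

Hypothesis inp1 : inp 1 = ell.
Hypothesis inpL : forall a k, a < n + n -> k < n -> inp (a * n + k + 2) = nth 0 (L a) k.
Hypothesis inpP : forall a, a < n -> inp (n * n + n * n + 2 + a) = P a.
Hypothesis sizeL : forall a, a < n + n -> size (L a) = n.
Hypothesis uniqL : forall a, a < n + n -> uniq (L a).
Hypothesis memL : forall a y, a < n + n -> (y \in L a) = (y < n).
Hypothesis ltP : forall a, a < n + n -> P a < n.
Hypothesis PK : forall a, a < n + n -> P (opp n a + P a) = loc n a.

Definition affordable : Prop := exists j,
  [/\ acyclic (n + n) (target_list n L P) j, bounded (n + n) (target_list n L P) j &
    blocking_count n L P + \sum_(v < n + n) j v <= ell].

Lemma target_list_lt v x : v < n + n -> x \in target_list n L P v -> x < n + n.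
Proof.
move=> lv /mapP [y]; rewrite mem_filter memL // => /andP [_ ly] ->.
rewrite /target_of; have lz : opp n v + y < n + n by rewrite /opp; case: ifP; lia.
by have := ltP lz; rewrite {2}/opp; case: ifP; lia.
Qed.

Definition main_time : nat :=
  ((n + n) * 100 + 100) + ((n * 100 + 100) + (((n + n) * (n * 100 + 100) + 100) +
  (((n + n) * (n * 300 + 300) + 100) +
  ((500 * (n + n + (n + n + 2) * (3 * (n + n)) + 3 * ((n + n) * n)) + 200) + 100)))).

Lemma main_cmd_ok s : vars s Var.n = n -> vars s Var.nn = n * n ->
  (forall j a, arrs s j a = 0) ->
  tri main_cmd s main_time (fun s' => vars s' Var.ans = 1 <-> affordable).
Proof.
move=> sn snn s0.
apply: tri_seq (leqnn _); apply: tri_weaken (offsets_cmd_ok inp sn) (leqnn _) _.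
move=> s1 [[fv1 fa1] [N1 tab1]].
have n1 : vars s1 Var.n = n by rewrite fv1.
have nn1 : vars s1 Var.nn = n * n by rewrite fv1.
apply: tri_seq (leqnn _); apply: tri_weaken (partners_cmd_ok inpP ltP PK n1 nn1) (leqnn _) _.
move=> s2 [[fv2 fa2] tab2].
have n2 : vars s2 Var.n = n by rewrite fv2.
have N2 : vars s2 Var.N = n + n by rewrite fv2.
have off2 : offsets_spec n s2 by move=> a la; rewrite fa2 //; case: (tab1 a la).
apply: tri_seq (leqnn _); apply: tri_weaken (ranks_cmd_ok inpL sizeL uniqL memL n2 N2 off2) (leqnn _) _.
move=> s3 [[fv3 fa3] tab3].
have n3 : vars s3 Var.n = n by rewrite fv3.
have N3 : vars s3 Var.N = n + n by rewrite fv3.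
have off3 : offsets_spec n s3 by move=> a la; rewrite fa3 // off2.
have opp3 a : a < n + n -> arrs s3 Arr.opp a = opp n a.
  by move=> la; rewrite fa3 // fa2 //; case: (tab1 a la).
have pl3 a : a < n + n -> arrs s3 Arr.pl a = P a by move=> la; rewrite fa3 // tab2.
apply: tri_seq (leqnn _).
apply: tri_weaken (targets_cmd_ok inpL sizeL uniqL memL ltP n3 N3 off3 opp3 pl3 tab3) (leqnn _) _.
move=> s4 [[fv4 fa4] [tab4 blk4]].
have st4 : static n (target_list n L P) s4.
  split; [by rewrite fv4|by move=> v lv; rewrite fa4 // off3|exact: tab4].
have pos4 a : arrs s4 Arr.pos a = 0 by rewrite fa4 // fa3 // fa2 // fa1.
have p4 a : arrs s4 Arr.p a = 0 by rewrite fa4 // fa3 // fa2 // fa1.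
apply: tri_seq (leqnn _).
apply: tri_weaken (arborescence_cmd_ok inp base (size_target_list sizeL memL ltP) target_list_lt st4 pos4 p4) (leqnn _) _.
move=> s5 [[fv5 fa5] [[j [ac bd Ej]] opt]].
apply: tri_run => //; rewrite /= flat_inp; last by rewrite /base; lia.
rewrite inp1 (fv5 Var.blk) // blk4 addn1 ltnS; case: ifP => le /=; split=> //.
  by move=> _; exists j; rewrite Ej.
move=> [j' [ac' bd' le']]; have := opt j' ac' bd'.
by move: le; rewrite leqNgt => /negbFE; lia.
Qed.

End Main.

(** The base address depends on [n], so a first stage computes it without arrays and moves it to
    register 0. The last stage overwrites cell 0 with the answer. *)
Definition solver : seq instr :=
  ccmd layout_cmd 0 ++ [:: Iconst (tmp 1) 0; Iadd (tmp 0) (reg Var.base) (tmp 1)] ++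
  ccmd main_cmd (scmd layout_cmd + 2) ++
  [:: Iconst (tmp 1) 0; Istore (tmp 1) (reg Var.ans); Ihalt].

Lemma exec_solver input base T1 T2 (Q1 : env -> Prop) (Q2 : env -> Prop) :
  size input <= base -> 0 < base ->
  tri (nth 0 input) base layout_cmd (Env (fun _ => 0) (fun _ _ => 0)) T1 Q1 ->
  (forall s, Q1 s -> vars s Var.base = base /\ tri (nth 0 input) base main_cmd s T2 Q2) ->
  exists s st, [/\ exec solver (T1 + T2 + 10) (init_state input) = Some st, Q2 s &
    ram_mem st 0 = vars s Var.ans].
Proof.
move=> szi b0 [t1 [s1 [B1 le1 q1]]] /(_ s1 q1) [Eb [t2 [s2 [B2 le2 q2]]]].
have C : code_at solver 0 solver by exists [::]; rewrite ?drop0 ?cats0.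
move: C; rewrite {2}/solver => /code_at_cat [C1 /code_at_cat []].
rewrite add0n size_ccmd => /code_at_cons [E1 /code_at_cons [E2 _]] /code_at_cat [].
rewrite [size _]/= => C2; rewrite size_ccmd => /code_at_cons [E3 /code_at_cons [E4 /code_at_cons [E5 _]]].
have ag0 : agrees (nth 0 input) base false (Env (fun _ => 0) (fun _ _ => 0)) (init_state input).
  (* Memory beyond the input is zero, which is precisely an environment whose arrays are all
     zero. *)
  split=> // a; rewrite /flat /=; case: ltnP => // le; rewrite nth_default //; exact: leq_trans le.
have [[pc1 R1 M1] S1 [[a1 b1 _] P1]] := ccmd_correct B1 (isT : wfcmd false layout_cmd) ag0 erefl C1.
rewrite /= add0n in a1 b1 P1; subst pc1.
pose m2 := State (scmd layout_cmd).+2 (upd (upd R1 (tmp 1) 0) (tmp 0) base) M1.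
have S2 : steps solver 2 (State (scmd layout_cmd) R1 M1) m2.
  apply: step1; [exact: E1|by []|rewrite /step /fetch [ram_pc _]/= E1].
  apply: step1; [exact: E2|by []|rewrite /step /fetch [ram_pc _]/= E2].
  rewrite [ram_regs _]/= [ram_mem _]/= (_ : State _ _ _ = m2); first exact: Steps0.
  rewrite /m2; congr (State _ (upd _ _ _) _).
  by rewrite /upd regE eqxx addn0 a1.
have ag2 : agrees (nth 0 input) base true s1 m2.
  by split=> // x; rewrite /= ?regE.
have C2' : code_at solver (scmd layout_cmd + 2) (ccmd main_cmd (scmd layout_cmd + 2)) by [].
have [[pc3 R3 M3] S3 [[a3 b3 _] P3]] :=
  ccmd_correct B2 (isT : wfcmd true main_cmd) ag2 (esym (addn2 _)) C2'.
rewrite /= in a3 b3 P3; subst pc3.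
set o3 := _ + _ in S3 E3 E4 E5.
pose m4 := State o3.+2 (upd R3 (tmp 1) 0) (upd M3 0 (vars s2 Var.ans)).
have S4 : steps solver 2 (State o3 R3 M3) m4.
  apply: step1; [exact: E3|by []|rewrite /step /fetch [ram_pc _]/= E3].
  apply: step1; [exact: E4|by []|rewrite /step /fetch [ram_pc _]/= E4].
  rewrite [ram_regs _]/= [ram_mem _]/= (_ : State _ _ _ = m4); first exact: Steps0.
  rewrite /m4 {1 3}/upd eqxx; congr (State _ _ (upd _ _ _)).
  exact: a3.
exists s2, m4; split=> //.
rewrite (_ : T1 + T2 + 10 = (t1 + (2 + (t2 + 2))) + (T1 + T2 + 10 - (t1 + (2 + (t2 + 2))))); last lia.
rewrite (exec_steps _ (steps_cat S1 (steps_cat S2 (steps_cat S3 S4)))).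
by apply: exec_halted; rewrite /is_halted /fetch E5.
Qed.

Lemma exec_mono prog t d s s' : exec prog t s = Some s' -> exec prog (t + d) s = Some s'.
Proof.
elim: t s => [|t IH] s /=; first by case: ifP => // h [<-]; rewrite exec_halted.
by case: ifP => // _; apply: IH.
Qed.

(** * Reading the instance off its encoding *)

Lemma size_flatten_uniform n (ss : seq (seq nat)) : (forall s, s \in ss -> size s = n) ->
  size (flatten ss) = size ss * n.
Proof.
elim: ss => //= s ss IH H; rewrite size_cat H ?mem_head // IH ?mulSn // => t tin.
by apply: H; rewrite inE tin orbT.
Qed.

Lemma nth_flatten_uniform n (ss : seq (seq nat)) a k : (forall s, s \in ss -> size s = n) ->
  a < size ss -> k < n -> nth 0 (flatten ss) (a * n + k) = nth 0 (nth [::] ss a) k.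
Proof.
elim: ss a => //= s ss IH [|a] H la lk; rewrite nth_cat H ?mem_head //; first by rewrite lk.
rewrite mulSn -addnA ltnNge leq_addr /= addKn IH // => t tin.
by apply: H; rewrite inE tin orbT.
Qed.

Section Agents.
Variables (n : nat) (pM pW : 'I_n -> seq 'I_n) (mu : {perm 'I_n}) (ell : nat).
Hypothesis SM : SM_instance pM pW.

(* Men and women are numbered jointly, man m as m and woman w as n + w; the lists
   contain positions within the opposite side. *)
Definition agent_list (a : nat) : seq nat :=
  if insub a is Some m then map val (pM m)
  else if insub (a - n) is Some w then map val (pW w) else [::].

Definition agent_partner (a : nat) : nat :=
  if insub a is Some m then val (mu m)
  else if insub (a - n) is Some w then val ((mu^-1)%g w) else 0.

Lemma insub_ord (m : 'I_n) : insub (val m) = Some m :> option 'I_n.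
Proof. by rewrite insubT //= => lt; congr Some; apply: val_inj. Qed.

Lemma insub_ge (w : nat) : insub (n + w) = None :> option 'I_n.
Proof. by rewrite insubF // ltnNge leq_addr. Qed.

Lemma agent_list_man (m : 'I_n) : agent_list m = map val (pM m).
Proof. by rewrite /agent_list insub_ord. Qed.

Lemma agent_list_woman (w : 'I_n) : agent_list (n + w) = map val (pW w).
Proof. by rewrite /agent_list insub_ge addKn insub_ord. Qed.

Lemma agent_partner_man (m : 'I_n) : agent_partner m = mu m.
Proof. by rewrite /agent_partner insub_ord. Qed.

Lemma agent_partner_woman (w : 'I_n) : agent_partner (n + w) = (mu^-1)%g w.
Proof. by rewrite /agent_partner insub_ge addKn insub_ord. Qed.

Lemma opp_man (m : 'I_n) : opp n m = n. Proof. by rewrite /opp ltn_ord. Qed.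
Lemma opp_woman w : opp n (n + w) = 0. Proof. by rewrite /opp ltnNge leq_addr. Qed.
Lemma loc_man (m : 'I_n) : loc n m = m. Proof. by rewrite /loc opp_man addnK. Qed.
Lemma loc_woman w : loc n (n + w) = w. Proof. by rewrite /loc opp_woman addn0 addKn. Qed.

Lemma size_list (l : seq 'I_n) : perm_eq l (enum 'I_n) -> size l = n.
Proof. by move=> /perm_size ->; rewrite size_enum_ord. Qed.

Lemma size_agent_list a : a < n + n -> size (agent_list a) = n.
Proof.
move=> /vertex_cases [[m ->]|[w ->]]; have := SM.
  by move=> /(_ m) [/size_list E _]; rewrite agent_list_man size_map.
by move=> /(_ w) [_ /size_list E]; rewrite agent_list_woman size_map.
Qed.

Lemma uniq_agent_list a : a < n + n -> uniq (agent_list a).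
Proof.
by move=> /vertex_cases [[m ->]|[w ->]];
  rewrite ?agent_list_man ?agent_list_woman map_inj_uniq ?(SM_uniq SM) //; apply: val_inj.
Qed.

Lemma mem_agent_list a y : a < n + n -> (y \in agent_list a) = (y < n).
Proof.
move=> la; have [l El ml] : exists2 l : seq 'I_n, agent_list a = map val l & forall i, i \in l.
  move: la => /vertex_cases [[m ->]|[w ->]].
    by exists (pM m); rewrite ?agent_list_man // => i; rewrite (SM_mem SM).
  by exists (pW w); rewrite ?agent_list_woman // => i; rewrite (SM_mem SM).
rewrite El; apply/mapP/idP => [[i _ ->]|ly]; [exact: ltn_ord|by exists (Ordinal ly)].
Qed.

Lemma agent_partner_lt a : a < n + n -> agent_partner a < n.
Proof.
by move=> /vertex_cases [[m ->]|[w ->]]; rewrite ?agent_partner_man ?agent_partner_woman ltn_ord.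
Qed.

Lemma agent_partnerK a : a < n + n -> agent_partner (opp n a + agent_partner a) = loc n a.
Proof.
move=> /vertex_cases [[m ->]|[w ->]].
  by rewrite agent_partner_man opp_man agent_partner_woman permK loc_man.
by rewrite agent_partner_woman opp_woman agent_partner_man permKV loc_woman.
Qed.

Lemma index_val (l : seq 'I_n) i : index (val i) (map val l) = index i l.
Proof. by rewrite index_map //; apply: val_inj. Qed.

Lemma beats_man (m w : 'I_n) :
  beats n agent_list agent_partner m w = prefers (pW w) m ((mu^-1)%g w).
Proof.
by rewrite /beats opp_man loc_man agent_list_woman agent_partner_woman !index_val.
Qed.

Lemma beats_woman (m w : 'I_n) :
  beats n agent_list agent_partner (n + w) m = prefers (pM m) w (mu m).
Proof.
by rewrite /beats opp_woman loc_woman agent_list_man agent_partner_man !index_val.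
Qed.

Lemma target_list_agents v : v < n + n ->
  target_list n agent_list agent_partner v = targets pM pW mu v.
Proof.
move=> /vertex_cases [[m ->]|[w ->]].
  rewrite targets_man /man_targets /target_list agent_list_man filter_map -map_comp.
  transitivity [seq val ((mu^-1)%g w) | w <- pM m & is_target n agent_list agent_partner m (val w)].
    by apply: eq_map => w /=; rewrite /target_of opp_man opp_woman agent_partner_woman.
  congr map; apply: eq_filter => w /=.
  by rewrite /is_target beats_man agent_partner_man agent_list_man !index_val /prefers invgK.
rewrite targets_woman /woman_targets /target_list agent_list_woman filter_map -map_comp.
transitivity [seq n + val (mu m) | m <- pW w & is_target n agent_list agent_partner (n + w) (val m)].
  by apply: eq_map => m /=; rewrite /target_of opp_woman add0n opp_man agent_partner_man.
congr map; apply: eq_filter => m /=.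
by rewrite /is_target beats_woman agent_partner_woman agent_list_woman !index_val /prefers.
Qed.

Lemma card_blocking : #|blocking pM pW mu| = blocking_count n agent_list agent_partner.
Proof.
rewrite -sum1_card big_mkcond /=; under eq_bigr => p _ do rewrite inE.
rewrite -(pair_bigA _ (fun m w => if prefers (pM m) w (mu m) && prefers (pW w) m ((mu^-1)%g w) then 1 else 0)) /=.
apply: eq_bigr => m _; rewrite agent_list_man count_map -big_mkcond -sum1_count /=.
have [p _] := SM m; rewrite (perm_big _ p) /= big_enum_cond /=; apply: eq_bigl => w.
by rewrite /is_blocking beats_man agent_partner_man agent_list_man !index_val.
Qed.

Lemma affordable_EUDA : affordable n ell agent_list agent_partner <-> EUDA pM pW mu ell.
Proof.
rewrite (EUDA_choice mu SM) /affordable card_blocking.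
have E : {in gtn (n + n), target_list n agent_list agent_partner =1 targets pM pW mu}.
  by move=> v lv; apply: target_list_agents.
split=> [] [j [ac bd le]]; exists j; split=> //.
- by move=> A HA; apply: ac => v Av; have [lv] := HA v Av; rewrite /tgt -E.
- by move=> v lv; rewrite -E //; apply: bd.
- by move=> A HA; apply: ac => v Av; have [lv] := HA v Av; rewrite /tgt E.
- by move=> v lv; rewrite E //; apply: bd.
Qed.

Let input := encode pM pW mu ell.
Let lists (p : 'I_n -> seq 'I_n) := [seq map val (p i) | i <- enum 'I_n].

Lemma lists_uniform (p : 'I_n -> seq 'I_n) : (forall i, size (p i) = n) ->
  [/\ size (lists p) = n, forall s, s \in lists p -> size s = n &
    forall i : 'I_n, nth [::] (lists p) i = map val (p i)].
Proof.
move=> H; split; first by rewrite size_map size_enum_ord.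
  by move=> s /mapP [i _ ->]; rewrite size_map.
by move=> i; rewrite (nth_map i) ?size_enum_ord // nth_ord_enum.
Qed.

Lemma size_pM i : size (pM i) = n. Proof. by have [/size_list] := SM i. Qed.
Lemma size_pW i : size (pW i) = n. Proof. by have [_ /size_list] := SM i. Qed.

Lemma size_encode : size input = n * n + n * n + n + 2.
Proof.
have [a1 b1 _] := lists_uniform size_pM; have [a2 b2 _] := lists_uniform size_pW.
rewrite /input /encode !size_cat (size_flatten_uniform b1) (size_flatten_uniform b2) a1 a2.
by rewrite size_map size_enum_ord /=; lia.
Qed.

Lemma encode_list a k : a < n + n -> k < n ->
  nth 0 input (a * n + k + 2) = nth 0 (agent_list a) k.
Proof.
have [a1 b1 c1] := lists_uniform size_pM; have [a2 b2 c2] := lists_uniform size_pW.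
move=> la lk; rewrite addn2 /input /encode /=; move: la => /vertex_cases [[m ->]|[w ->]].
  have lt : m * n + k < n * n.
    have : (m.+1) * n <= n * n by rewrite leq_mul2r ltn_ord orbT.
    by rewrite mulSn; lia.
  rewrite nth_cat (size_flatten_uniform b1) a1 lt (nth_flatten_uniform b1) ?a1 ?ltn_ord //.
  by rewrite c1 agent_list_man.
have lt : w * n + k < n * n.
  have : (w.+1) * n <= n * n by rewrite leq_mul2r ltn_ord orbT.
  by rewrite mulSn; lia.
rewrite mulnDl -addnA nth_cat (size_flatten_uniform b1) a1 ltnNge leq_addr /= addKn.
rewrite nth_cat (size_flatten_uniform b2) a2 lt (nth_flatten_uniform b2) ?a2 ?ltn_ord //.
by rewrite c2 agent_list_woman.
Qed.

Lemma encode_partner a : a < n -> nth 0 input (n * n + n * n + 2 + a) = agent_partner a.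
Proof.
have [a1 b1 _] := lists_uniform size_pM; have [a2 b2 _] := lists_uniform size_pW.
move=> la; rewrite (_ : _ + 2 + a = (n * n + (n * n + a)).+2); last lia.
rewrite /input /encode /= nth_cat (size_flatten_uniform b1) a1 ltnNge leq_addr /= addKn.
rewrite nth_cat (size_flatten_uniform b2) a2 ltnNge leq_addr /= addKn.
rewrite (nth_map (Ordinal la)) ?size_enum_ord // -[a]/(val (Ordinal la)) nth_ord_enum.
by rewrite agent_partner_man.
Qed.

End Agents.

(** The phases add up to [9800 * n ^ 2 + 8200 * n + 810], of which the arborescence accounts for
    [9000 * n ^ 2 + 7000 * n]; with [n <= n ^ 2] the coefficient stays below 20000. *)
Definition time_factor : nat := 200 * 100.

Lemma total_time n : (n * 100 + 100) + main_time n + 10 <= time_factor * n ^ 2 + time_factor.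
Proof.
have : n <= n * n by case: n => // m; rewrite leq_pmulr.
by rewrite -mulnn /main_time /time_factor; nia.
Qed.

Theorem mainTheorem19 :
  exists (prog : seq instr) (c : nat),
    forall (n : nat) (pM pW : 'I_n -> seq 'I_n) (mu : {perm 'I_n}) (ell : nat),
      SM_instance pM pW ->
      exists s : state,
        exec prog (c * n ^ 2 + c) (init_state (encode pM pW mu ell)) = Some s /\
        (ram_mem s 0 = 1 <-> EUDA pM pW mu ell).
Proof.
exists solver, time_factor => n pM pW mu ell SM.
have inp0 : nth 0 (encode pM pW mu ell) 0 = n by [].
have inp1 : nth 0 (encode pM pW mu ell) 1 = ell by [].
have szi : size (encode pM pW mu ell) <= n * n + n * n + n + 2 by rewrite (size_encode mu ell SM).
have [|s1 q1|s [st [ex q Em]]] := exec_solver (Q2 := fun s => vars s Var.ans = 1 <-> EUDA pM pW mu ell)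
    (T2 := main_time n) szi _ (layout_cmd_ok inp0).
- by lia.
- case: q1 => [n1 nn1 b1 z1]; split=> //.
  have := main_cmd_ok inp1 (encode_list mu ell SM) (encode_partner mu ell SM)
    (size_agent_list SM) (uniq_agent_list SM) (fun a y => @mem_agent_list n pM pW SM a y)
    (@agent_partner_lt n mu) (@agent_partnerK n mu) n1 nn1 z1.
  move=> H; apply: tri_weaken H (leqnn _) _ => s ->; exact: affordable_EUDA.
exists st; split; last by rewrite Em.
by rewrite -(subnKC (total_time n)); apply: exec_mono.
Qed.
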